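(* Let $\alpha(x)$ be a sub-polynomial such that $\lim_{x\to+\infty}\alpha(x)=+\infty$. Suppose that, for every $p\in\mathbb{Q}[x]$ and every $c\in\mathbb{R}$, $$\lim_{x\to+\infty}\frac{|\alpha(x)-c\,p(x)|}{\log x}=+\infty.$$ Then, for every $A\subseteq\mathbb{N}$ with $\overline{d}(A)>0$, there exist distinct $x,y\in A$ and some $n\in\mathbb{N}$ such that $x+y=\lfloor\alpha(n)\rfloor$.
   Context: $\mathbb{N}=\{1,2,\dots\}$. For $A\subseteq\mathbb{N}$, $\overline{d}(A)=\limsup_{N\to\infty}\frac{|A\cap[1,N]|}{N}$. Let $\mathcal{G}$ be the ring (under pointwise addition and multiplication) of germs at $+\infty$ of continuous real-valued functions defined on half-lines $(a,+\infty)$; two functions have the same germ if they agree for all sufficiently large $x$. A Hardy field is a subfield of $\mathcal{G}$ closed under differentiation (each element is eventually differentiable and its derivative's germ lies in the field). A sub-polynomial is a function $\alpha$ whose germ belongs to some Hardy field and which satisfies $\lim_{x\to+\infty}\alpha(x)/x^l=0$ for some $l>0$. Functions and germs are not distinguished; when values $\alpha(n)$, $n\in\mathbb{N}$, appear, $\alpha$ denotes a fixed real-valued representative defined on $[1,+\infty)$. *)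

(* Defs.v *)
From HB Require Import structures.
From mathcomp Require Import all_boot all_order all_algebra finmap.
From mathcomp Require Import all_classical all_reals all_analysis.
Set Implicit Arguments.
Unset Strict Implicit.
Unset Printing Implicit Defensive.
Import Order.TTheory GRing.Theory Num.Theory.
Import numFieldNormedType.Exports.

Local Open Scope classical_set_scope.
Local Open Scope ring_scope.

(* A germ at +oo is represented by total functions [R -> R], whose values away
   from +oo are irrelevant. *)
Definition germ_eq (R : realType) (f g : R -> R) : Prop :=
  \forall x \near +oo, f x = g x.

(* A set of germs is represented by the set [H] of all representatives of its
   elements, hence the saturation condition [hardy_germ]. *)
Record is_hardy_field (R : realType) (H : set (R -> R)) : Prop := {
  hardy_germ : forall f g, H f -> germ_eq f g -> H g;
  hardy_continuous :
    forall f, H f -> \forall x \near +oo, {for x, continuous f};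
  hardy_0 : H (fun=> 0);
  hardy_1 : H (fun=> 1);
  hardy_opp : forall f, H f -> H (fun x => - f x);
  hardy_add : forall f g, H f -> H g -> H (fun x => f x + g x);
  hardy_mul : forall f g, H f -> H g -> H (fun x => f x * g x);
  hardy_inv : forall f, H f -> ~ germ_eq f (fun=> 0) ->
    exists2 g, H g & germ_eq (fun x => f x * g x) (fun=> 1);
  hardy_derivable : forall f, H f -> \forall x \near +oo, derivable f x 1;
  hardy_derive : forall f, H f -> H (derive1 f)
}.

Definition sub_polynomial (R : realType) (alpha : R -> R) : Prop :=
  (exists2 H : set (R -> R), is_hardy_field H & H alpha) /\
  (exists2 l : R, 0 < l & alpha x / x `^ l @[x --> +oo] --> 0).

(* The term N = 0 of the sequence (which is 0 / 0 = 0) does not affect the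
   limsup. *)
Definition upper_density (R : realType) (A : set nat) : \bar R :=
  limn_esup (fun N : nat =>
    (#|` fset_set (A `&` [set k : nat | (1 <= k <= N)%N])|%:R / N%:R : R)%:E).

(* Main.v *)
(** Let [d] be such that [alpha^(d+1)] is the first derivative of [alpha] that
    tends to [0].

    If [d = 0], the increments of [alpha n] tend to [0], so every large integer
    is some [floor (alpha n)].

    If [d > 0], choose [N] such that [A] has at least [delta * N] elements up to
    [N], put [Q = 2 * N + 2], and average over the [x], [y] in [A] up to [N] and
    over the [n] with [alpha n <= Q], with weights [alpha (n + 1) - alpha n].
    A trigonometric polynomial of degree [2 * Q] in
    [2 pi (alpha n - x - y - 1/2) / Q] that is positive only if
    [0 < alpha n - x - y < 1] has positive average provided that the weighted
    exponential sums with phases [2 pi j alpha n / Q], [0 < j < 2 * Q], are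
    [o(Q)].  For small [j] they are compared with an integral; for the others
    partial summation leads to unweighted sums with phases
    [2 pi s alpha n], [0 < s <= 2].

    If [alpha^(d)] tends to infinity, the [(d+1)]-st derivative test applies to
    these sums.  If [alpha^(d)] has a finite limit, the [d]-th one applies to
    small [s], and the [(d+1)]-st one to the other [s] unless
    [x^(d+1) alpha^(d+1)] is bounded.  In that last case [alpha] is a polynomial
    up to [O(log x)], and the hypothesis on [alpha] implies that, for each [s0],
    [s0] times this polynomial has an irrational coefficient; Weyl's argument
    then bounds the sums for [s] near [s0], and [s] ranges over a compact set.
    The Hardy field enters through the eventual sign of all the auxiliary
    functions. *)
Require Import Defs.
From mathcomp Require Import all_boot all_order all_algebra finmap.
From mathcomp Require Import all_classical all_reals all_analysis.
From mathcomp Require Import zify ring lra.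
Import Order.TTheory GRing.Theory Num.Theory.
Import numFieldNormedType.Exports.
Local Open Scope classical_set_scope.
Local Open Scope ring_scope.

(** * Exponential sums *)

(** An arithmetic hypothesis is unavoidable: if [alpha x = 3 * x] and [A] is the residue class of 1
    modulo 3, no [x + y] is a value of [alpha]. The weights [alpha (n + 1) - alpha n] turn the
    values of [alpha] into a discretised Lebesgue measure on [[0, Q]], whatever the growth of
    [alpha]. The target window has length 1 out of [Q], so about [2 * Q] frequencies matter, and
    bounding their contributions one by one would lose a factor [Q]. But the double sum over [x] and
    [y] is the square of one exponential sum [S j] over the chosen part [s] of [A], and Parseval
    gives [2 * Q * |s|] for the sum of all [|S j| ^ 2]. With weighted sums of size [o(Q)] the total
    error is [o(Q ^ 2 * |s|)], which positive density makes smaller than the main term, of order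
    [Q * |s| ^ 2]. This is why no rate of decay is ever needed. The diagonal [x = y] contributes at
    most one pair for each [n], hence [O(Q ^ 2)], which is negligible too. *)

Lemma sin_Lipschitz (R : realType) (x y : R) : `|sin x - sin y| <= `|x - y|.
Proof.
wlog le_yx : x y / y <= x => [hw|].
  case: (leP y x) => [/hw//|/ltW/hw]; by rewrite distrC (distrC x).
have [c _ ->] : exists2 c, c \in `[y, x] & sin x - sin y = cos c * (x - y).
  apply: (@MVT_segment _ sin cos) => //; apply: continuous_subspaceT.
  by move=> z; exact: continuous_sin.
by rewrite normrM ler_piMl // cos_max.
Qed.

Lemma cos_Lipschitz (R : realType) (x y : R) : `|cos x - cos y| <= `|x - y|.
Proof.
rewrite -!sinDpihalf; apply: le_trans (sin_Lipschitz _ _ _) _.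
by rewrite opprD addrACA subrr addr0.
Qed.

Lemma sin_taylor1 (R : realType) (x h : R) :
  `|sin (x + h) - sin x - h * cos x| <= h ^+ 2.
Proof.
have sub_mvt (a b : R) : a <= b -> exists2 c : R, a <= c <= b &
    sin b - sin a = cos c * (b - a).
  move=> ab.
  have [c cab e] : exists2 c, c \in `[a, b] & sin b - sin a = cos c * (b - a).
    apply: (@MVT_segment _ sin cos) => //; apply: continuous_subspaceT.
    by move=> z; exact: continuous_sin.
  by exists c => //; move: cab; rewrite in_itv.
have [c cx ->] : exists2 c : R, `|c - x| <= `|h| &
    sin (x + h) - sin x = h * cos c.
  case: (leP 0 h) => h0.
    have [|c /andP[h1 h2] ->] := sub_mvt x (x + h); first by lra.
    exists c; first by rewrite (ger0_norm h0) ger0_norm; lra.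
    by ring.
  have [|c /andP[h1 h2] e] := sub_mvt (x + h) x; first by lra.
  exists c; first by rewrite (ltr0_norm h0) ler0_norm; lra.
  by rewrite -opprB e; ring.
rewrite -mulrBr normrM -[h ^+ 2]real_normK ?num_real // expr2.
by apply: ler_wpM2l => //; apply: le_trans cx; exact: cos_Lipschitz.
Qed.

Section vdC.
Variables (R : realType).
Implicit Types (f : nat -> R).

Lemma sum_nat_le1 (F : nat -> R) (p m : nat) :
  (forall n, F n <= 1) -> \sum_(p <= n < m) F n <= (m - p)%:R.
Proof.
move=> F1; apply: le_trans (ler_sum _ (fun n _ => F1 n)) _.
by rewrite big_const_nat iter_addr addr0.
Qed.

Lemma sqr_cos_sin_sum (x : nat -> R) (H : nat) :
  (\sum_(0 <= h < H) cos (x h)) ^+ 2 + (\sum_(0 <= h < H) sin (x h)) ^+ 2 =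
  \sum_(0 <= h < H) \sum_(0 <= k < H) cos (x h - x k).
Proof.
rewrite !expr2 !big_distrl -big_split /=; apply: eq_bigr => h _.
rewrite !big_distrr -big_split /=; apply: eq_bigr => k _.
by rewrite cosB.
Qed.

Lemma count_near (h L H : nat) :
  (\sum_(0 <= k < H) ((h < k + L) && (k < h + L)) <= L.*2)%N.
Proof.
rewrite -big_mkcond /= sum1_count -size_filter.
rewrite -(size_iota (h.+1 - L) L.*2).
apply: uniq_leq_size; first by rewrite filter_uniq // iota_uniq.
move=> k; rewrite mem_filter => /andP[/andP[h1 h2] _].
by rewrite mem_iota; lia.
Qed.

(** Van der Corput's inequality. The sum is compared with its translates by [q * h], [h < H], at the
    cost [q * H] of the ends; squaring the average leaves correlations of [f] with its shifts. Pairs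
    of shifts closer than [L] are bounded trivially, which the condition on [L] makes affordable, so
    only lags [l >= L] need a hypothesis. Shifts by multiples of [q] will let a perturbation of
    period [q] modulo [2 * pi] cancel. *)
Lemma vdC (q H L : nat) (e M : R) f (p m : nat) (phi : R) :
  (0 < H)%N -> 0 < e -> (p <= m)%N -> (m - p)%:R <= M ->
  2 * L%:R <= e ^+ 2 / 2 * H%:R ->
  (forall l p1 m1, (L <= l < H)%N -> (p <= p1)%N -> (p1 <= m1)%N ->
     (m1 + q * l <= m)%N ->
     \sum_(p1 <= n < m1) cos (f (n + q * l)%N - f n) <= e ^+ 2 / 2 * M) ->
  \sum_(p <= n < m) cos (f n + phi) <= (q * H)%:R + e * M.
Proof.
move=> H0 e0 pm mpM LH hyp.
have M0 : 0 <= M by apply: le_trans mpM; exact: ler0n.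
have c1 (g : nat -> R) n : cos (g n + phi) <= 1 :> R by exact: cos_le1.
case: (leqP m (p + q * H)) => [mle|mgt].
  apply: (@le_trans _ _ (m - p)%:R); first exact: sum_nat_le1.
  apply: (@le_trans _ _ (q * H)%:R); first by rewrite ler_nat; lia.
  by rewrite lerDl mulr_ge0 // ltW.
set m' := (m - q * H)%N.
set c := fun n => cos (f n + phi).
have shift h : (h < H)%N ->
    \sum_(p <= n < m) c n <=
      (q * H)%:R + \sum_(p <= n < m') c (n + q * h)%N.
  move=> hH.
  have qh : (q * h <= q * H)%N by rewrite leq_mul2l ltnW ?orbT.
  rewrite (@big_cat_nat _ _ _ (p + q * h)) /=; [|lia|lia].
  rewrite (@big_cat_nat _ _ _ (m' + q * h) (p + q * h)) /=; [|lia|lia].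
  have -> : \sum_(p + q * h <= n < m' + q * h) c n =
            \sum_(p <= n < m') c (n + q * h)%N.
    by rewrite big_addn; congr bigop; congr index_iota; lia.
  have h1 := sum_nat_le1 c p (p + q * h) (c1 f).
  have h2 := sum_nat_le1 c (m' + q * h) m (c1 f).
  have : (p + q * h - p)%:R + (m - (m' + q * h))%:R <= (q * H)%:R :> R.
    by rewrite -natrD ler_nat; lia.
  by lra.
have step1 : H%:R * \sum_(p <= n < m) c n <=
   H%:R * (q * H)%:R + \sum_(p <= n < m') \sum_(0 <= h < H) c (n + q * h)%N.
  rewrite exchange_big /=.
  have -> : forall x : R, H%:R * x = \sum_(0 <= h < H) x.
    by move=> x; rewrite big_const_nat iter_addr addr0 subn0 mulr_natl.
  rewrite [X in _ <= X + _](_ : _ = \sum_(0 <= h < H) (q * H)%:R); last first.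
    by rewrite big_const_nat iter_addr addr0 subn0 mulr_natl.
  rewrite -big_split /= [leLHS]big_nat [leRHS]big_nat.
  by apply: ler_sum => h /andP[_ hH]; exact: shift.
have HR : 0 < H%:R :> R by rewrite ltr0n.
have eH : 0 < e * H%:R by rewrite mulr_gt0.
set D := fun n => \sum_(0 <= h < H) \sum_(0 <= k < H)
  cos (f (n + q * h)%N - f (n + q * k)%N).
(* AM-GM with parameter [e * H] instead of Cauchy-Schwarz: the bound is linear in [D n], so no
   square root is taken. *)
have amgm n : \sum_(0 <= h < H) c (n + q * h)%N <=
    e * H%:R / 2 + D n / (2 * (e * H%:R)).
  set a := \sum_(0 <= h < H) _.
  have aD : a ^+ 2 <= D n.
    have -> : D n = a ^+ 2 + (\sum_(0 <= h < H) sin (f (n + q * h)%N + phi)) ^+ 2.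
      rewrite (sqr_cos_sin_sum (fun h => f (n + q * h)%N + phi)).
      by apply: eq_bigr => h _; apply: eq_bigr => k _; congr cos; ring.
    by rewrite lerDl sqr_ge0.
  have am : a * (2 * (e * H%:R)) <= (e * H%:R) ^+ 2 + a ^+ 2.
    by have := sqr_ge0 (a - e * H%:R); lra.
  have t0 : 0 < 2 * (e * H%:R) by rewrite mulr_gt0.
  have e2 : D n / (2 * (e * H%:R)) * (2 * (e * H%:R)) = D n.
    by rewrite divfK // gt_eqF.
  by rewrite -(ler_pM2r t0) (mulrDl (e * H%:R / 2)) e2; lra.
have pair h k : (h < H)%N -> (k < H)%N ->
    \sum_(p <= n < m') cos (f (n + q * h)%N - f (n + q * k)%N) <=
    e ^+ 2 / 2 * M + ((h < k + L) && (k < h + L))%N%:R * M.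
  wlog kh : h k / (k <= h)%N => [hw hH kH|].
    case: (leqP k h) => [/hw|/ltnW/hw]; first exact.
    rewrite andbC => /(_ kH hH); apply: le_trans.
    by under eq_bigr do rewrite -cosN opprB.
  move=> hH kH.
  case: andP => [_|nL] /=.
    rewrite mul1r -[leLHS]add0r lerD //.
      by rewrite mulr_ge0 // divr_ge0 // sqr_ge0.
    apply: (@le_trans _ _ (m' - p)%:R); first by apply: sum_nat_le1 => n; exact: cos_le1.
    by apply: le_trans mpM; rewrite ler_nat; lia.
  rewrite mul0r addr0.
  have Lhk : (L <= h - k < H)%N.
    by apply/andP; split; last lia; rewrite leqNgt; apply/negP => h1; apply: nL; lia.
  have := hyp (h - k)%N (p + q * k)%N (m' + q * k)%N Lhk.
  have e1 : (q * k + q * (h - k) = q * h)%N by rewrite -mulnDr subnKC.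
  have e2 : (q * h <= q * H)%N by rewrite leq_mul2l ltnW ?orbT.
  move=> /(_ ltac:(clear; lia) ltac:(clear -m' mgt; lia) ltac:(clear -e1 e2 m' mgt; lia)).
  rewrite big_addn.
  have -> : (m' + q * k - q * k = m')%N by lia.
  by under eq_bigr do rewrite -addnA e1.
have Dsum : \sum_(p <= n < m') D n <= e ^+ 2 * H%:R ^+ 2 * M.
  rewrite /D exchange_big /=.
  under eq_bigr do rewrite exchange_big /=.
  apply: (@le_trans _ _ (\sum_(0 <= h < H) \sum_(0 <= k < H)
    (e ^+ 2 / 2 * M + ((h < k + L) && (k < h + L))%N%:R * M))).
    rewrite [leLHS]big_nat [leRHS]big_nat; apply: ler_sum => h /andP[_ hH].
    rewrite [leLHS]big_nat [leRHS]big_nat; apply: ler_sum => k /andP[_ kH].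
    exact: pair.
  apply: (@le_trans _ _ (\sum_(0 <= h < H) (e ^+ 2 / 2 * M * H%:R + 2 * L%:R * M))).
    apply: ler_sum => h _; rewrite big_split /= lerD //.
      by rewrite big_const_nat iter_addr addr0 subn0 mulr_natr.
    rewrite -big_distrl /= ler_wpM2r // -natr_sum -natrM ler_nat.
    by rewrite mul2n; exact: count_near.
  rewrite big_const_nat iter_addr addr0 subn0 -mulr_natr.
  have : 2 * L%:R * (M * H%:R) <= e ^+ 2 / 2 * H%:R * (M * H%:R).
    by rewrite ler_wpM2r // mulr_ge0 // ltW.
  by lra.
have step2 : \sum_(p <= n < m') \sum_(0 <= h < H) c (n + q * h)%N <=
    H%:R * (e * M).
  apply: le_trans (ler_sum _ (fun n _ => amgm n)) _.
  rewrite big_split /= big_const_nat iter_addr addr0 -mulr_suml.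
  have h1 : e * H%:R / 2 *+ (m' - p) <= e * H%:R / 2 * M.
    rewrite -mulr_natr; apply: ler_wpM2l; first by lra.
    by apply: le_trans mpM; rewrite ler_nat; lia.
  have h2 : (\sum_(p <= n < m') D n) / (2 * (e * H%:R)) <= e * H%:R / 2 * M.
    rewrite ler_pdivrMr ?mulr_gt0 //; apply: le_trans Dsum _.
    by rewrite le_eqVlt; apply/orP; left; apply/eqP; field.
  by apply: le_trans (lerD h1 h2) _; lra.
rewrite -(@ler_pM2l _ H%:R) // mulrDr.
by apply: le_trans step1 _; rewrite lerD2l.
Qed.
End vdC.

Section fdiff.
Variable R : realType.
Implicit Types f g : nat -> R.

Definition fdiff (k : nat) f : nat -> R :=
  iter k (fun g n => g n.+1 - g n) f.

Arguments fdiff : simpl never.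

Lemma fdiffSr k f : fdiff k.+1 f = fdiff k (fun n => f n.+1 - f n).
Proof. by rewrite /fdiff iterSr. Qed.

Lemma fdiffS k f n : fdiff k.+1 f n = fdiff k f n.+1 - fdiff k f n.
Proof. by []. Qed.

Lemma fdiff_shift k f l n : fdiff k (fun n => f (n + l)%N) n = fdiff k f (n + l).
Proof. by elim: k n => [//|k IH] n; rewrite !fdiffS !IH addSn. Qed.

Lemma fdiffD k f g n : fdiff k (fun n => f n + g n) n = fdiff k f n + fdiff k g n.
Proof. by elim: k n => [//|k IH] n; rewrite !fdiffS !IH; ring. Qed.

Lemma fdiffZ k (c : R) f n : fdiff k (fun n => c * f n) n = c * fdiff k f n.
Proof. by elim: k n => [//|k IH] n; rewrite !fdiffS !IH; ring. Qed.

(** Telescoping. Differencing a phase at lag [l] thus trades one order of [fdiff] for a window of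
    [l] terms, which drives the inductions on the order. *)
Lemma fdiff_sum k l f n :
  fdiff k (fun n => f (n + l)%N - f n) n = \sum_(0 <= j < l) fdiff k.+1 f (n + j).
Proof.
have -> : (fun n => f (n + l)%N - f n) = (fun n => f (n + l)%N + -1 * f n).
  by apply: funext => x; ring.
rewrite fdiffD fdiffZ fdiff_shift.
elim: l => [|l IH]; first by rewrite big_nil addn0; ring.
by rewrite big_nat_recr //= -IH addnS fdiffS; ring.
Qed.

Definition monotone_on (p m : nat) (v : nat -> R) : Prop :=
  (forall n, (p <= n)%N -> (n.+1 < m)%N -> v n <= v n.+1) \/
  (forall n, (p <= n)%N -> (n.+1 < m)%N -> v n.+1 <= v n).

(** Summation by parts as an induction: the partial sums obey an invariant linear in the last
    weight, with one form for increasing and one for decreasing [v]. *)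
Lemma abel_monotone (v s : nat -> R) (p m : nat) (V B : R) :
  0 <= V -> 0 <= B ->
  (forall n, (p <= n < m)%N -> 0 <= v n <= V) -> (forall n, (n <= m)%N -> `|s n| <= B) ->
  monotone_on p m v ->
  \sum_(p <= n < m) v n * (s n.+1 - s n) <= 2 * V * B.
Proof.
move=> V0 B0 vV sB mono.
have [mp|pm] := leqP m p; first by rewrite big_geq // !mulr_ge0.
have sB' n : (n <= m)%N -> - B <= s n <= B by move=> nm; rewrite -ler_norml; exact: sB.
case: mono => mono.
- suff H k : (p + k < m)%N -> \sum_(p <= n < (p + k).+1) v n * (s n.+1 - s n) <=
      v (p + k)%N * (s (p + k).+1 + B).
    have := H (m.-1 - p)%N ltac:(lia).
    have -> : (p + (m.-1 - p) = m.-1)%N by lia.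
    rewrite prednK; last lia.
    have /andP[h1 h2] := vV m.-1 ltac:(lia).
    have /andP[h3 h4] := sB' m ltac:(lia) => /le_trans; apply.
    by rewrite mulrAC mulrC; apply: ler_pM; lra.
  elim: k => [|k IH] km.
    rewrite addn0 big_nat1 in km *.
    have /andP[h1 h2] := vV p ltac:(lia); have /andP[h3 h4] := sB' p ltac:(lia).
    by apply: ler_wpM2l => //; lra.
  rewrite addnS big_nat_recr /=; last lia.
  apply: le_trans (lerD (IH ltac:(lia)) (lexx _)) _.
  have /andP[h3 h4] := sB' (p + k).+1 ltac:(lia).
  have h : v (p + k)%N <= v (p + k).+1 by apply: mono; lia.
  have : v (p + k)%N * (s (p + k).+1 + B) <= v (p + k).+1 * (s (p + k).+1 + B).
    by apply: ler_wpM2r => //; lra.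
  by lra.
- suff H k : (p + k < m)%N -> \sum_(p <= n < (p + k).+1) v n * (s n.+1 - s n) <=
      v (p + k)%N * (s (p + k).+1 - B) + 2 * v p * B.
    have := H (m.-1 - p)%N ltac:(lia).
    have -> : (p + (m.-1 - p) = m.-1)%N by lia.
    rewrite prednK; last lia.
    have /andP[h1 h2] := vV m.-1 ltac:(lia).
    have /andP[h1' h2'] := vV p ltac:(lia).
    have /andP[h3 h4] := sB' m ltac:(lia) => /le_trans; apply.
    have : v m.-1 * (s m - B) <= 0 by apply: mulr_ge0_le0 => //; lra.
    have : v p * B <= V * B by apply: ler_wpM2r.
    by lra.
  elim: k => [|k IH] km.
    rewrite addn0 big_nat1 in km *.
    have /andP[h1 h2] := vV p ltac:(lia); have /andP[h3 h4] := sB' p ltac:(lia).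
    have : v p * (- s p) <= v p * B by apply: ler_wpM2l => //; lra.
    by lra.
  rewrite addnS big_nat_recr /=; last lia.
  apply: le_trans (lerD (IH ltac:(lia)) (lexx _)) _.
  have /andP[h3 h4] := sB' (p + k).+1 ltac:(lia).
  have h : v (p + k).+1 <= v (p + k)%N by apply: mono; lia.
  have : v (p + k).+1 * (B - s (p + k).+1) <= v (p + k)%N * (B - s (p + k).+1).
    by apply: ler_wpM2r => //; lra.
  by lra.
Qed.

(* The [k]-th derivative test.  An exponential sum is bounded through its real
   part, for all rotations [phi] at once. *)
Definition kdt (k : nat) : Prop := forall e C : R, 0 < e -> 1 <= C ->
  exists T delta : R, [/\ 0 < T, 0 < delta &
    forall (M lambda : R) f (p m : nat), (p <= m)%N -> (m - p)%:R <= M ->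
      0 < lambda <= delta -> T <= M -> T <= lambda * M ^+ k ->
      (forall n, (p <= n < m - k)%N -> lambda <= fdiff k f n <= C * lambda) ->
      monotone_on p (m - k) (fdiff k f) ->
      forall phi, \sum_(p <= n < m) cos (f n + phi) <= e * M].

(** [cos (f n)] is the increment of [sin (f n)] divided by that of [f], up to an error of the size
    of the latter. The reciprocals of the increments are monotone and at most [1 / lambda], so the
    sum is [O(1 + 1 / lambda + lambda * M)]. *)
Lemma kdt1 : kdt 1.
Proof.
move=> e C e0 C1.
(* The last term, [2 / lambda] and [C * lambda * M] get the shares [e / 6], [e / 3] and [e / 2] of
   the bound. *)
exists (6 / e), (e / (2 * C)); split; [by rewrite divr_gt0|by rewrite divr_gt0 //; lra|].
move=> M l f p m pm mpM /andP[l0 ld] TM TlM fl mono phi.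
have M0 : 0 < M by apply: lt_le_trans TM; rewrite divr_gt0.
have [mp|pm'] := leqP m p; first by rewrite big_geq // mulr_ge0 // ltW.
rewrite -(prednK (n := m)); last lia.
rewrite big_nat_recr /=; last lia.
have h1 : cos (f m.-1 + phi) <= 1 by exact: cos_le1.
set v := fun n => (f n.+1 - f n)^-1.
set s := fun n => sin (f n + phi).
have fl' n : (p <= n < m.-1)%N -> l <= f n.+1 - f n <= C * l.
  by move=> h; apply: fl; lia.
have v0 n : (p <= n < m.-1)%N -> 0 <= v n <= l^-1.
  move=> /fl'/andP[h2 h3]; have h4 : 0 < f n.+1 - f n by exact: lt_le_trans h2.
  by rewrite invr_ge0 ltW //= lef_pV2.
have cosv n : (p <= n < m.-1)%N ->
    cos (f n + phi) <= v n * (s n.+1 - s n) + C * l.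
  move=> /fl'/andP[h2 h3]; have h4 : 0 < f n.+1 - f n by exact: lt_le_trans h2.
  have := sin_taylor1 R (f n + phi) (f n.+1 - f n).
  have -> : f n + phi + (f n.+1 - f n) = f n.+1 + phi by ring.
  rewrite ler_norml => /andP[h5 h6].
  apply: (@le_trans _ _ (v n * (s n.+1 - s n) + (f n.+1 - f n))); last by rewrite lerD2l.
  rewrite -(ler_pM2l h4) mulrDr /v mulrA divff ?gt_eqF // mul1r -expr2 /s.
  by lra.
have ab : \sum_(p <= n < m.-1) v n * (s n.+1 - s n) <= 2 * l^-1 * 1.
  apply: abel_monotone => //; first by rewrite invr_ge0 ltW.
    by move=> n _; exact: sin_max.
  have fp n : (p <= n < m.-1)%N -> f n.+1 - f n \in Num.pos.
    by move=> /fl'/andP[h2 h3]; rewrite posrE; exact: lt_le_trans h2.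
  case: mono => mono; [right|left] => n pn nm.
    by rewrite /v lef_pV2 ?fp; [apply: mono|..]; clear -pn nm; lia.
  by rewrite /v lef_pV2 ?fp; [apply: mono|..]; clear -pn nm; lia.
have : \sum_(p <= n < m.-1) cos (f n + phi) <= 2 * l^-1 * 1 + C * l * M.
  apply: le_trans (_ : \sum_(p <= n < m.-1) (v n * (s n.+1 - s n) + C * l) <= _).
    by rewrite [leLHS]big_nat [leRHS]big_nat; apply: ler_sum.
  rewrite big_split /= lerD // big_const_nat iter_addr addr0 -[leLHS]mulr_natr.
  apply: ler_wpM2l; first by rewrite mulr_ge0 //; lra.
  by apply: le_trans mpM; rewrite ler_nat; lia.
have h2 : l^-1 <= e / 6 * M.
  rewrite -(ler_pM2l l0) divff ?gt_eqF //.
  rewrite expr1 in TlM.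
  have : (e / 6) * (6 / e) <= (e / 6) * (l * M) by apply: ler_wpM2l => //; lra.
  have -> : e / 6 * (6 / e) = 1 by field; rewrite gt_eqF.
  by lra.
have h3 : 1 <= e / 6 * M.
  have : (e / 6) * (6 / e) <= (e / 6) * M by apply: ler_wpM2l => //; lra.
  by have -> : e / 6 * (6 / e) = 1 by field; rewrite gt_eqF.
have h4 : C * l * M <= e / 2 * M.
  apply: ler_wpM2r; first exact: ltW.
  have : C * l <= C * (e / (2 * C)) by apply: ler_wpM2l => //; lra.
  have -> : C * (e / (2 * C)) = e / 2 by field; rewrite gt_eqF //; lra.
  by [].
by lra.
Qed.

End fdiff.

Section kdtq.
Variable R : realType.
Implicit Types f g rho : nat -> R.

Lemma truncn_ex (x : R) : 0 <= x -> exists n : nat, n%:R <= x < n.+1%:R.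
Proof. by move=> x0; exists (Num.truncn x); exact: truncn_itv. Qed.

Lemma cosD2piz (x : R) (z : int) : cos (x + 2 * pi * z%:~R) = cos x.
Proof.
have H (y : R) n : cos (y + 2 * pi * n%:R) = cos y.
  elim: n => [|n IH]; first by rewrite mulr0 addr0.
  by rewrite -[RHS]IH -natr1 -[RHS]cosD2pi mulr2n; congr cos; ring.
case: z => n; first by rewrite -pmulrn H.
by rewrite NegzE mulrNz mulrN -[LHS](H _ n.+1) -pmulrn subrK.
Qed.

(** That is, [exp (i * rho)] has period [q]. It models the part of a polynomial phase that has
    rational coefficients. *)
Definition quasi_periodic (q : nat) rho : Prop :=
  forall n, exists z : int, rho (n + q)%N = rho n + 2 * pi * z%:~R.

Lemma quasi_periodicM q rho l n : quasi_periodic q rho ->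
  exists z : int, rho (n + q * l)%N = rho n + 2 * pi * z%:~R.
Proof.
move=> per; elim: l => [|l [z IH]]; first by exists 0; rewrite muln0 addn0 mulr0 addr0.
have [z' e] := per (n + q * l)%N.
by exists (z + z'); rewrite mulnSr addnA e IH intrD; ring.
Qed.

(** After a shift by [q * h] the differenced phase has [k]-th differences of size [q * h * lambda],
    and [rho] drops out modulo [2 * pi], so [kdt k] applies to each correlation. *)
Lemma kdt_step (k q : nat) (e C : R) : (0 < k)%N -> (0 < q)%N -> 0 < e -> 1 <= C ->
  kdt R k ->
  exists T delta : R, [/\ 0 < T, 0 < delta &
    forall (M lambda : R) f rho (p m : nat), quasi_periodic q rho ->
      (p <= m)%N -> (m - p)%:R <= M ->
      0 < lambda <= delta -> T <= M -> T <= lambda * M ^+ k.+1 ->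
      (forall n, (p <= n < m - k.+1)%N ->
         lambda <= fdiff _ k.+1 f n <= C * lambda) ->
      monotone_on _ p (m - k.+1) (fdiff _ k.+1 f) ->
      forall phi, \sum_(p <= n < m) cos (f n + rho n + phi) <= e * M].
Proof.
move=> k0 q0 e0 C1 kd.
have e20 : 0 < e ^+ 2 by rewrite exprn_gt0.
have [T' [d' [T'0 d'0 IH]]] := kd (e ^+ 2 / 8) C ltac:(lra) C1.
have qR : 0 < q%:R :> R by rewrite ltr0n.
(* As [(e / 2) ^ 2 / 2 = 4 * eta], a cut-off [L] of about [eta * H] meets the condition in [vdC];
   [A0] ensures [eta * H >= 1], which absorbs the rounding. *)
pose eta := e ^+ 2 / 32.
have eta0 : 0 < eta by rewrite /eta; lra.
pose A0 := eta^-1 + 2.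
have etaV : 0 < eta^-1 by rewrite invr_gt0.
have A00 : 0 < A0 by rewrite /A0; lra.
have t1 : 0 < 2 * q%:R * A0 / e by rewrite divr_gt0 // !mulr_gt0.
have t2 : 0 < 4 * T' / (eta * e) by rewrite divr_gt0 // !mulr_gt0.
have t3 : 0 < 2 * T' / (eta * d') by rewrite divr_gt0 // !mulr_gt0.
pose T := 1 + T' + 2 * q%:R * A0 / e + 4 * T' / (eta * e) + 2 * T' / (eta * d').
exists T, (d' / (q%:R * A0)); split; [by rewrite /T; lra|by rewrite divr_gt0 // mulr_gt0|].
move=> M l f rho p m per pm mpM /andP[l0 ld] TM TlM fl mono phi.
have [M1 MT' MA MT3] : [/\ 1 <= M, T' <= M, 2 * q%:R * A0 / e <= M & 2 * T' / (eta * d') <= M].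
  by rewrite /T in TM; split; lra.
have Ml : 4 * T' / (eta * e) <= l * M ^+ k.+1 by rewrite /T in TlM; lra.
clear T TM TlM.
have M0 : 0 < M by lra.
(* The largest admissible number of shifts: the first bound keeps the ends below [e / 2 * M], the
   second keeps [q * h * lambda] within the range [d'] of [IH]. Each branch of the minimum consumes
   one of the last two summands of [T]. *)
pose X := Num.min (e * M / (2 * q%:R)) (d' / (q%:R * l)).
have XA : A0 <= X.
  rewrite le_min !ler_pdivlMr ?mulr_gt0 //; apply/andP; split.
    have : e * (2 * q%:R * A0 / e) <= e * M.
      by apply: ler_wpM2l; [exact: ltW|].
    have -> : e * (2 * q%:R * A0 / e) = 2 * q%:R * A0 by field; rewrite gt_eqF.
    by lra.
  move: ld; rewrite ler_pdivlMr ?mulr_gt0 // => ld.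
  by apply: le_trans ld; rewrite le_eqVlt; apply/orP; left; apply/eqP; ring.
have X1 : q%:R * X <= e / 2 * M.
  have : X <= e * M / (2 * q%:R) by rewrite ge_min lexx.
  by rewrite ler_pdivlMr ?mulr_gt0 //; lra.
have X2 : q%:R * l * X <= d'.
  have : X <= d' / (q%:R * l) by rewrite ge_min lexx orbT.
  by rewrite ler_pdivlMr ?mulr_gt0 //; lra.
have X3 : T' <= q%:R * eta * (X / 2) * l * M ^+ k.
  rewrite /X; case: (leP (e * M / (2 * q%:R)) (d' / (q%:R * l))) => _.
    have -> : q%:R * eta * (e * M / (2 * q%:R) / 2) * l * M ^+ k =
        eta * e / 4 * (l * M ^+ k.+1) by rewrite exprS; field; rewrite gt_eqF.
    have : eta * e / 4 * (4 * T' / (eta * e)) <= eta * e / 4 * (l * M ^+ k.+1).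
      by apply: ler_wpM2l => //; rewrite divr_ge0 // mulr_ge0 // ltW.
    have -> : eta * e / 4 * (4 * T' / (eta * e)) = T' by field; rewrite !gt_eqF.
    by [].
  have -> : q%:R * eta * (d' / (q%:R * l) / 2) * l * M ^+ k =
      eta * d' / 2 * M ^+ k by field; rewrite !gt_eqF.
  have MMk : M <= M ^+ k by rewrite -[leLHS]expr1; apply: ler_weXn2l.
  have : eta * d' / 2 * (2 * T' / (eta * d')) <= eta * d' / 2 * M ^+ k.
    apply: ler_wpM2l; first by rewrite divr_ge0 // mulr_ge0 // ltW.
    exact: le_trans MMk.
  have -> : eta * d' / 2 * (2 * T' / (eta * d')) = T' by field; rewrite !gt_eqF.
  by [].
have A2 : eta^-1 + 2 <= X := XA.
clear Ml MA MT3 t1 t2 t3 XA ld A0 A00; clearbody X.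
have [H /andP[H1 H2]] := truncn_ex X ltac:(lra).
rewrite -natr1 in H2.
have XH : X / 2 <= H%:R by lra.
have etaH : 1 <= eta * H%:R.
  have : eta * eta^-1 <= eta * H%:R.
    by apply: ler_wpM2l; [exact: ltW|lra].
  by rewrite divff // gt_eqF.
have [L0 /andP[L1 L2]] := truncn_ex (eta * H%:R) ltac:(lra).
have H0 : (0 < H)%N by rewrite -(ltr0n R); lra.
have vd := @vdC R q H L0.+1 (e / 2) M (fun n => f n + rho n) p m phi H0
  ltac:(lra) pm mpM.
have qHM : (q * H)%:R <= e / 2 * M.
  by rewrite natrM; apply: le_trans X1; apply: ler_wpM2l => //; lra.
apply: le_trans (vd _ _) _; [| |lra].
  rewrite -natr1; have -> : (e / 2) ^+ 2 / 2 * H%:R = 4 * (eta * H%:R).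
    by rewrite /eta; field.
  by lra.
move=> h p1 m1 /andP[Lh hH] pp1 p1m1 m1m.
have -> : (e / 2) ^+ 2 / 2 = e ^+ 2 / 8 by field.
have hR : eta * H%:R <= h%:R.
  by apply: ltW; apply: lt_le_trans L2 _; rewrite ler_nat.
have hHR : h%:R <= H%:R :> R by rewrite ler_nat ltnW.
have h0 : 0 < h%:R :> R by apply: lt_le_trans hR; lra.
have hX : h%:R <= X by lra.
have -> : \sum_(p1 <= n < m1) cos (f (n + q * h)%N + rho (n + q * h)%N - (f n + rho n)) =
   \sum_(p1 <= n < m1) cos (f (n + q * h)%N - f n + 0).
  apply: eq_bigr => n _; have [z ->] := @quasi_periodicM q rho h n per.
  by rewrite -[RHS](cosD2piz _ z); congr cos; ring.
have fdg n : fdiff _ k (fun n => f (n + q * h)%N - f n) n =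
   \sum_(0 <= j < q * h) fdiff _ k.+1 f (n + j)%N by exact: fdiff_sum.
apply: (IH M (q%:R * h%:R * l)); first exact: p1m1.
- by apply: le_trans mpM; rewrite ler_nat; clear -m1m pp1; lia.
- have -> : 0 < q%:R * h%:R * l by rewrite mulr_gt0 // mulr_gt0.
  apply: le_trans X2.
  have : q%:R * l * h%:R <= q%:R * l * X by apply: ler_wpM2l => //; rewrite mulr_ge0 // ltW.
  by lra.
- exact: MT'.
- apply: le_trans X3 _; rewrite -subr_ge0.
  have -> : q%:R * h%:R * l * M ^+ k - q%:R * eta * (X / 2) * l * M ^+ k =
     q%:R * l * M ^+ k * (h%:R - eta * (X / 2)) by ring.
  apply: mulr_ge0; first by rewrite !mulr_ge0 ?exprn_ge0 // ltW.
  have : eta * (X / 2) <= eta * H%:R by apply: ler_wpM2l => //; exact: ltW.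
  by lra.
- move=> n nr; rewrite fdg.
  have fl' j : (0 <= j < q * h)%N -> l <= fdiff _ k.+1 f (n + j) <= C * l.
    by move=> jr; apply: fl; clear -jr nr m1m pp1; lia.
  apply/andP; split.
    have -> : q%:R * h%:R * l = \sum_(0 <= j < q * h) l.
      by rewrite big_const_nat iter_addr addr0 subn0 -[RHS]mulr_natr natrM; ring.
    rewrite [leLHS]big_nat [leRHS]big_nat; apply: ler_sum => j jr.
    by case/andP: (fl' j jr).
  have -> : C * (q%:R * h%:R * l) = \sum_(0 <= j < q * h) (C * l).
    by rewrite big_const_nat iter_addr addr0 subn0 -[RHS]mulr_natr natrM; ring.
  rewrite [leLHS]big_nat [leRHS]big_nat; apply: ler_sum => j jr.
  by case/andP: (fl' j jr).
- case: mono => mono; [left|right] => n pn nm; rewrite !fdg;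
    rewrite [leLHS]big_nat [leRHS]big_nat; apply: ler_sum => j jr;
    rewrite addSn; apply: mono; clear -jr pn nm m1m pp1; lia.
Qed.

Lemma kdtP k : (0 < k)%N -> kdt R k.
Proof.
case: k => // k _; elim: k => [|k IH]; first exact: kdt1.
move=> e C e0 C1.
have [T [d [T0 d0 H]]] := kdt_step k.+1 1 e C (ltn0Sn _) (ltn0Sn _) e0 C1 IH.
exists T, d; split => // M l f p m pm mpM ld TM TlM fl mono phi.
have := H M l f (fun=> 0) p m _ pm mpM ld TM TlM fl mono phi.
under eq_bigr do rewrite addr0.
by apply => n; exists 0; rewrite mulr0 addr0.
Qed.
End kdtq.

(** * Weyl sums with an irrational leading coefficient *)

Section weyl.
Variable R : realType.
Implicit Types f g rho : nat -> R.

Lemma norm_sum_nat_le1 (F : nat -> R) (p m : nat) :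
  (forall n, `|F n| <= 1) -> `|\sum_(p <= n < m) F n| <= (m - p)%:R.
Proof.
by move=> F1; apply: le_trans (ler_norm_sum _ _ _) _; exact: sum_nat_le1.
Qed.

(* The condition on sines says that [omega / (2 pi)] is irrational. *)
Definition weyl_irr (i : nat) : Prop :=
  forall (q : nat) (omega e : R), (0 < q)%N -> 0 < e ->
  (forall h : nat, (0 < h)%N -> sin (h%:R * omega / 2) != 0) ->
  exists eta M0 : R, 0 < eta /\
    forall (M : R) f rho (p m : nat), quasi_periodic _ q rho -> (p <= m)%N ->
      (m - p)%:R <= M -> M0 <= M ->
      (forall n, (p <= n < m - i)%N -> `|fdiff _ i f n - omega| <= eta) ->
      forall phi, \sum_(p <= n < m) cos (f n + rho n + phi) <= e * M.

Lemma fdiff_shift_near (i l : nat) f (n : nat) (omega eta : R) :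
  (forall j, (j < l)%N -> `|fdiff _ i.+1 f (n + j) - omega| <= eta) ->
  `|fdiff _ i (fun n => f (n + l)%N - f n) n - l%:R * omega| <= l%:R * eta.
Proof.
move=> H; rewrite fdiff_sum.
have -> : forall x : R, l%:R * x = \sum_(0 <= j < l) x.
  by move=> x; rewrite big_const_nat iter_addr addr0 subn0 mulr_natl.
rewrite -sumrB; apply: le_trans (ler_norm_sum _ _ _) _.
have -> : l%:R * eta = \sum_(0 <= j < l) eta.
  by rewrite big_const_nat iter_addr addr0 subn0 mulr_natl.
by rewrite [leLHS]big_nat [leRHS]big_nat; apply: ler_sum => j /andP[_ /H].
Qed.

(** Modulo [2 * pi] the phase moves by nearly [theta = q * omega] when [n] moves by [q]. Multiplying
    by [2 * sin (theta / 2)], nonzero by irrationality, yields a difference of two sums that nearly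
    agree after a shift by [q]; only end terms and the drift, controlled by [eta], remain. *)
Lemma weyl_irr1 : weyl_irr 1.
Proof.
move=> q omega e q0 e0 irr.
have qR : 0 < q%:R :> R by rewrite ltr0n.
pose theta := q%:R * omega.
pose c := 2 * sin (theta / 2).
have c0 : c != 0 by rewrite mulf_neq0 // irr.
have cn : 0 < `|c| by rewrite normr_gt0.
exists (`|c| * e / (2 * q%:R)), (4 * q%:R / (`|c| * e)); split.
  by rewrite divr_gt0 // mulr_gt0.
move=> M f rho p m per pm mpM M0M fo phi.
have M0 : 0 < M by apply: lt_le_trans M0M; rewrite divr_gt0 // mulr_gt0.
have M2 : 2 * q%:R <= `|c| * (e / 2 * M).
  by move: M0M; rewrite ler_pdivrMr ?mulr_gt0 //; lra.
set x := fun n => f n + rho n.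
pose psi := phi - theta / 2 + pi / 2.
have cZ : c * \sum_(p <= n < m) cos (f n + rho n + phi) =
    \sum_(p <= n < m) cos (x n + psi) - \sum_(p <= n < m) cos (x n + theta + psi).
  rewrite mulr_sumr -sumrB; apply: eq_bigr => n _.
  have -> : x n + psi = (x n + phi + pi / 2) - theta / 2 by rewrite /psi; ring.
  have -> : x n + theta + psi = (x n + phi + pi / 2) + theta / 2.
    by rewrite /psi; field.
  by rewrite (cosB (x n + phi + pi / 2)) (cosD (x n + phi + pi / 2)) sinDpihalf /c /x; ring.
suff : `|c * \sum_(p <= n < m) cos (f n + rho n + phi)| <= `|c| * (e * M).
  by rewrite normrM ler_pM2l // => /(le_trans (ler_norm _)).
rewrite {}cZ.
have c1 (g : nat -> R) n : `|cos (g n)| <= 1 by exact: cos_max.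
have [mq|qm] := leqP m (p + q).
  apply: le_trans (ler_normB _ _) _.
  have h1 : `|\sum_(p <= n < m) cos (x n + psi)| <= q%:R.
    apply: (@le_trans _ _ (m - p)%:R); first by apply: norm_sum_nat_le1 => n; exact: cos_max.
    by rewrite ler_nat; clear -mq; lia.
  have h2 : `|\sum_(p <= n < m) cos (x n + theta + psi)| <= q%:R.
    apply: (@le_trans _ _ (m - p)%:R); first by apply: norm_sum_nat_le1 => n; exact: cos_max.
    by rewrite ler_nat; clear -mq; lia.
  have : 0 <= `|c| * (e / 2 * M) by rewrite !mulr_ge0 //; lra.
  by lra.
rewrite (@big_cat_nat _ _ _ (p + q) p m) /=; [|clear; lia|exact: ltnW].
rewrite (@big_cat_nat _ _ _ (m - q) p m _ (fun n => cos (x n + theta + psi))) /=; [|clear -qm; lia|clear; lia].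
have -> : \sum_(p + q <= n < m) cos (x n + psi) =
   \sum_(p <= n < m - q) cos (x (n + q)%N + psi) by rewrite big_addn.
have h1 : `|\sum_(p <= n < p + q) cos (x n + psi)| <= q%:R.
  apply: (@le_trans _ _ (p + q - p)%:R); first by apply: norm_sum_nat_le1 => n; exact: cos_max.
  by rewrite ler_nat; clear; lia.
have h2 : `|\sum_(m - q <= n < m) cos (x n + theta + psi)| <= q%:R.
  apply: (@le_trans _ _ (m - (m - q))%:R); first by apply: norm_sum_nat_le1 => n; exact: cos_max.
  by rewrite ler_nat; clear; lia.
have h3 : `|\sum_(p <= n < m - q) cos (x (n + q)%N + psi) -
    \sum_(p <= n < m - q) cos (x n + theta + psi)| <= `|c| * (e / 2) * M.
  rewrite -sumrB; apply: le_trans (ler_norm_sum _ _ _) _.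
  apply: (@le_trans _ _ (\sum_(p <= n < m - q) (`|c| * (e / 2)))); last first.
    rewrite big_const_nat iter_addr addr0 -[leLHS]mulr_natr.
    apply: ler_wpM2l; first by rewrite mulr_ge0 //; lra.
    by apply: le_trans mpM; rewrite ler_nat; clear; lia.
  rewrite [leLHS]big_nat [leRHS]big_nat; apply: ler_sum => n nr.
  have [z ez] := per n.
  have -> : cos (x (n + q)%N + psi) = cos (f (n + q)%N + rho n + psi).
    by rewrite -[RHS](cosD2piz _ _ z) /x ez; congr cos; ring.
  apply: le_trans (cos_Lipschitz _ _ _) _.
  have := @fdiff_shift_near 0 q f n omega (`|c| * e / (2 * q%:R)) _.
  rewrite /fdiff /= => /(_ _)/le_trans H.
  have -> : f (n + q)%N + rho n + psi - (x n + theta + psi) =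
    f (n + q)%N - f n - q%:R * omega by rewrite /x /theta; ring.
  apply: H; last by rewrite le_eqVlt; apply/orP; left; apply/eqP; field; rewrite gt_eqF.
  by move=> j jq; apply: fo; clear -jq nr qm; lia.
have -> (a b b1 d : R) : a + b - (b1 + d) = a + (b - b1) - d by ring.
apply: le_trans (ler_normB _ _) _.
have := ler_normD (\sum_(p <= n < p + q) cos (x n + psi))
  (\sum_(p <= n < m - q) cos (x (n + q)%N + psi) - \sum_(p <= n < m - q) cos (x n + theta + psi)).
by lra.
Qed.

(** Weyl differencing with a number [H] of shifts that depends on [e] only. The differenced phases
    have [i]-th differences near [q * l * omega] with [0 < l < H], which is irrational over [2 * pi]
    again, so finitely many instances of [IH] suffice and a common [eta] and [M0] exist. *)
Lemma weyl_irrS i : weyl_irr i -> weyl_irr i.+1.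
Proof.
move=> IH q omega e q0 e0 irr.
have qR : 0 < q%:R :> R by rewrite ltr0n.
have e20 : 0 < e ^+ 2 by rewrite exprn_gt0.
have eV : 0 <= 16 / e ^+ 2 by rewrite divr_ge0 // ltW.
(* [H > 16 / e ^ 2] is the condition of [vdC] for [L = 1] and accuracy [e / 2]. *)
have [H0 /andP[_ H1]] := truncn_ex _ _ eV.
set H := H0.+1 in H1.
have HR : 0 < H%:R :> R by rewrite ltr0n.
have [eta [M0 [eta0 small]]] : exists eta M0 : R, 0 < eta /\
    forall l, (0 < l < H)%N -> forall (M : R) f (p m : nat), (p <= m)%N ->
      (m - p)%:R <= M -> M0 <= M ->
      (forall n, (p <= n < m - i)%N -> `|fdiff _ i f n - (q * l)%:R * omega| <= eta) ->
      \sum_(p <= n < m) cos (f n) <= e ^+ 2 / 8 * M.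
  elim: {1}H => [|k [eta [M0 [eta0 small]]]]; first by exists 1, 0; split => // l /andP[_].
  have [k0|k0] := posnP k.
    by exists 1, 0; split => // l h; exfalso; clear -h k0; lia.
  have [|h h0|eta1 [M1 [eta10 small1]]] := IH 1 ((q * k)%:R * omega) (e ^+ 2 / 8) isT; first by lra.
    by rewrite mulrA -natrM irr // !muln_gt0 h0 q0.
  exists (Num.min eta eta1), (Num.max M0 M1); split; first by rewrite lt_min eta0 eta10.
  move=> l lk M f p m pm mpM; rewrite ge_max => /andP[MM0 MM1] fl.
  have [lk'|lk'] := ltnP l k.
    apply: (small l) => //; first by clear -lk lk'; lia.
    by move=> n /fl; rewrite le_min => /andP[].
  have lE : l = k by clear -lk lk'; lia.
  have := small1 M f (fun=> 0) p m _ pm mpM MM1 _ 0.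
  under eq_bigr do rewrite !addr0; apply.
    by move=> n; exists 0; rewrite mulr0 addr0.
  by move=> n /fl; rewrite lE le_min => /andP[].
exists (eta / (q * H)%:R), (Num.max M0 (2 * (q * H)%:R / e)); split.
  by rewrite divr_gt0 // ltr0n muln_gt0 q0.
move=> M f rho p m per pm mpM; rewrite ge_max => /andP[MM0 MM1] fo phi.
have vd := @vdC R q H 1 (e / 2) M (fun n => f n + rho n) p m phi (ltn0Sn _)
  ltac:(lra) pm mpM.
have h1 : (q * H)%:R <= e / 2 * M by move: MM1; rewrite ler_pdivrMr //; lra.
apply: le_trans (vd _ _) _; [| |lra].
  move: H1; rewrite ltr_pdivrMr // => H1.
  have -> : (e / 2) ^+ 2 / 2 * H%:R = H%:R * e ^+ 2 / 8 by field.
  by lra.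
move=> h p1 m1 /andP[Lh hH] pp1 p1m1 m1m.
have -> : (e / 2) ^+ 2 / 2 = e ^+ 2 / 8 by field.
have -> : \sum_(p1 <= n < m1) cos (f (n + q * h)%N + rho (n + q * h)%N - (f n + rho n)) =
   \sum_(p1 <= n < m1) cos (f (n + q * h)%N - f n).
  apply: eq_bigr => n _; have [z ->] := @quasi_periodicM _ q rho h n per.
  by rewrite -[RHS](cosD2piz _ _ z); congr cos; ring.
apply: (small h _ M); [by rewrite Lh|exact: p1m1| |exact: MM0|].
  by apply: le_trans mpM; rewrite ler_nat; clear -pp1 m1m; lia.
move=> n nr; apply: le_trans (_ : (q * h)%:R * (eta / (q * H)%:R) <= _).
  by apply: fdiff_shift_near => j jr; apply: fo; clear -jr nr pp1 m1m; lia.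
rewrite mulrA ler_pdivrMr ?ltr0n ?muln_gt0 ?q0 // mulrC.
by apply: ler_wpM2l; [exact: ltW|rewrite ler_nat leq_mul2l ltnW ?orbT].
Qed.

Lemma weyl_irrP i : (0 < i)%N -> weyl_irr i.
Proof.
by case: i => // i _; elim: i => [|i IH]; [exact: weyl_irr1|exact: weyl_irrS].
Qed.
End weyl.

(** * A trigonometric kernel *)

Section trig.
Variable R : realType.

Lemma sum_cos_eq0 (q : nat) (beta : R) :
  sin (beta / 2) != 0 -> (exists z : int, q%:R * beta = 2 * pi * z%:~R) ->
  \sum_(0 <= l < q) cos (l%:R * beta) = 0.
Proof.
move=> sb [z qb].
suff : (2 * sin (beta / 2)) * (\sum_(0 <= l < q) cos (l%:R * beta)) = 0.
  by move/eqP; rewrite !mulf_eq0 (negbTE sb) orbF pnatr_eq0 /= => /eqP.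
rewrite mulr_sumr.
pose V := fun l : nat => sin (l%:R * beta - beta / 2).
rewrite (eq_bigr (fun l => V l.+1 - V l)); last first.
  move=> l _; rewrite /V -(natr1 l).
  have -> : (l%:R + 1) * beta - beta / 2 = l%:R * beta + beta / 2 by field.
  by rewrite sinB sinD; ring.
rewrite telescope_sumr // /V mul0r sub0r qb.
have -> : 2 * pi * z%:~R - beta / 2 = - (beta / 2 + pi / 2) + 2 * pi * z%:~R + pi / 2.
  by ring.
rewrite sinDpihalf cosD2piz -[- (beta / 2) in X in _ - X](subrK (pi / 2)) sinDpihalf.
by rewrite opprD subrr.
Qed.

Lemma cos_le_cos_outside (t tau : R) : 0 <= t <= pi -> t <= `|tau| <= 2 * pi - t ->
  cos tau <= cos t.
Proof.
move=> /andP[t0 tpi] /andP[h1 h2]; rewrite -(cos_norm tau).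
move: (`|tau|) h1 h2 => {}tau h1 h2.
have mono (x : R) : t <= x <= pi -> cos x <= cos t.
  move=> /andP[h3 h4]; rewrite leNgt ltr_cos ?in_itv /= -?leNgt; lra.
have [tp|tp] := leP tau pi; first by apply: mono; lra.
rewrite -cosN -(cosD2piz _ (- tau) 1).
by apply: mono; lra.
Qed.

Section kernel.
Variables (q : nat) (theta : R).
Hypothesis q0 : (0 < q)%N.

Let t1 : R := pi / q%:R.
Let b (l : nat) : R := sin (l%:R * t1).
Let C := \sum_(0 <= l < q) b l * cos (l%:R * theta).
Let S := \sum_(0 <= l < q) b l * sin (l%:R * theta).

Let qt1 : q%:R * t1 = pi.
Proof. by rewrite /t1; field; rewrite pnatr_eq0 -lt0n. Qed.

(* The [b l] form an eigenvector of the discrete Laplacian with Dirichlet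
   conditions at [0] and [q], so multiplication by [cos theta] acts on
   [C + i S] as multiplication by [cos t1], up to boundary terms. *)
Lemma kernel_cos : 2 * (cos theta - cos t1) * C = b 1 * (1 + cos (q%:R * theta)).
Proof.
pose V l := sin ((l%:R - 1) * t1) * cos (l%:R * theta) -
            sin (l%:R * t1) * cos ((l%:R - 1) * theta) : R.
rewrite /C mulr_sumr (eq_bigr (fun l => V l.+1 - V l)).
  rewrite telescope_sumr // /V.
  have -> : (q%:R - 1) * t1 = - t1 + pi by rewrite mulrBl qt1 mul1r addrC.
  rewrite sinDpi qt1 sinpi !mul0r sin0 sub0r mulN1r sinN cos0 /b mul1r.
  by ring.
move=> l _; rewrite /V -(natr1 l) /b.
have -> : l%:R + 1 - 1 = l%:R :> R by ring.
rewrite !(mulrDl _ _ t1) !(mulrDl _ _ theta) !mulN1r !mul1r.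
by rewrite !(sinD, cosD) !sinN !cosN; ring.
Qed.

Lemma kernel_sin : 2 * (cos theta - cos t1) * S = b 1 * sin (q%:R * theta).
Proof.
pose V l := sin ((l%:R - 1) * t1) * sin (l%:R * theta) -
            sin (l%:R * t1) * sin ((l%:R - 1) * theta) : R.
rewrite /S mulr_sumr (eq_bigr (fun l => V l.+1 - V l)).
  rewrite telescope_sumr // /V.
  have -> : (q%:R - 1) * t1 = - t1 + pi by rewrite mulrBl qt1 mul1r addrC.
  rewrite sinDpi qt1 sinpi !mul0r sin0 sub0r mulN1r sinN /b mul1r.
  by ring.
move=> l _; rewrite /V -(natr1 l) /b.
have -> : l%:R + 1 - 1 = l%:R :> R by ring.
rewrite !(mulrDl _ _ t1) !(mulrDl _ _ theta) !mulN1r !mul1r.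
by rewrite !(sinD, cosD) !sinN !cosN; ring.
Qed.

Lemma kernel_sqr : C ^+ 2 + S ^+ 2 =
  \sum_(0 <= l < q) \sum_(0 <= k < q) b l * b k * cos (l%:R * theta - k%:R * theta).
Proof.
rewrite !expr2 /C /S !big_distrl -big_split /=; apply: eq_bigr => h _.
rewrite !big_distrr -big_split /=; apply: eq_bigr => k _.
by rewrite cosB; ring.
Qed.

(** The left-hand side has the sign of [cos theta - c0], the right-hand side is a cosine polynomial.
    Its constant term is positive when [c0 < cos t1], because [cos t1] is the eigenvalue belonging
    to [b]; the first sum, at frequencies [l] and [q - l], is the boundary effect. *)
Lemma kernelE (c0 : R) : 2 * (cos theta - c0) * (C ^+ 2 + S ^+ 2) =
  \sum_(0 <= l < q) b 1 * b l * (cos (l%:R * theta) + cos ((q%:R - l%:R) * theta)) +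
  2 * (cos t1 - c0) *
  \sum_(0 <= l < q) \sum_(0 <= k < q) b l * b k * cos (l%:R * theta - k%:R * theta).
Proof.
rewrite -kernel_sqr.
have -> : \sum_(0 <= l < q) b 1 * b l * (cos (l%:R * theta) + cos ((q%:R - l%:R) * theta))
    = b 1 * (1 + cos (q%:R * theta)) * C + b 1 * sin (q%:R * theta) * S.
  rewrite /C /S !mulr_sumr -big_split /=; apply: eq_bigr => l _.
  by rewrite mulrBl cosB; ring.
by rewrite -kernel_cos -kernel_sin; ring.
Qed.

Lemma kernel_sqr_le : C ^+ 2 + S ^+ 2 <= q%:R ^+ 2.
Proof.
rewrite kernel_sqr.
have -> : q%:R ^+ 2 = \sum_(0 <= l < q) \sum_(0 <= k < q) 1 :> R.
  by rewrite !big_const_nat !iter_addr !addr0 subn0 expr2 mulr_natl.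
apply: ler_sum => l _; apply: ler_sum => k _.
apply: le_trans (ler_norm _) _; rewrite !normrM.
by rewrite mulr_ile1 ?mulr_ge0 ?mulr_ile1 ?sin_max ?cos_max.
Qed.

End kernel.
End trig.

(** * Detecting sums near the values of a sequence *)

Section hit.
Variables (R : realType) (s : seq nat) (N : nat) (a w : nat -> R) (n0 M : nat) (B : R).
Let Q : nat := N.*2.+2.
Let q : nat := Q.*2.
Let beta : R := 2 * pi / Q%:R.
Let W : R := \sum_(n0 <= n < M) w n.

Hypothesis s_uniq : uniq s.
Hypothesis s_bound : forall x, x \in s -> (0 < x <= N)%N.
Hypothesis a_bound : forall n, (n0 <= n < M)%N -> 0 <= a n <= Q%:R.
Hypothesis w_ge0 : forall n, (n0 <= n < M)%N -> 0 <= w n.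
Hypothesis B_ge0 : 0 <= B.
Hypothesis w_bound : forall (j : nat) (phi : R), (0 < j < q)%N ->
  \sum_(n0 <= n < M) w n * cos (j%:R * beta * a n + phi) <= B.

Let theta (n x y : nat) : R := beta * (a n - x%:R - y%:R - 2^-1).
Let E (F : R -> R) : R :=
  \sum_(n0 <= n < M) w n * \sum_(x <- s) \sum_(y <- s) F (theta n x y).

Let E_D F G : E (fun t => F t + G t) = E F + E G.
Proof.
rewrite /E -big_split /=; apply: eq_bigr => n _; rewrite -mulrDr; congr (_ * _).
rewrite -big_split /=; apply: eq_bigr => x _.
by rewrite -big_split.
Qed.

Let E_Z c F : E (fun t => c * F t) = c * E F.
Proof.
rewrite /E mulr_sumr; apply: eq_bigr => n _; rewrite mulrCA; congr (_ * _).
rewrite mulr_sumr; apply: eq_bigr => x _.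
by rewrite mulr_sumr.
Qed.

Let E_sum (m : nat) (F : nat -> R -> R) :
  E (fun t => \sum_(0 <= i < m) F i t) = \sum_(0 <= i < m) E (F i).
Proof.
elim: m => [|m IH].
  rewrite big_geq // /E big1 // => n _; rewrite big1 ?mulr0 // => x _.
  by rewrite big1 // => y _; rewrite big_geq.
rewrite big_nat_recr //= -IH -E_D; congr E; apply: funext => t.
by rewrite big_nat_recr.
Qed.

Let QR : 0 < Q%:R :> R. Proof. by rewrite ltr0n. Qed.

Let w_norm (j : nat) (phi : R) : (0 < j < q)%N ->
  `|\sum_(n0 <= n < M) w n * cos (j%:R * beta * a n + phi)| <= B.
Proof.
move=> jq; rewrite ler_norml w_bound // andbT lerNl -sumrN.
under eq_bigr do rewrite -mulrN -cosDpi -addrA.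
exact: w_bound.
Qed.

Let X (r : R) : R := E (fun t => cos (r * t)).
Let Y (j : nat) : R := 2 * B *
  ((\sum_(x <- s) cos (j%:R * beta * x%:R)) ^+ 2 +
   (\sum_(x <- s) sin (j%:R * beta * x%:R)) ^+ 2).

Let Y_ge0 j : 0 <= Y j.
Proof. by rewrite /Y !mulr_ge0 // addr_ge0 // sqr_ge0. Qed.

Let X_opp r : X (- r) = X r.
Proof.
rewrite /X /E; apply: eq_bigr => n _; congr (_ * _).
by apply: eq_bigr => x _; apply: eq_bigr => y _; rewrite mulNr cosN.
Qed.

Let X0 : X 0 = W * (size s)%:R ^+ 2.
Proof.
rewrite /X /E /W mulr_suml; apply: eq_bigr => n _; congr (_ * _).
rewrite (eq_bigr (fun=> (size s)%:R)) => [|x _].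
  by rewrite big_const_seq iter_addr addr0 count_predT expr2 mulr_natl.
rewrite (eq_bigr (fun=> 1)) => [|y _]; last by rewrite mul0r cos0.
by rewrite big_const_seq iter_addr addr0 count_predT.
Qed.

(** The sum over [x] and [y] factors as the square of the exponential sum over [s] at frequency [j];
    the sum over [n] separates from it and costs a factor [B]. *)
Let X_le j : (0 < j < q)%N -> - Y j <= X j%:R.
Proof.
move=> jq.
set Cs := \sum_(x <- s) cos (j%:R * beta * x%:R).
set Ss := \sum_(x <- s) sin (j%:R * beta * x%:R).
pose u n := j%:R * beta * a n - j%:R * beta / 2.
have inner n : \sum_(x <- s) \sum_(y <- s) cos (j%:R * theta n x y) =
    cos (u n) * (Cs ^+ 2 - Ss ^+ 2) + sin (u n) * (2 * Cs * Ss).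
  transitivity (cos (u n) * (Cs * Cs) - cos (u n) * (Ss * Ss) +
     (sin (u n) * (Ss * Cs) + sin (u n) * (Cs * Ss))); last by ring.
  rewrite /Cs /Ss !big_distrlr /= !mulr_sumr -sumrB -!big_split /=.
  apply: eq_bigr => x _; rewrite !mulr_sumr -sumrB -!big_split /=.
  apply: eq_bigr => y _.
  have -> : j%:R * theta n x y = u n - j%:R * beta * x%:R - j%:R * beta * y%:R.
    by rewrite /theta /u; field.
  by rewrite cosB (cosB (u n)) (sinB (u n)); ring.
have -> : X j%:R = (\sum_(n0 <= n < M) w n * cos (u n)) * (Cs ^+ 2 - Ss ^+ 2) +
    (\sum_(n0 <= n < M) w n * sin (u n)) * (2 * Cs * Ss).
  rewrite /X /E !mulr_suml -big_split /=; apply: eq_bigr => n _.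
  by rewrite inner; ring.
have h1 : `|\sum_(n0 <= n < M) w n * cos (u n)| <= B by exact: w_norm.
have h2 : `|\sum_(n0 <= n < M) w n * sin (u n)| <= B.
  under eq_bigr do rewrite -cosBpihalf /u -addrA.
  exact: w_norm.
rewrite /Y -/Cs -/Ss lerNl.
move: (\sum_(n0 <= n < M) _) (\sum_(n0 <= n < M) _) h1 h2 => A2 A1 h2 h1.
apply: le_trans (ler_norm _) _; rewrite normrN.
apply: le_trans (ler_normD _ _) _; rewrite !normrM.
have h3 : `|A1| * `|Cs ^+ 2 - Ss ^+ 2| <= B * (Cs ^+ 2 + Ss ^+ 2).
  apply: ler_pM => //; rewrite ler_norml.
  by have := sqr_ge0 Cs; have := sqr_ge0 Ss; lra.
have h4 : `|A2| * (`|2| * `|Cs| * `|Ss|) <= B * (Cs ^+ 2 + Ss ^+ 2).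
  apply: ler_pM => //; rewrite ?mulr_ge0 // ger0_norm //.
  by have := sqr_ge0 (`|Cs| - `|Ss|); rewrite -(real_normK (num_real Cs)) -(real_normK (num_real Ss)); lra.
by lra.
Qed.

(** Parseval over [q] frequencies: distinct elements of [s] differ by less than [Q], so the mixed
    terms are full sums of roots of unity and vanish. *)
Let sum_Y : \sum_(0 <= j < q) Y j = 2 * B * (q%:R * (size s)%:R).
Proof.
rewrite /Y -mulr_sumr; congr (_ * _).
have pair x y : x \in s -> y \in s ->
    \sum_(0 <= j < q) cos (j%:R * beta * x%:R - j%:R * beta * y%:R) =
    if y == x then q%:R else 0.
  move=> xs ys; case: eqVneq => [->|yx].
    rewrite (eq_bigr (fun=> 1)) => [|j _]; last by rewrite subrr cos0.
    by rewrite big_const_nat iter_addr addr0 subn0.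
  have xN := s_bound x xs; have yN := s_bound y ys.
  have go (u v : nat) : (v < u)%N -> (u <= N)%N ->
    \sum_(0 <= j < q) cos (j%:R * beta * u%:R - j%:R * beta * v%:R) = 0.
    move=> vu uN.
    under eq_bigr do rewrite -mulrBr -mulrA -(natrB _ (ltnW vu)).
    apply: sum_cos_eq0.
      apply: lt0r_neq0; apply: sin_gt0_pi.
      have -> : beta * (u - v)%:R / 2 = pi * (u - v)%:R / Q%:R.
        by rewrite /beta; field; rewrite gt_eqF.
      rewrite divr_gt0 ?mulr_gt0 ?pi_gt0 ?ltr0n ?subn_gt0 //=.
      rewrite ltr_pdivrMr // ltr_pM2l ?pi_gt0 // ltr_nat /Q.
      by clear -vu uN; lia.
    exists (2 * (u - v)%N%:Z); rewrite intrM -pmulrn /q /beta -muln2 natrM.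
    by field; rewrite gt_eqF.
  have [yx'|xy] := ltnP y x; first by apply: go => //; case/andP: xN.
  under eq_bigr do rewrite -cosN opprB.
  apply: go; last by case/andP: yN.
  by rewrite ltn_neqAle eq_sym yx.
transitivity (\sum_(x <- s) \sum_(y <- s) \sum_(0 <= j < q)
    cos (j%:R * beta * x%:R - j%:R * beta * y%:R)).
  under [RHS]eq_bigr do rewrite exchange_big.
  rewrite exchange_big; apply: eq_bigr => j _.
  rewrite !expr2 !big_distrl -big_split /=; apply: eq_bigr => x _.
  rewrite !big_distrr -big_split /=; apply: eq_bigr => y _.
  by rewrite cosB.
rewrite big_seq (eq_bigr (fun=> q%:R)) => [|x xs].
  by rewrite -big_seq big_const_seq iter_addr addr0 count_predT mulr_natr.
rewrite big_seq (eq_bigr (fun y => if y == x then q%:R else 0)) => [|y ys]; last exact: pair.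
rewrite -big_seq (bigD1_seq x) //= eqxx big1 ?addr0 // => y /negbTE ->.
by [].
Qed.

Let t1 : R := pi / q%:R.
Let b (l : nat) : R := sin (l%:R * t1).
Let kappa : R := cos t1 - cos (2 * t1).
(* As [2 * t1 = pi / Q], positivity of [psi (theta n x y)] forces
   [0 < a n - x - y < 1]. *)
Let psi (t : R) : R := 2 * (cos t - cos (2 * t1)) *
  ((\sum_(0 <= l < q) b l * cos (l%:R * t)) ^+ 2 +
   (\sum_(0 <= l < q) b l * sin (l%:R * t)) ^+ 2).

Let q0 : (0 < q)%N. Proof. by []. Qed.
Let qR : 0 < q%:R :> R. Proof. by rewrite ltr0n. Qed.

Let E_psi : E psi = \sum_(0 <= l < q) b 1 * b l * (X l%:R + X (q%:R - l%:R)) +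
  2 * kappa * \sum_(0 <= l < q) \sum_(0 <= k < q) b l * b k * X (l%:R - k%:R).
Proof.
have -> : psi = fun t =>
   \sum_(0 <= l < q) b 1 * b l * (cos (l%:R * t) + cos ((q%:R - l%:R) * t)) +
   2 * kappa * \sum_(0 <= l < q) \sum_(0 <= k < q) b l * b k * cos ((l%:R - k%:R) * t).
  apply: funext => t; rewrite /psi kernelE //; congr (_ + _ * _).
  by apply: eq_bigr => l _; apply: eq_bigr => k _; rewrite mulrBl.
rewrite E_D E_Z !E_sum; congr (_ + _ * _).
  by apply: eq_bigr => l _; rewrite E_Z E_D.
apply: eq_bigr => l _; rewrite E_sum; apply: eq_bigr => k _.
by rewrite E_Z.
Qed.

Let t1_bound : 0 < t1 <= 1 /\ t1 <= pi / 2.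
Proof.
have h : 4 <= q%:R :> R by rewrite ler_nat /q /Q; clear; lia.
have pi0 := pi_gt0 R; have pi4 : pi <= 4 :> R by have := pihalf_lt2 R; lra.
split; last by rewrite /t1 ler_pM2l // lef_pV2 ?posrE //; lra.
by rewrite divr_gt0 //= ler_pdivrMr // mul1r; lra.
Qed.

Let sigma : R := sin (t1 / 2).

Let sigma_ge : 1 <= 4 * Q%:R * sigma.
Proof.
have [/andP[t0 tle] _] := t1_bound.
have := sin_taylor1 R 0 (t1 / 2).
rewrite add0r sin0 cos0 subr0 mulr1 ler_norml => /andP[h _].
have : t1 / 4 <= sigma.
  have : t1 * t1 <= t1 * 1 by apply: ler_wpM2l => //; exact: ltW.
  by move: h; rewrite /sigma expr2; lra.
have -> : t1 = pi / (2 * Q%:R) by rewrite /t1 /q -mul2n natrM.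
have pi2 := pi_ge2 R.
move=> h2; apply: (@le_trans _ _ (4 * Q%:R * (pi / (2 * Q%:R) / 4))).
  have -> : 4 * Q%:R * (pi / (2 * Q%:R) / 4) = pi / 2 :> R by field; rewrite gt_eqF.
  by lra.
by apply: ler_wpM2l => //; rewrite mulr_ge0 // ltW.
Qed.

Let sigma_gt0 : 0 < sigma.
Proof.
have := sigma_ge; rewrite ltNge; case: (leP sigma 0) => // h.
have : 4 * Q%:R * sigma <= 0 by apply: mulr_ge0_le0 => //; rewrite mulr_ge0 // ltW.
by lra.
Qed.

Let cos_t1 : 0 <= cos t1 <= 1 /\ cos t1 = 1 - 2 * sigma ^+ 2.
Proof.
have [/andP[t0 tle] t2] := t1_bound; split.
  by rewrite cos_le1 andbT; apply: cos_ge0_pihalf; lra.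
have e : t1 = t1 / 2 + t1 / 2 by field.
by rewrite {1}e cosD -!expr2 cos2sin2 /sigma; ring.
Qed.

Let cos_2t1 : cos (2 * t1) = 2 * cos t1 ^+ 2 - 1.
Proof. by rewrite mulr_natl cos_mulr2n; ring. Qed.

Let kappa_ge : 2 * sigma ^+ 2 <= kappa.
Proof.
have [/andP[c0 c1] e] := cos_t1; rewrite /kappa cos_2t1.
have : cos t1 * (cos t1 - 1) <= 0 by apply: mulr_ge0_le0 => //; lra.
by rewrite expr2 in e *; lra.
Qed.

Let kappa_gt0 : 0 < kappa.
Proof. by apply: lt_le_trans kappa_ge; rewrite mulr_gt0 // exprn_gt0. Qed.

(** [b 1] has order [1 / Q] and [kappa] order [1 / Q ^ 2]. The bound lets the boundary sum of
    [E_psi] join the error of the double sum; the half-angle sine [sigma] gives it from crude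
    estimates only. *)
Let b1_le : b 1 <= 4 * Q%:R * kappa.
Proof.
rewrite /b mul1r; have e : t1 = t1 / 2 + t1 / 2 by field.
have h : sin t1 <= 2 * sigma.
  rewrite {1}e sinD.
  have := ler_wpM2l (ltW sigma_gt0) (cos_le1 (t1 / 2)).
  by rewrite /sigma; lra.
apply: le_trans h _.
apply: (@le_trans _ _ (4 * Q%:R * (2 * sigma ^+ 2))); last first.
  by apply: ler_wpM2l kappa_ge; rewrite mulr_ge0 // ltW.
have : sigma * 1 <= sigma * (4 * Q%:R * sigma) by apply: ler_wpM2l sigma_ge; exact: ltW sigma_gt0.
by lra.
Qed.

Let b_bound l : (l < q)%N -> 0 <= b l <= 1.
Proof.
move=> lq; rewrite sin_le1 andbT; apply: sin_ge0_pi; apply/andP; split.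
  by rewrite mulr_ge0 //; have [/andP[t0 _] _] := t1_bound; exact: ltW.
have -> : pi = q%:R * t1 :> R by rewrite /t1; field; rewrite gt_eqF.
apply: ler_wpM2r; first by have [/andP[t0 _] _] := t1_bound; exact: ltW.
by rewrite ler_nat ltnW.
Qed.

Let sum_b2 : \sum_(0 <= l < q) b l ^+ 2 = Q%:R.
Proof.
have [/andP[t0 tle] t2] := t1_bound.
rewrite (eq_bigr (fun l : nat => 2^-1 - 2^-1 * cos (l%:R * (2 * t1)))); last first.
  move=> l _; rewrite mulrCA mulr_natl cos_mulr2n /b.
  by have := cos2Dsin2 (l%:R * t1); rewrite !expr2 => ?; lra.
rewrite sumrB -mulr_sumr sum_cos_eq0; last 2 first.
  - have -> : 2 * t1 / 2 = t1 by field.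
    by apply: lt0r_neq0; apply: sin_gt0_pi; have := pi_gt0 R; lra.
  - by exists 1; rewrite /t1; field; rewrite gt_eqF.
rewrite mulr0 subr0 big_const_nat iter_addr addr0 subn0 -[LHS]mulr_natr /q -muln2 natrM.
by field.
Qed.

Let sumY1 (l : nat) : (l <= q)%N -> \sum_(1 <= j < l) Y j <= 2 * B * (q%:R * (size s)%:R).
Proof.
move=> lq; rewrite -sum_Y.
have [l0|l0] := posnP l; first by rewrite l0 big_geq // sumr_ge0.
rewrite (@big_cat_nat _ _ _ l 0 q) //= (@big_cat_nat _ _ _ 1 0 l) //=.
by rewrite -addrA addrCA lerDl addr_ge0 // sumr_ge0.
Qed.

(** The diagonal term is kept. Off it, a lag [j] occurs at most twice, as [l - k] and as [k - l],
    whence two copies of the total of [Y]. *)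
Let row (l : nat) : (l < q)%N ->
  b l ^+ 2 * X 0 - 2 * (2 * B * (q%:R * (size s)%:R)) <=
  \sum_(0 <= k < q) b l * b k * X (l%:R - k%:R).
Proof.
move=> lq.
have term (k j : nat) : (k < q)%N -> (0 < j < q)%N -> l%:R - k%:R = j%:R :> R \/ l%:R - k%:R = - j%:R :> R ->
    - Y j <= b l * b k * X (l%:R - k%:R).
  move=> kq jq h; have -> : X (l%:R - k%:R) = X j%:R by case: h => ->; rewrite ?X_opp.
  have /andP[h1 h2] := b_bound l lq; have /andP[h3 h4] := b_bound k kq.
  have h5 := X_le j jq; have h6 := Y_ge0 j.
  have h7 : 0 <= b l * b k <= 1 by rewrite mulr_ge0 // mulr_ile1.
  case/andP: h7 => h7 h8.
  have h9 : b l * b k * (- Y j) <= b l * b k * X j%:R by apply: ler_wpM2l.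
  have h10 : b l * b k * Y j <= 1 * Y j by apply: ler_wpM2r.
  by lra.
have Yq := sumY1 q (leqnn q).
have Yl (m : nat) : (m <= q)%N -> - (2 * B * (q%:R * (size s)%:R)) <= \sum_(1 <= j < m) - Y j.
  by move=> mq; rewrite sumrN lerN2; exact: sumY1.
rewrite (@big_cat_nat _ _ _ l 0 q) ?(ltnW lq) //= (@big_ltn _ _ _ l q) // subrr -expr2.
rewrite (big_addn 0 q l.+1 xpredT).
have lo : - (2 * B * (q%:R * (size s)%:R)) <= \sum_(0 <= k < l) b l * b k * X (l%:R - k%:R).
  rewrite big_nat_rev /=.
  apply: le_trans (Yl l.+1 lq) _; rewrite big_add1 /= [leLHS]big_nat [leRHS]big_nat.
  apply: ler_sum => k /andP[_ kl]; apply: term; [clear -kl lq; lia|clear -kl lq; lia|].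
  by left; rewrite -natrB; [congr (_%:R); clear -kl; lia|clear -kl; lia].
have hi : - (2 * B * (q%:R * (size s)%:R)) <=
    \sum_(0 <= k < q - l.+1) b l * b (k + l.+1)%N * X (l%:R - (k + l.+1)%N%:R).
  apply: le_trans (Yl (q - l)%N (leq_subr _ _)) _.
  rewrite big_add1 /= (_ : (q - l).-1 = (q - l.+1)%N); last by clear; lia.
  rewrite [leLHS]big_nat [leRHS]big_nat.
  apply: ler_sum => k /andP[_ kl]; apply: term; [clear -kl lq; lia|clear -kl lq; lia|].
  by right; rewrite addnS -addSn natrD; ring.
by lra.
Qed.

Let E_psi_ge : 2 * kappa * Q%:R * (W * (size s)%:R ^+ 2 - 32 * B * Q%:R * (size s)%:R) <= E psi.
Proof.
set SY := 2 * B * (q%:R * (size s)%:R).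
have SY0 : 0 <= SY by rewrite /SY !mulr_ge0.
have qQ : q%:R = 2 * Q%:R :> R by rewrite /q -mul2n natrM.
have /andP[b10 b11] : 0 <= b 1 <= 1 by apply: b_bound.
have first_sum : - (2 * b 1 * SY) <=
    \sum_(0 <= l < q) b 1 * b l * (X l%:R + X (q%:R - l%:R)).
  have b00 : b 0 = 0 by rewrite /b mul0r sin0.
  rewrite big_ltn // b00 mulr0 mul0r add0r.
  apply: (@le_trans _ _ (\sum_(1 <= l < q) b 1 * - (Y l + Y (q - l)%N))).
    rewrite -mulr_sumr sumrN big_split /=.
    have -> : \sum_(1 <= i < q) Y (q - i)%N = \sum_(1 <= i < q) Y i.
      by rewrite [RHS]big_nat_rev /=; apply: eq_bigr => i _; rewrite add1n subSS.
    have : b 1 * \sum_(1 <= i < q) Y i <= b 1 * SY.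
      by apply: ler_wpM2l => //; exact: sumY1.
    by lra.
  rewrite [leLHS]big_nat [leRHS]big_nat; apply: ler_sum => l /andP[l0 lq].
  rewrite -mulrA; apply: ler_wpM2l => //.
  have /andP[h1 h2] := b_bound l lq.
  rewrite -natrB ?(ltnW lq) //.
  have h3 := X_le l ltac:(clear -l0 lq; lia).
  have h4 := X_le (q - l)%N ltac:(clear -l0 lq; lia).
  have h5 := Y_ge0 l; have h6 := Y_ge0 (q - l)%N.
  have h7 : b l * - (Y l + Y (q - l)%N) <= b l * (X l%:R + X (q - l)%:R).
    by apply: ler_wpM2l => //; lra.
  have h8 : b l * (Y l + Y (q - l)%N) <= 1 * (Y l + Y (q - l)%N).
    by apply: ler_wpM2r => //; lra.
  by lra.
have second_sum : Q%:R * X 0 - q%:R * (2 * SY) <=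
    \sum_(0 <= l < q) \sum_(0 <= k < q) b l * b k * X (l%:R - k%:R).
  apply: (@le_trans _ _ (\sum_(0 <= l < q) (b l ^+ 2 * X 0 - 2 * SY))).
    by rewrite sumrB -mulr_suml sum_b2 big_const_nat iter_addr addr0 subn0 -[2 * SY *+ q]mulr_natl.
  rewrite [leLHS]big_nat [leRHS]big_nat; apply: ler_sum => l /andP[l0 lq].
  exact: row.
rewrite E_psi -X0.
have k0 := kappa_gt0.
have h1 : 2 * kappa * (Q%:R * X 0 - q%:R * (2 * SY)) <= 2 * kappa *
    \sum_(0 <= l < q) \sum_(0 <= k < q) b l * b k * X (l%:R - k%:R).
  by apply: ler_wpM2l => //; lra.
have h2 : b 1 * SY <= 4 * Q%:R * kappa * SY by apply: ler_wpM2r => //; exact: b1_le.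
have h3 : SY = 4 * B * Q%:R * (size s)%:R by rewrite /SY qQ; ring.
apply: le_trans (lerD first_sum h1); rewrite qQ.
have -> : 2 * kappa * Q%:R * (X 0 - 32 * B * Q%:R * (size s)%:R) =
  2 * kappa * Q%:R * X 0 - 16 * kappa * Q%:R * SY by rewrite h3; ring.
by lra.
Qed.

Let psi_max t : psi t <= 32 * kappa * Q%:R ^+ 2.
Proof.
have k0 := kappa_gt0.
have k2 : 0 <= 32 * kappa * Q%:R ^+ 2 by rewrite !mulr_ge0 // ltW.
set P := (\sum_(0 <= l < q) b l * cos (l%:R * t)) ^+ 2 +
   (\sum_(0 <= l < q) b l * sin (l%:R * t)) ^+ 2.
have P0 : 0 <= P by rewrite addr_ge0 // sqr_ge0.
have Pq : P <= q%:R ^+ 2 by exact: kernel_sqr_le.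
have -> : psi t = 2 * (cos t - cos (2 * t1)) * P by [].
have [h|h] := leP (cos t - cos (2 * t1)) 0.
  by apply: le_trans k2; rewrite mulr_le0_ge0 // mulr_ge0_le0.
(* [1 - cos (2 * t1) = 2 * (1 - cos t1) * (1 + cos t1)], and this is at most [4 * kappa]. *)
have h1 : 2 * (cos t - cos (2 * t1)) <= 8 * kappa.
  have [/andP[c0 c1] e] := cos_t1.
  have h2 : 1 - cos t1 <= kappa by have := kappa_ge; lra.
  rewrite cos_2t1; have h3 := cos_le1 t.
  have : (1 - cos t1) * (1 + cos t1) <= (1 - cos t1) * 2 by apply: ler_wpM2l; lra.
  by rewrite expr2; lra.
have -> : 32 * kappa * Q%:R ^+ 2 = 8 * kappa * q%:R ^+ 2.
  by rewrite /q -mul2n natrM; ring.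
by apply: ler_pM => //; lra.
Qed.

(** Since [x + y + 2 <= Q] and [0 <= a n <= Q], the number [a n - x - y - 1/2] is at most [Q - 1/2]
    in absolute value: there is no wrap-around modulo [Q], and its distance to the multiples of [Q]
    is at least [1/2] unless there is a hit. *)
Let psi_le0 n x y : (n0 <= n < M)%N -> x \in s -> y \in s ->
  ~ (0 < a n - x%:R - y%:R < 1) -> psi (theta n x y) <= 0.
Proof.
move=> nM xs ys nxy; rewrite /psi; apply: mulr_le0_ge0; last by rewrite addr_ge0 // sqr_ge0.
rewrite pmulr_rle0 // subr_le0.
have -> : 2 * t1 = pi / Q%:R by rewrite /t1 /q -mul2n natrM; field; rewrite gt_eqF.
have pi0 := pi_gt0 R.
have Q2 : 2 <= Q%:R :> R by rewrite ler_nat.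
apply: cos_le_cos_outside.
  apply/andP; split; first by rewrite divr_ge0 // ltW.
  by rewrite ler_pdivrMr // ler_peMr; lra.
have /andP[a0 aQ] := a_bound n nM.
have /andP[x0 xN] := s_bound x xs; have /andP[y0 yN] := s_bound y ys.
set v := a n - x%:R - y%:R - 2^-1.
have v1 : 2^-1 <= `|v|.
  rewrite leNgt; apply/negP; rewrite ltr_norml => /andP[h1 h2]; apply: nxy.
  by rewrite /v in h1 h2; apply/andP; split; lra.
have v2 : `|v| <= Q%:R - 2^-1.
  have h1 : 1 <= x%:R :> R by rewrite ler1n.
  have h2 : 1 <= y%:R :> R by rewrite ler1n.
  have h3 : x%:R + y%:R + 2 <= Q%:R :> R.
    by rewrite -!natrD ler_nat /Q; clear -xN yN; lia.
  by rewrite ler_norml /v; lra.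
have -> : pi / Q%:R = 2 * pi / Q%:R * 2^-1 :> R by field; rewrite gt_eqF.
have b0 : 0 < 2 * pi / Q%:R :> R by rewrite divr_gt0 // mulr_gt0.
rewrite /theta -/v normrM (gtr0_norm b0) ler_pM2l // v1 /=.
have -> : 2 * pi - 2 * pi / Q%:R * 2^-1 = 2 * pi / Q%:R * (Q%:R - 2^-1) :> R.
  by field; rewrite gt_eqF.
by rewrite ler_pM2l.
Qed.

(** Without a hit off the diagonal, [psi] is positive only at pairs [x = y], and for each [n] at one
    of them at most, because the numbers [2 * x] are at least 2 apart. Hence the average is at most
    [W] times the maximum of [psi], which contradicts [E_psi_ge]. *)
Lemma sum_hits_near :
  16 * W * Q%:R + 32 * B * Q%:R * (size s)%:R < W * (size s)%:R ^+ 2 ->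
  exists x y n, [/\ x \in s, y \in s, x <> y, (n0 <= n < M)%N &
     0 < a n - x%:R - y%:R < 1].
Proof.
move=> big; apply: contrapT => no.
have no' n x y : (n0 <= n < M)%N -> x \in s -> y \in s -> x != y -> psi (theta n x y) <= 0.
  move=> nM xs ys /eqP xy; apply: psi_le0 => // h; apply: no.
  by exists x, y, n.
have k0 := kappa_gt0.
have k2 : 0 <= 32 * kappa * Q%:R ^+ 2 by rewrite !mulr_ge0 // ltW.
have inner n : (n0 <= n < M)%N ->
    \sum_(x <- s) \sum_(y <- s) psi (theta n x y) <= 32 * kappa * Q%:R ^+ 2.
  move=> nM.
  have h x : x \in s -> \sum_(y <- s) psi (theta n x y) <= psi (theta n x x).
    move=> xs; rewrite (bigD1_seq x) //= gerDl big_seq_cond.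
    by apply: sumr_le0 => y /andP[ys yx]; apply: no' => //; rewrite eq_sym.
  apply: (@le_trans _ _ (\sum_(x <- s) psi (theta n x x))).
    by rewrite big_seq [leRHS]big_seq; apply: ler_sum.
  have [[x0 x0s px]|none] := pselect (exists2 x, x \in s & 0 < psi (theta n x x)).
    rewrite (bigD1_seq x0) //=.
    suff : \sum_(x <- s | x != x0) psi (theta n x x) <= 0.
      by have := psi_max (theta n x0 x0); lra.
    rewrite big_seq_cond; apply: sumr_le0 => x /andP[xs xx0].
    apply: psi_le0 => // /andP[h1 h2].
    have /andP[h3 h4] : 0 < a n - x0%:R - x0%:R < 1.
      by apply: contrapT => /(psi_le0 n x0 x0 nM x0s x0s); rewrite leNgt px.
    have [lt|lt|e] := ltngtP x x0; last by rewrite e eqxx in xx0.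
      have : x%:R + 1 <= x0%:R :> R by rewrite natr1 ler_nat.
      by lra.
    have : x0%:R + 1 <= x%:R :> R by rewrite natr1 ler_nat.
      by lra.
  apply: le_trans k2; rewrite big_seq; apply: sumr_le0 => x xs.
  by rewrite leNgt; apply/negP => px; apply: none; exists x.
have up : E psi <= W * (32 * kappa * Q%:R ^+ 2).
  rewrite /E /W mulr_suml [leLHS]big_nat [leRHS]big_nat; apply: ler_sum => n nM.
  by apply: ler_wpM2l; [exact: w_ge0|exact: inner].
have := le_trans E_psi_ge up.
have -> : W * (32 * kappa * Q%:R ^+ 2) = 2 * kappa * Q%:R * (16 * W * Q%:R) by ring.
rewrite ler_pM2l ?mulr_gt0 //; lra.
Qed.

End hit.

(** * Hitting sums of a dense set *)

Section equidistribution.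
Variable R : realType.

(* The condition on [e'] excludes the frequencies so small that the sum is not
   small; the weighted sums are then estimated by telescoping. *)
Definition exp_sums_small (n0 : nat) (a : nat -> R) : Prop :=
  forall e e' : R, 0 < e -> 0 < e' -> exists M0 : nat, forall M m (s phi : R),
    (M0 <= M)%N -> (m <= M)%N -> 0 < s <= 2 -> e' <= s * (a M.+1 - a M) ->
    \sum_(n0 <= n < m) cos (2 * pi * s * a n + phi) <= e * M%:R.

Section weighted.
Variables (n0 : nat) (a : nat -> R) (c C : R).
Let w n := a n.+1 - a n.
Hypothesis c_gt0 : 0 < c.
Hypothesis C_gt0 : 0 < C.
Hypothesis a_ge0 : 0 <= a n0.
Hypothesis w_gt0 : forall n, (n0 <= n)%N -> 0 < w n.
Hypothesis w_mono : forall m, monotone_on _ n0 m w.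
Hypothesis w_comp : forall n m, (n0 <= n <= m)%N -> c * w n <= w m.
Hypothesis w_le : forall n, (n0 <= n)%N -> n%:R * w n <= C * a n.
Hypothesis a_unbounded : forall X : R, exists2 n, (n0 <= n)%N & X < a n.
Hypothesis a_small : exp_sums_small n0 a.

Let a_mono n m : (n0 <= n <= m)%N -> a n <= a m.
Proof.
move=> /andP[n0n]; elim: m => [|m IH]; first by rewrite leqn0 => /eqP ->.
rewrite leq_eqVlt => /orP[/eqP -> //|nm]; apply: le_trans (IH nm) _.
by have := w_gt0 m (leq_trans n0n nm); rewrite /w; lra.
Qed.

Let sum_w m : (n0 <= m)%N -> \sum_(n0 <= n < m) w n = a m - a n0.
Proof. by move=> h; rewrite telescope_sumr. Qed.

Let first_above (Q : R) : a n0 <= Q -> exists M, [/\ (n0 < M)%N, Q < a M &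
  forall n, (n0 <= n < M)%N -> a n <= Q].
Proof.
move=> aQ; have [M n0M MQ] := a_unbounded Q.
have ex : exists n, (n0 <= n)%N && (Q < a n) by exists M; apply/andP; split.
case: (ex_minnP ex) => m /andP[n0m mQ] min.
exists m; split=> //.
  by rewrite ltn_neqAle n0m andbT; apply/eqP => e; rewrite -e ltNge aQ in mQ.
move=> n /andP[n0n nm]; rewrite leNgt; apply/negP => Qn.
by have := min n; rewrite n0n Qn leqNgt nm => /(_ isT).
Qed.

(** [M] is the first index with [a M > Q]. If the phase moves by little at each step, the sum is
    close to an integral over [[0, Q]], that is over [j] full periods, which vanishes. Otherwise
    summation by parts leads to unweighted sums; by [w_le] the weights are [O(Q / M)], so a bound
    [o(M)] for these becomes [o(Q)]. *)
Lemma weighted_exp_sums (e : R) : 0 < e <= 1 -> exists Q0 : nat, forall Q : nat, (Q0 <= Q)%N ->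
  exists M, [/\ (n0 < M)%N, forall n, (n0 <= n < M)%N -> 0 <= a n <= Q%:R,
    Q%:R / 2 <= \sum_(n0 <= n < M) w n &
    forall (j : nat) (phi : R), (0 < j < Q.*2)%N ->
      \sum_(n0 <= n < M) w n * cos (j%:R * (2 * pi / Q%:R) * a n + phi) <= e * Q%:R].
Proof.
move=> /andP[e0 ele1].
pose C2 := 2 * C / c.
have C20 : 0 < C2 by rewrite /C2 divr_gt0 // mulr_gt0.
pose e1 := e / 64.
have e10 : 0 < e1 by rewrite /e1; lra.
pose e2 := e / (4 * C2).
have e20 : 0 < e2 by rewrite /e2 divr_gt0 // mulr_gt0.
(* The factor [c ^ 2] comes from two uses of [w_comp]: the increment at [M] against the one at
   [M - 1], and the latter against the upper bound [wm] of all weights. *)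
have [M1 small] := a_small e2 (c ^+ 2 * e1) e20 (mulr_gt0 (exprn_gt0 2 c_gt0) e10).
have [M2 /andP[_ M2e]] := truncn_ex _ (8 * C2 / e) ltac:(by apply: ltW; rewrite divr_gt0 // mulr_gt0).
pose M3 := (maxn n0 (maxn M1 M2.+2)).
have [Q1 /andP[_ Q1a]] := truncn_ex _ (a M3) (le_trans a_ge0 (a_mono n0 M3 ltac:(rewrite leqnn /=; exact: leq_maxl))).
have [Q2 /andP[_ Q2a]] := truncn_ex _ (a n0 * (2 + 8 / e)) ltac:(by rewrite mulr_ge0 // addr_ge0 // divr_ge0 // ltW).
exists (maxn 1 (maxn Q1.+1 Q2.+1)) => Q.
rewrite !geq_max => /andP[Qge1 /andP[QQ1 QQ2]].
have QR : 0 < Q%:R :> R by rewrite ltr0n.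
have Qa : a M3 <= Q%:R by apply: ltW; apply: lt_le_trans Q1a _; rewrite ler_nat.
have Qan0 : a n0 * (2 + 8 / e) <= Q%:R by apply: ltW; apply: lt_le_trans Q2a _; rewrite ler_nat.
have Qa1 : 2 * a n0 <= Q%:R.
  apply: le_trans Qan0; rewrite mulrC; apply: ler_wpM2l => //.
  by rewrite lerDl divr_ge0 // ltW.
have Qa2 : a n0 <= e / 8 * Q%:R.
  have -> : a n0 = e / 8 * (a n0 * (8 / e)) by field; rewrite gt_eqF.
  apply: ler_wpM2l; first by lra.
  by apply: le_trans Qan0; apply: ler_wpM2l => //; lra.
have [|M [n0M QM Mmin]] := first_above Q%:R; first by lra.
have M3M : (M3 < M)%N.
  rewrite ltnNge; apply/negP => MM3.
  by have := a_mono M M3 ltac:(by rewrite MM3 ltnW); lra.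
have [MM1 MM2] : (M1 <= M)%N /\ (M2.+2 <= M)%N.
  by move: M3M; rewrite /M3; clear; lia.
exists M; split => //.
- move=> n nM; rewrite Mmin // andbT; apply: le_trans a_ge0 (a_mono _ _ _).
  by rewrite leqnn; case/andP: nM.
- by rewrite sum_w ?(ltnW n0M) //; lra.
clear Qan0 Qa1 QQ1 QQ2 Q1a Q2a Qa Qge1; move=> j phi jQ.
pose P := M.-1.
have MP : M = P.+1 by rewrite /P prednK //; clear -n0M; lia.
have n0P : (n0 <= P)%N by rewrite MP in n0M.
pose wm := w P / c.
have wm0 : 0 < wm by rewrite divr_gt0 // w_gt0.
have w_max n : (n0 <= n < M)%N -> 0 <= w n <= wm.
  move=> /andP[n0n nM]; rewrite ltW ?w_gt0 //= ler_pdivlMr // mulrC.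
  by apply: w_comp; rewrite n0n -ltnS -MP.
have aPQ : a P <= Q%:R by apply: Mmin; rewrite n0P MP leqnn.
have Mwm : M%:R * wm <= C2 * Q%:R.
  have h1 : M%:R <= 2 * P%:R :> R by rewrite -natrM ler_nat MP; clear -MM2 MP; lia.
  have h2 := w_le P n0P.
  have h3 : C * a P <= C * Q%:R by rewrite ler_pM2l.
  have h4 : M%:R * w P <= 2 * P%:R * w P by apply: ler_wpM2r => //; apply: ltW; exact: w_gt0.
  have -> : M%:R * wm = (M%:R * w P) / c by rewrite /wm mulrA.
  have -> : C2 * Q%:R = (2 * (C * Q%:R)) / c by rewrite /C2; field; rewrite gt_eqF.
  by rewrite ler_pM2r ?invr_gt0 //; lra.
have wme : wm <= e / 8 * Q%:R.
  have h1 : 8 * C2 / e < M%:R by apply: lt_le_trans M2e _; rewrite ler_nat; clear -MM2; lia.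
  have h2 : 8 * C2 < M%:R * e by rewrite -ltr_pdivrMr.
  rewrite -(ler_pM2l C20).
  have h3 : 8 * C2 * wm <= M%:R * e * wm by apply: ler_wpM2r; exact: ltW.
  have h4 : e * (M%:R * wm) <= e * (C2 * Q%:R) by rewrite ler_pM2l.
  by lra.
pose s : R := j%:R / Q%:R.
have s0 : 0 < s by case/andP: jQ => j0 _; rewrite divr_gt0 // ltr0n.
have s2 : s <= 2.
  by rewrite ler_pdivrMr // -natrM ler_nat mul2n; case/andP: jQ => _ /ltnW.
have phase n : j%:R * (2 * pi / Q%:R) * a n = 2 * pi * s * a n by rewrite /s; ring.
under eq_bigr do rewrite phase.
have pi0 := pi_gt0 R; have pi8 : 2 * pi <= 8 :> R by have := pihalf_lt2 R; lra.
have [low|high] := leP (s * wm) e1.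
  pose x n := 2 * pi * s * a n + phi.
  have sW : \sum_(n0 <= n < M) w n <= 9 / 8 * Q%:R.
    rewrite sum_w ?(ltnW n0M) // MP.
    have h1 : w P <= wm by case/andP: (w_max P ltac:(by rewrite n0P MP leqnn)).
    have h2 : e / 8 * Q%:R <= 1 / 8 * Q%:R by rewrite ler_pM2r // ler_pM2r.
    have hw : w P = a P.+1 - a P by [].
    have t1 : wm <= 1 / 8 * Q%:R by lra.
    have t2 : a P.+1 <= Q%:R + wm by lra.
    by have t3 := a_ge0; lra.
  pose k := 2 * pi * s.
  have k0 : 0 < k by rewrite /k mulr_gt0 // mulr_gt0.
  have step n : (n0 <= n < M)%N ->
      k * (w n * cos (x n)) <= (sin (x n.+1) - sin (x n)) + k * (8 * e1 * w n).
    move=> nM; have /andP[h1 h2] := w_max n nM.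
    have := sin_taylor1 R (x n) (k * w n).
    have -> : x n + k * w n = x n.+1 by rewrite /x /k /w; ring.
    rewrite ler_norml => /andP[h3 _].
    have h4 : w n * s <= e1.
      by apply: le_trans low; rewrite mulrC; apply: ler_wpM2l => //; exact: ltW.
    have h5 : k * w n * (w n * s * (2 * pi)) <= k * w n * (e1 * 8).
      apply: ler_wpM2l; first by rewrite mulr_ge0 // ltW.
      by apply: ler_pM => //; rewrite ?mulr_ge0 ?(ltW s0) ?(ltW pi0).
    have h6 : (k * w n) ^+ 2 = k * w n * (w n * s * (2 * pi)) by rewrite /k; ring.
    by rewrite h6 in h3; lra.
  have tot : k * (\sum_(n0 <= n < M) w n * cos (x n)) <=
      (sin (x M) - sin (x n0)) + k * (8 * e1 * \sum_(n0 <= n < M) w n).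
    rewrite -(telescope_sumr (fun n => sin (x n)) (ltnW n0M)) !mulr_sumr -big_split /=.
    by rewrite [leLHS]big_nat [leRHS]big_nat; apply: ler_sum.
  (* [k * Q] is [2 * pi * j], so the end value at [a M], which exceeds [Q] by at most one step, is
     compared with the value at 0. The bound must carry the factor [k], which is divided out and may
     be tiny. *)
  have sM : `|sin (x M) - sin phi| <= k * wm.
    have -> : sin (x M) = sin (k * (a M - Q%:R) + phi).
      rewrite -!cosBpihalf -[RHS](cosD2piz _ _ j%:Z) -pmulrn /x /k /s.
      by congr cos; field; rewrite gt_eqF.
    apply: le_trans (sin_Lipschitz _ _ _) _; rewrite addrK normrM gtr0_norm //.
    rewrite ler_pM2l // ger0_norm; last by lra.
    have : w P <= wm by case/andP: (w_max P ltac:(by rewrite n0P MP leqnn)).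
    by rewrite /w -MP; lra.
  have sn0 : `|sin (x n0) - sin phi| <= k * a n0.
    apply: le_trans (sin_Lipschitz _ _ _) _; rewrite /x addrK normrM gtr0_norm //.
    by rewrite ger0_norm.
  have dif : sin (x M) - sin (x n0) <= k * (wm + a n0).
    by move: sM sn0; rewrite !ler_norml => /andP[_ h1] /andP[h2 _]; lra.
  rewrite -(ler_pM2l k0); apply: le_trans tot _.
  apply: le_trans (lerD dif (lexx _)) _; rewrite -mulrDr ler_pM2l //.
  have : 8 * e1 * \sum_(n0 <= n < M) w n <= 8 * e1 * (9 / 8 * Q%:R).
    by apply: ler_wpM2l => //; lra.
  by rewrite /e1; lra.
have sbig : c ^+ 2 * e1 <= s * (a M.+1 - a M).
  have h1 : c * w P <= w M by apply: w_comp; rewrite n0P MP leqnSn.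
  have h2 : c ^+ 2 * (s * wm) = s * (c * w P) by rewrite /wm; field; rewrite gt_eqF.
  have h3 : c ^+ 2 * e1 <= c ^+ 2 * (s * wm) by rewrite ler_pM2l ?exprn_gt0 // ltW.
  have h4 : s * (c * w P) <= s * w M by rewrite ler_pM2l.
  by rewrite /w in h4 h2; lra.
pose S m := \sum_(n0 <= n < m) cos (2 * pi * s * a n + phi).
have Sb m : (m <= M)%N -> `|S m| <= e2 * M%:R.
  move=> mM; rewrite ler_norml small ?s0 // andbT lerNl -sumrN.
  under eq_bigr do rewrite -cosDpi -addrA.
  by apply: small; rewrite ?s0.
have -> : \sum_(n0 <= n < M) w n * cos (2 * pi * s * a n + phi) =
    \sum_(n0 <= n < M) w n * (S n.+1 - S n).
  rewrite big_nat [RHS]big_nat; apply: eq_bigr => n /andP[n0n _].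
  by rewrite /S big_nat_recr //= [X in w n * (X - _)]addrC addrK.
apply: le_trans (abel_monotone _ w S n0 M wm (e2 * M%:R) (ltW wm0) _ w_max Sb (w_mono M)) _.
  by rewrite mulr_ge0 // ltW.
have -> : 2 * wm * (e2 * M%:R) = 2 * e2 * (M%:R * wm) by ring.
apply: (@le_trans _ _ (2 * e2 * (C2 * Q%:R))).
  by apply: ler_wpM2l => //; rewrite mulr_ge0 // ltW.
have -> : 2 * e2 * (C2 * Q%:R) = e / 2 * Q%:R by rewrite /e2; field; rewrite gt_eqF.
by apply: ler_wpM2r => //; rewrite ler_pdivrMr // ler_peMr ?ler1n // ltW.
Qed.

Lemma dense_set_hits (A : set nat) (delta : R) : 0 < delta <= 1 ->
  (forall N0, exists N s, [/\ (N0 <= N)%N, uniq s,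
     forall x, x \in s -> A x /\ (0 < x <= N)%N & delta * N%:R <= (size s)%:R]) ->
  exists x y n, [/\ A x, A y, x <> y, (n0 <= n)%N & 0 < a n - x%:R - y%:R < 1].
Proof.
move=> /andP[d0 d1] dense.
(* With this accuracy the error [32 * B * Q * size s] is at most a quarter of [W * (size s) ^ 2];
   [K] makes the diagonal term less than half of it. *)
have [|Q0 hQ] := weighted_exp_sums (delta / 1024); first by lra.
have [K /andP[_ hK]] := truncn_ex _ (512 / delta ^+ 2) ltac:(by rewrite divr_ge0 ?ler0n ?exprn_ge0 ?ltW).
have [N [s [NQ us sA sN]]] := dense (maxn 1 (maxn Q0 K.+1)).
move: NQ; rewrite !geq_max => /andP[N1 /andP[NQ NK]].
pose Q := N.*2.+2.
have [|M [n0M aQ WQ wB]] := hQ Q; first by rewrite /Q; clear -NQ; lia.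
have QR : 0 < Q%:R :> R by rewrite ltr0n.
set W := \sum_(n0 <= n < M) w n in WQ.
set B := delta / 1024 * Q%:R in wB.
have B0 : 0 <= B by apply: mulr_ge0; lra.
have sQ : delta / 4 * Q%:R <= (size s)%:R.
  apply: le_trans sN; rewrite -mulrA ler_pM2l //.
  have : Q%:R <= 4 * N%:R :> R by rewrite -natrM ler_nat /Q; clear -N1; lia.
  by lra.
have KQ : 512 < delta ^+ 2 * Q%:R.
  have : 512 / delta ^+ 2 < Q%:R.
    by apply: lt_le_trans hK _; rewrite ler_nat /Q; clear -NK; lia.
  have d2 : 0 < delta ^+ 2 by rewrite exprn_gt0.
  by move: (512 : R) => k; rewrite ltr_pdivrMr // mulrC.
have S0 : 0 < (size s)%:R :> R by apply: lt_le_trans sQ; rewrite mulr_gt0 //; lra.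
have W0 : 0 < W by lra.
have h1 : 32 * B * Q%:R * (size s)%:R <= W * (size s)%:R ^+ 2 / 4.
  have h2 : Q%:R / 2 * (delta / 4 * Q%:R) <= W * (size s)%:R.
    by apply: ler_pM => //; rewrite ?mulr_ge0 //; lra.
  have h3 : Q%:R / 2 * (delta / 4 * Q%:R) * (size s)%:R <= W * (size s)%:R * (size s)%:R.
    by rewrite ler_pM2r.
  have h4 : 32 * B * Q%:R * (size s)%:R = Q%:R / 2 * (delta / 4 * Q%:R) * (size s)%:R / 4.
    by rewrite /B; lra.
  by rewrite h4 expr2; lra.
have h2 : 16 * W * Q%:R < W * (size s)%:R ^+ 2 / 2.
  have h3 : (delta / 4 * Q%:R) ^+ 2 <= (size s)%:R ^+ 2.
    by apply: lerXn2r => //; rewrite nnegrE ?mulr_ge0 //; lra.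
  have h4 : 512 * Q%:R < delta ^+ 2 * Q%:R * Q%:R by rewrite ltr_pM2r.
  have h5 : 32 * Q%:R < (size s)%:R ^+ 2 :> R.
    by apply: (lt_le_trans _ h3); rewrite exprMn expr_div_n; rewrite !expr2 in h4 *; lra.
  have h6 : W * (32 * Q%:R) < W * (size s)%:R ^+ 2 by rewrite ltr_pM2l.
  by lra.
have h3 : 0 < W * (size s)%:R ^+ 2 by rewrite mulr_gt0 // exprn_gt0.
have ineq : 16 * W * Q%:R + 32 * B * Q%:R * (size s)%:R < W * (size s)%:R ^+ 2 by lra.
have [x [y [n [xs ys xy /andP[n0n nM] h]]]] := sum_hits_near R s N a w n0 M B us
  (fun x xs => (sA x xs).2) aQ (fun n nM => ltW (w_gt0 n (proj1 (andP nM)))) B0 wB ineq.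
by exists x, y, n; split => //; [exact: (sA x xs).1|exact: (sA y ys).1].
Qed.
End weighted.
End equidistribution.

(** * Derivative tests along a sequence *)

Section kdt_sequence.
Variable R : realType.
Implicit Types a f v : nat -> R.

Lemma monotone_onZ (p p' m m' : nat) (c : R) v : (p <= p')%N -> (m' <= m)%N ->
  monotone_on _ p m v -> monotone_on _ p' m' (fun n => c * v n).
Proof.
move=> pp mm; have [c0|/ltW c0] := leP 0 c; case=> h; [left|right|right|left] => n pn nm.
- by apply: ler_wpM2l => //; apply: h; [exact: leq_trans pn|exact: leq_trans mm].
- by apply: ler_wpM2l => //; apply: h; [exact: leq_trans pn|exact: leq_trans mm].
- by apply: ler_wnM2l => //; apply: h; [exact: leq_trans pn|exact: leq_trans mm].
- by apply: ler_wnM2l => //; apply: h; [exact: leq_trans pn|exact: leq_trans mm].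
Qed.

(** What a derivative test up to [M] asks of [v] once the first [e * M] terms are dropped: the
    values left agree up to a constant that may depend on [e]. *)
Definition comparable_scales (v : nat -> R) : Prop :=
  forall e : R, 0 < e -> exists C (M0 : nat), 1 <= C /\ forall M n : nat, (M0 <= M)%N ->
    e * M%:R <= n%:R -> (n <= M)%N -> `|v M| <= C * `|v n| /\ `|v n| <= C * `|v M|.

Lemma sum_cos_split (f : nat -> R) (phi B : R) (n0 p m : nat) :
  p%:R <= B -> 0 <= B ->
  ((p <= m)%N -> (n0 <= p)%N -> \sum_(p <= n < m) cos (f n + phi) <= B) ->
  ((p <= n0)%N -> \sum_(n0 <= n < m) cos (f n + phi) <= B) ->
  \sum_(n0 <= n < m) cos (f n + phi) <= 2 * B.
Proof.
move=> pB B0 tail all.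
have [pn0|n0p] := leqP p n0; first by have := all pn0; lra.
have [mp|pm] := leqP m p.
  apply: (@le_trans _ _ (m - n0)%:R).
    by apply: sum_nat_le1 => n; exact: cos_le1.
  have : (m - n0)%:R <= p%:R :> R by rewrite ler_nat; clear -mp; lia.
  by lra.
rewrite (@big_cat_nat _ _ _ p n0 m) ?(ltnW n0p) ?(ltnW pm) //=.
have h : \sum_(n0 <= n < p) cos (f n + phi) <= (p - n0)%:R.
  by apply: sum_nat_le1 => n; exact: cos_le1.
have h2 : (p - n0)%:R <= p%:R :> R by rewrite ler_nat; exact: leq_subr.
by have := tail (ltnW pm) (ltnW n0p); lra.
Qed.

(** The terms up to [e / 4 * M] are bounded trivially. On the rest the test applies with
    [lambda = 2 * pi * s * |v M| / C] and ratio [C ^ 2]. If [v] is negative, the phase is reflected,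
    cosine being even. *)
Lemma kdt_on_sequence (k n0 : nat) a : (0 < k)%N ->
  let v := fdiff _ k a in
  (forall m, monotone_on _ n0 m v) ->
  (forall n, (n0 <= n)%N -> 0 <= v n) \/ (forall n, (n0 <= n)%N -> v n <= 0) ->
  comparable_scales v ->
  forall e : R, 0 < e -> exists (T delta : R) (M0 : nat), [/\ 0 < T, 0 < delta &
    forall M m (s phi : R), (M0 <= M)%N -> (m <= M)%N -> 0 < s ->
      s * `|v M| <= delta -> T <= s * `|v M| * M%:R ^+ k ->
      \sum_(n0 <= n < m) cos (2 * pi * s * a n + phi) <= e * M%:R].
Proof.
move=> k0 v mono sgn comp e e0.
have [C [M1 [C1 comp1]]] := comp (e / 4) ltac:(lra).
have C0 : 0 < C by lra.
have [T [d [T0 d0 H]]] := kdtP R k k0 (e / 2) (C ^+ 2) ltac:(lra) ltac:(by rewrite exprn_ege1).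
have [M2 /andP[_ M2e]] := truncn_ex _ (T + 4 / e) ltac:(by rewrite addr_ge0 ?divr_ge0 // ltW).
exists (T * C), (d / 8), (maxn M1 M2.+1); split; [by rewrite mulr_gt0|lra|].
move=> M m s phi; rewrite geq_max => /andP[MM1 MM2] mM s0 svd svT.
have MR : T + 4 / e < M%:R by apply: lt_le_trans M2e _; rewrite ler_nat.
have e4 : 0 < 4 / e by rewrite divr_gt0.
have M0 : 0 < M%:R :> R by lra.
have eM : 1 <= e / 4 * M%:R.
  have : e / 4 * (4 / e) <= e / 4 * M%:R by apply: ler_wpM2l; lra.
  by have -> : e / 4 * (4 / e) = 1 by field; rewrite gt_eqF.
have [K /andP[K1 K2]] := truncn_ex _ (e / 4 * M%:R) ltac:(lra).
have -> : e * M%:R = 2 * (e / 2 * M%:R) by field.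
have tail p : (n0 <= p)%N -> (K < p)%N -> (p <= m)%N ->
    \sum_(p <= n < m) cos (2 * pi * s * a n + phi) <= e / 2 * M%:R.
  move=> n0p Kp pm.
  have [sg sgE vs] : exists2 sg : R, sg = 1 \/ sg = -1 &
      forall n, (n0 <= n)%N -> sg * v n = `|v n|.
    case: sgn => sgn; [exists 1; first by left|exists (-1); first by right] => n nn.
      by rewrite mul1r ger0_norm // sgn.
    by rewrite mulN1r ler0_norm // sgn.
  pose f n := sg * (2 * pi * s) * a n.
  have fv n : fdiff _ k f n = sg * (2 * pi * s) * v n by rewrite /f fdiffZ.
  have eqc : \sum_(p <= n < m) cos (2 * pi * s * a n + phi) =
      \sum_(p <= n < m) cos (f n + sg * phi).
    apply: eq_bigr => n _; rewrite /f; case: sgE => ->; first by rewrite !mul1r.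
    by rewrite -cosN; congr cos; ring.
  have pi0 := pi_gt0 R; have pi4 : pi <= 4 :> R by have := pihalf_lt2 R; lra.
  have pi2 := pi_ge2 R.
  have vM : 0 < `|v M|.
    rewrite normr_gt0; apply/eqP => vM; move: svT; rewrite vM normr0 mulr0 mul0r.
    by rewrite leNgt mulr_gt0.
  have sv : 0 < s * `|v M| by rewrite mulr_gt0.
  have pis : 0 < 2 * pi * s by rewrite mulr_gt0 // mulr_gt0.
  have bnd n : (p <= n < m)%N -> `|v M| <= C * `|v n| /\ `|v n| <= C * `|v M|.
    move=> /andP[pn nm]; apply: comp1 => //; last by clear -nm mM; lia.
    by apply: ltW; apply: lt_le_trans K2 _; rewrite ler_nat; clear -pn Kp; lia.
  rewrite eqc; apply: (H M%:R (2 * pi * s * `|v M| / C)) => //.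
  - by rewrite ler_nat; clear -mM; lia.
  - rewrite divr_gt0 ?mulr_gt0 //= ler_pdivrMr //.
    have h1 : 2 * pi * s * `|v M| <= 8 * (s * `|v M|).
      by rewrite -mulrA; apply: ler_wpM2r; [exact: ltW|lra].
    have h2 : d * 1 <= d * C by apply: ler_wpM2l => //; exact: ltW.
    by lra.
  - by lra.
  - have -> : 2 * pi * s * `|v M| / C * M%:R ^+ k = 2 * pi * (s * `|v M| * M%:R ^+ k) / C.
      by ring.
    rewrite ler_pdivlMr //; apply: le_trans svT _.
    rewrite ler_peMl ?mulr_ge0 ?exprn_ge0 ?(ltW sv) //; first exact: ltW.
    by lra.
  - move=> n nr; have [h1 h2] := bnd n ltac:(clear -nr; lia).
    have -> : fdiff _ k f n = 2 * pi * s * `|v n|.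
      by rewrite fv -(vs n) //; [ring|clear -nr n0p; lia].
    apply/andP; split.
      rewrite ler_pdivrMr //; apply: (@le_trans _ _ (2 * pi * s * (C * `|v n|))).
        by apply: ler_wpM2l => //; exact: ltW.
      by rewrite (mulrC C) mulrA.
    have -> : C ^+ 2 * (2 * pi * s * `|v M| / C) = 2 * pi * s * (C * `|v M|).
      by field; rewrite gt_eqF.
    by apply: ler_wpM2l => //; exact: ltW.
  - have -> : fdiff _ k f = (fun n => sg * (2 * pi * s) * v n) by apply: funext.
    by apply: (@monotone_onZ n0 p m (m - k)) => //; exact: leq_subr.
have [Kn0|n0K] := leqP K.+1 n0.
  have [mn0|n0m] := leqP m n0; first by rewrite big_geq // !mulr_ge0 //; lra.
  have := tail n0 (leqnn _) Kn0 (ltnW n0m).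
  have : 0 <= e / 2 * M%:R by rewrite mulr_ge0 //; lra.
  by lra.
apply: (@sum_cos_split _ phi _ n0 K.+1 m).
- by rewrite -natr1; lra.
- by rewrite mulr_ge0 //; lra.
- by move=> Km n0K'; apply: tail.
- by rewrite leqNgt n0K.
Qed.

Lemma fdiff_growth (k n0 : nat) f (K : R) : (0 < n0)%N ->
  (forall n, (n0 <= n)%N -> `|fdiff _ k f n| <= K) ->
  exists2 K' : R, 0 < K' & forall n, (n0 <= n)%N -> `|f n| <= K' * n%:R ^+ k.
Proof.
move=> n00; elim: k f => [|k IH] f fK.
  exists (`|K| + 1); first by rewrite ltr_wpDl.
  by move=> n nn; rewrite expr0 mulr1; apply: le_trans (fK n nn) _; apply: ler_wpDr => //; exact: ler_norm.
have [|K1 K10 h] := IH (fun n => f n.+1 - f n); first by move=> n nn; rewrite -fdiffSr; exact: fK.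
exists (`|f n0| + K1); first by rewrite ltr_wpDl.
move=> n nn.
have n1 : 1 <= n%:R :> R by rewrite ler1n (leq_trans n00).
have -> : f n = f n0 + \sum_(n0 <= i < n) (f i.+1 - f i) by rewrite telescope_sumr // addrC subrK.
apply: le_trans (ler_normD _ _) _; rewrite mulrDl; apply: lerD.
  by rewrite ler_peMr // exprn_ege1.
apply: le_trans (ler_norm_sum _ _ _) _.
apply: (@le_trans _ _ (\sum_(n0 <= i < n) (K1 * n%:R ^+ k))).
  rewrite [leLHS]big_nat [leRHS]big_nat; apply: ler_sum => i /andP[n0i ni].
  apply: le_trans (h i n0i) _; rewrite ler_pM2l //.
  by apply: lerXn2r; rewrite ?nnegrE ?ler0n // ler_nat ltnW.
rewrite big_const_nat iter_addr addr0 -[leLHS]mulr_natr -mulrA ler_pM2l // exprSr.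
by apply: ler_wpM2l; [rewrite exprn_ge0|rewrite ler_nat leq_subr].
Qed.

End kdt_sequence.

Section small_sums.
Variable R : realType.
Implicit Types a f v : nat -> R.

(** The lower bound on [s] times the increment gives [s >= e' / (C * M ^ (d - 1) * g M)], so
    [s * u M * M ^ (d + 1)] is at least [e' * M ^ 2 * u M / (C * g M)], which tends to infinity,
    while [s * u M] tends to 0. One derivative test, of order [d + 1], thus covers all
    frequencies. *)
Lemma exp_sums_small_infinite (d n0 : nat) a (C : R) : (0 < d)%N -> 0 < C ->
  let g := fdiff _ d a in
  let u := fdiff _ d.+1 a in
  (forall m, monotone_on _ n0 m u) ->
  (forall n, (n0 <= n)%N -> 0 <= u n) ->
  (forall n, (n0 <= n)%N -> 0 < g n) ->
  comparable_scales R u ->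
  (forall e : R, 0 < e -> exists M0, forall M, (M0 <= M)%N -> u M <= e) ->
  (forall T : R, exists M0, forall M, (M0 <= M)%N -> T * g M <= M%:R ^+ 2 * u M) ->
  (forall n, (n0 <= n)%N -> a n.+1 - a n <= C * n%:R ^+ d.-1 * g n) ->
  exp_sums_small R n0 a.
Proof.
move=> d0 C0 g u mono u0 g0 comp ulim ug wg e e' e0 e'0.
have [T [del [M0 [T0 del0 H]]]] := kdt_on_sequence R d.+1 n0 a (ltn0Sn d) mono (or_introl u0) comp e e0.
rewrite -/u in H.
have [M1 h1] := ulim (del / 2) ltac:(lra).
have [M2 h2] := ug (T * C / e').
exists (maxn (maxn 1 n0) (maxn M0 (maxn M1 M2))) => M m s phi.
rewrite !geq_max => /andP[/andP[M1' Mn0] /andP[MM0 /andP[MM1 MM2]]] mM /andP[s0 s2] sw.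
have uM0 : 0 <= u M by exact: u0.
apply: (H M) => //; rewrite ger0_norm //.
  have := h1 M MM1 => h3.
  have : s * u M <= 2 * (del / 2) by apply: ler_pM => //; exact: ltW.
  by lra.
have gM0 := g0 M Mn0.
have MR : 0 < M%:R :> R by rewrite ltr0n.
have Md : 0 < M%:R ^+ d.-1 :> R by rewrite exprn_gt0.
have h3 : e' <= s * (C * M%:R ^+ d.-1 * g M).
  by apply: le_trans sw _; rewrite ler_pM2l //; exact: wg.
have h4 := h2 M MM2.
have h5 : T * C / e' * g M * e' <= M%:R ^+ 2 * u M * (s * (C * M%:R ^+ d.-1 * g M)).
  apply: ler_pM => //; last exact: ltW.
  by rewrite !mulr_ge0 ?invr_ge0 // ltW.
have Cg : 0 < C * g M by rewrite mulr_gt0.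
rewrite -(ler_pM2r Cg).
have -> : T * (C * g M) = T * C / e' * g M * e' by field; rewrite gt_eqF.
apply: le_trans h5 _.
rewrite le_eqVlt; apply/orP; left; apply/eqP.
have -> : M%:R ^+ d.+1 = M%:R ^+ 2 * M%:R ^+ d.-1 :> R.
  by rewrite -exprD; congr (_ ^+ _); clear -d0; lia.
by ring.
Qed.

Definition mid_sums_small (n0 : nat) a : Prop :=
  forall e del : R, 0 < e -> 0 < del -> exists M0 : nat, forall M m (s phi : R),
    (M0 <= M)%N -> (m <= M)%N -> del <= s <= 2 ->
    \sum_(n0 <= n < m) cos (2 * pi * s * a n + phi) <= e * M%:R.

Lemma mid_sums_small_large (d n0 : nat) a :
  let u := fdiff _ d.+1 a in
  (forall m, monotone_on _ n0 m u) ->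
  (forall n, (n0 <= n)%N -> 0 <= u n) \/ (forall n, (n0 <= n)%N -> u n <= 0) ->
  comparable_scales R u ->
  (forall e : R, 0 < e -> exists M0, forall M, (M0 <= M)%N -> `|u M| <= e) ->
  (forall T : R, exists M0, forall M, (M0 <= M)%N -> T <= M%:R ^+ d.+1 * `|u M|) ->
  mid_sums_small n0 a.
Proof.
move=> u mono sgn comp ulim ularge e del e0 del0.
have [T [del' [M0 [T0 del'0 H]]]] := kdt_on_sequence R d.+1 n0 a (ltn0Sn d) mono sgn comp e e0.
rewrite -/u in H.
have [M1 h1] := ulim (del' / 2) ltac:(lra).
have [M2 h2] := ularge (T / del).
exists (maxn M0 (maxn M1 M2)) => M m s phi.
rewrite !geq_max => /andP[MM0 /andP[MM1 MM2]] mM /andP[sd s2].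
have s0 : 0 < s by lra.
apply: (H M) => //.
  have := h1 M MM1 => h3.
  have : s * `|u M| <= 2 * (del' / 2) by apply: ler_pM => //; exact: ltW.
  by lra.
have h3 := h2 M MM2.
have h4 : T / del * del <= M%:R ^+ d.+1 * `|u M| * s.
  by apply: ler_pM => //; [rewrite divr_ge0 // ltW|exact: ltW].
have e1 : T / del * del = T by field; rewrite gt_eqF.
by rewrite e1 in h4; lra.
Qed.

(** As [g] has the order of [c], the test of order [d] needs [s] small and [s * M ^ d] large. The
    latter holds because the lower bound on [s] makes [s * M ^ d] at least a multiple of [M]; beyond
    [del1] the hypothesis [mid] takes over. *)
Lemma exp_sums_small_finite (d n0 : nat) a (c C : R) : (0 < d)%N -> 0 < C -> 0 < c ->
  let g := fdiff _ d a in
  (forall m, monotone_on _ n0 m g) ->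
  (forall n, (n0 <= n)%N -> c / 2 <= g n <= 2 * c) ->
  (forall n, (n0 <= n)%N -> a n.+1 - a n <= C * n%:R ^+ d.-1) ->
  mid_sums_small n0 a ->
  exp_sums_small R n0 a.
Proof.
move=> d0 C0 c0 g mono gc wC mid e e' e0 e'0.
have g0 n : (n0 <= n)%N -> 0 <= g n by move=> /gc/andP[h _]; lra.
have gn n : (n0 <= n)%N -> c / 2 <= `|g n| <= 2 * c by move=> nn; rewrite ger0_norm ?g0 // gc.
have comp : comparable_scales R g.
  move=> e1 e10; have [K /andP[_ K1]] := truncn_ex _ (n0%:R / e1) ltac:(by rewrite divr_ge0 // ltW).
  exists 4, (maxn n0 K.+1); split; first by lra.
  move=> M n; rewrite geq_max => /andP[Mn0 MK] en nM.
  have /andP[h1 h2] := gn M Mn0.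
  have n0n : (n0 <= n)%N.
    rewrite -(ler_nat R); apply: le_trans en.
    have : n0%:R / e1 < M%:R by apply: lt_le_trans K1 _; rewrite ler_nat.
    by rewrite ltr_pdivrMr // => h3; rewrite mulrC ltW.
  have /andP[h3 h4] := gn n n0n.
  by split; lra.
have [T [del [M0 [T0 del0 H]]]] := kdt_on_sequence R d n0 a d0 mono (or_introl g0) comp e e0.
rewrite -/g in H.
pose del1 := del / (2 * c).
have del10 : 0 < del1 by rewrite /del1 divr_gt0 // mulr_gt0.
have [M1 h1] := mid e del1 e0 del10.
pose B := 2 * T * C / (e' * c).
have B0 : 0 <= B by rewrite /B divr_ge0 ?mulr_ge0 // ltW.
have [K /andP[_ K1]] := truncn_ex _ B B0.
exists (maxn (maxn 1 n0) (maxn M0 (maxn M1 K.+1))) => M m s phi.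
rewrite !geq_max => /andP[/andP[M1' Mn0] /andP[MM0 /andP[MM1 MK]]] mM /andP[s0 s2] sw.
have [sl|/ltW sl] := leP del1 s; first by apply: h1 => //; rewrite sl.
have /andP[h2 h3] := gn M Mn0.
apply: (H M) => //.
  have : s * `|g M| <= del1 * (2 * c) by apply: ler_pM => //; exact: ltW.
  by have -> : del1 * (2 * c) = del by rewrite /del1; field; rewrite gt_eqF.
have MR : 0 < M%:R :> R by rewrite ltr0n.
have Md : 0 < M%:R ^+ d.-1 :> R by rewrite exprn_gt0.
have MB : B <= M%:R by apply: ltW; apply: lt_le_trans K1 _; rewrite ler_nat.
have h4 : e' <= s * (C * M%:R ^+ d.-1).
  by apply: le_trans sw _; rewrite ler_pM2l //; exact: wC.
have h5 : e' * M%:R <= s * C * M%:R ^+ d.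
  have -> : s * C * M%:R ^+ d = s * (C * M%:R ^+ d.-1) * M%:R.
    by rewrite -(prednK d0) exprS /=; ring.
  by rewrite ler_pM2r.
have h6 : e' * B * (c / 2) <= s * C * M%:R ^+ d * `|g M|.
  apply: ler_pM => //; [exact: mulr_ge0 (ltW e'0) B0|by lra|].
  by apply: le_trans h5; rewrite ler_pM2l.
rewrite -(ler_pM2l C0).
have e1 : e' * B * (c / 2) = C * T by rewrite /B; field; rewrite !gt_eqF.
by rewrite e1 in h6; apply: le_trans h6 _; rewrite le_eqVlt; apply/orP; left; apply/eqP; ring.
Qed.

End small_sums.

(** * Polynomials up to a logarithm *)

Section newton.
Variable R : realType.
Implicit Types (a f h x : nat -> R) (b : nat -> R).

Lemma fdiff_bin (j i n : nat) :
  fdiff R j (fun m => 'C(m, i)%:R) n = if (j <= i)%N then 'C(n, i - j)%:R else 0.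
Proof.
elim: j n => [|j IH] n; first by rewrite subn0.
rewrite fdiffS !IH; have [ji|ij|->] := ltngtP j i.
- by rewrite -(subnSK ji) binS natrD addrC addKr.
- by rewrite subrr.
- by rewrite subnn !bin0 subrr.
Qed.

Lemma fdiff_big (k p q : nat) (F : nat -> nat -> R) (n : nat) :
  fdiff R k (fun m => \sum_(p <= i < q) F i m) n = \sum_(p <= i < q) fdiff R k (F i) n.
Proof. by elim: k n => [//|k IH] n; rewrite fdiffS !IH -sumrB. Qed.

Lemma fdiffB k f h n : fdiff R k (fun m => f m - h m) n = fdiff R k f n - fdiff R k h n.
Proof. by elim: k n => [//|k IH] n; rewrite !fdiffS !IH; ring. Qed.

Definition bin_poly b (p q : nat) (n : nat) : R := \sum_(p <= i < q) b i * 'C(n, i)%:R.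

Lemma fdiff_bin_poly k b p q n : fdiff R k (bin_poly b p q) n =
  \sum_(p <= i < q) b i * (if (k <= i)%N then 'C(n, i - k)%:R else 0).
Proof.
rewrite /bin_poly fdiff_big; apply: eq_bigr => i _.
by rewrite fdiffZ fdiff_bin.
Qed.

Lemma inv_pow_telescope (j : nat) (N : R) : (0 < j)%N -> 1 <= N ->
  (N ^+ j.+1)^-1 <= 2 * ((N ^+ j)^-1 - ((N + 1) ^+ j)^-1).
Proof.
move=> j0 N1.
have N0 : 0 < N by lra.
have Nj : 0 < N ^+ j by rewrite exprn_gt0.
have Nj1 : 0 < N ^+ j.-1 by rewrite exprn_gt0.
have h1 : N ^+ j.-1 * (N + 1) <= (N + 1) ^+ j.
  rewrite -[in leRHS](prednK j0) exprSr ler_pM2r; last by lra.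
  by apply: lerXn2r; rewrite ?nnegrE; lra.
have h2 : ((N + 1) ^+ j)^-1 <= (N ^+ j.-1 * (N + 1))^-1.
  by rewrite lef_pV2 ?posrE ?exprn_gt0 ?mulr_gt0 //; lra.
have h3 : (N ^+ j.+1)^-1 <= 2 * ((N ^+ j)^-1 - (N ^+ j.-1 * (N + 1))^-1).
  have -> : 2 * ((N ^+ j)^-1 - (N ^+ j.-1 * (N + 1))^-1) = (N ^+ j.+1)^-1 * (2 * N / (N + 1)).
    rewrite -(prednK j0) /= !exprS; field.
    by rewrite !gt_eqF //; lra.
  rewrite ler_peMr ?invr_ge0 ?exprn_ge0 ?(ltW N0) //.
  by rewrite ler_pdivlMr; lra.
by lra.
Qed.

(** [c n] dominates the tail of the series of increments, so [x n - c n] increases, [x n + c n]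
    decreases, and the supremum [beta] of the former is within [c n] of [x n]. *)
Lemma newton_step x (j n0 : nat) (K : R) : (0 < n0)%N -> (0 < j)%N ->
  (forall n, (n0 <= n)%N -> `|x n.+1 - x n| * n%:R ^+ j.+1 <= K) ->
  exists beta K' : R, forall n, (n0 <= n)%N -> `|x n - beta| * n%:R ^+ j <= K'.
Proof.
move=> n00 j0 xK.
have nR n : (n0 <= n)%N -> 1 <= n%:R :> R by move=> nn; rewrite ler1n (leq_trans n00).
have K0 : 0 <= K.
  by apply: le_trans (xK n0 (leqnn _)); rewrite mulr_ge0 // exprn_ge0.
pose c n : R := 2 * K * (n%:R ^+ j)^-1.
have c0 n : 0 <= c n by rewrite /c !mulr_ge0 // invr_ge0 exprn_ge0.
have step n : (n0 <= n)%N -> `|x n.+1 - x n| <= c n - c n.+1.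
  move=> nn; have n1 := nR n nn.
  have np : 0 < n%:R ^+ j.+1 :> R by rewrite exprn_gt0 //; lra.
  have h1 : `|x n.+1 - x n| <= K * (n%:R ^+ j.+1)^-1 by rewrite ler_pdivlMr // xK.
  have := inv_pow_telescope j n%:R j0 n1; rewrite natr1 => h2.
  have := ler_wpM2l K0 h2; rewrite /c; lra.
have mono n k : (n0 <= n)%N -> x n - c n <= x (n + k)%N - c (n + k)%N /\
    x (n + k)%N + c (n + k)%N <= x n + c n.
  move=> nn; elim: k => [|k [h1 h2]]; first by rewrite addn0.
  have := step (n + k)%N (leq_trans nn (leq_addr _ _)).
  by rewrite ler_norml addnS => /andP[h3 h4]; split; lra.
pose E := [set y : R | exists2 n, (n0 <= n)%N & y = x n - c n].
have Eub n : (n0 <= n)%N -> ubound E (x n + c n).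
  move=> nn _ [m mn ->].
  have [h1 h2] := mono n (m - n)%N nn; have [h3 h4] := mono m (n - m)%N mn.
  have cn := c0 n; have cm := c0 m.
  have [nm|mn'] := leqP n m.
    by rewrite subnKC // in h1 h2; lra.
  by rewrite subnKC ?(ltnW mn') // in h3 h4; lra.
exists (sup E), (2 * K) => n nn.
have h1 : x n - c n <= sup E.
  by apply: ub_le_sup; [exists (x n0 + c n0); exact: Eub|exists n].
have h2 : sup E <= x n + c n.
  by apply: ge_sup; [exists (x n - c n), n|exact: Eub].
have h3 : `|x n - sup E| <= c n by rewrite ler_norml; lra.
have np : 0 < n%:R ^+ j :> R by rewrite exprn_gt0 // (lt_le_trans ltr01) // nR.
have -> : 2 * K = c n * n%:R ^+ j by rewrite /c; field; rewrite gt_eqF.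
by rewrite ler_pM2r.
Qed.

(** By [newton_step] the [d]-th difference converges at rate [n ^ (- d)]; subtracting its limit
    times ['C(m, d)] lowers [d]. The range of [j] starts at 1: the function itself is left with
    increments [O(1 / n)] and need not be bounded. *)
Lemma newton_expansion (d n0 : nat) f (K : R) : (0 < n0)%N ->
  (forall n, (n0 <= n)%N -> `|fdiff R d.+1 f n| * n%:R ^+ d.+1 <= K) ->
  exists b (K' : R), forall j n, (0 < j <= d.+1)%N -> (n0 <= n)%N ->
    `|fdiff R j (fun m => f m - bin_poly b 1 d.+1 m) n| * n%:R ^+ j <= K'.
Proof.
move=> n00; elim: d f K => [|d IH] f K fK.
  exists (fun=> 0), K => -[|[|j]] n // _ nn.
  by rewrite fdiffB fdiff_bin_poly big_geq // subr0; exact: fK.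
have [beta [K1 h1]] := newton_step (fdiff R d.+1 f) d.+1 n0 K n00 isT fK.
have [|b [K2 h2]] := IH (fun m => f m - beta * 'C(m, d.+1)%:R) K1.
  move=> n nn; rewrite fdiffB fdiffZ fdiff_bin leqnn subnn bin0 mulr1.
  exact: h1.
exists (fun i => if i == d.+1 then beta else b i), (Num.max K2 K) => j n /andP[j0 jd] nn.
have eqf : (fun m => f m - bin_poly (fun i => if i == d.+1 then beta else b i) 1 d.+2 m) =
    (fun m => f m - beta * 'C(m, d.+1)%:R - bin_poly b 1 d.+1 m).
  apply: funext => m; rewrite /bin_poly big_nat_recr //= eqxx.
  rewrite (eq_big_nat _ _ (F2 := fun i => b i * 'C(m, i)%:R)); first by ring.
  by move=> i /andP[_ id]; rewrite ltn_eqF.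
rewrite eqf le_max; move: jd; rewrite leq_eqVlt => /orP[/eqP ->|jd]; apply/orP; last first.
  by left; apply: h2; rewrite ?j0.
right; rewrite !fdiffB fdiffZ fdiff_bin ltnn mulr0 subr0 fdiff_bin_poly.
rewrite big1_seq ?subr0; first exact: fK.
move=> i /=; rewrite mem_index_iota => /andP[_ id].
by rewrite leqNgt ltnS (ltnW id) mulr0.
Qed.

(** Increments [O(1 / n)] are compared with those of [ln]. This is where the [log x] in the
    hypothesis of the theorem originates. *)
Lemma log_growth x (n0 : nat) (K : R) : (0 < n0)%N ->
  (forall n, (n0 <= n)%N -> `|x n.+1 - x n| * n%:R <= K) ->
  exists K' : R, forall n, (n0 <= n)%N -> `|x n| <= K' * (1 + ln n%:R).
Proof.
move=> n00 xK.
have K0 : 0 <= K by apply: le_trans (xK n0 (leqnn _)); rewrite mulr_ge0.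
have lnn n : (n0 <= n)%N -> 0 <= ln n%:R :> R.
  by move=> nn; apply: ln_ge0; rewrite ler1n (leq_trans n00).
have step n : (n0 <= n)%N -> `|x n.+1 - x n| <= 2 * K * (ln n.+1%:R - ln n%:R).
  move=> nn; have n1 : 1 <= n%:R :> R by rewrite ler1n (leq_trans n00).
  have n0' : 0 < n%:R :> R by lra.
  have h1 : `|x n.+1 - x n| <= K * n%:R^-1 by rewrite ler_pdivlMr // xK.
  have := @le_ln1Dx R (- n.+1%:R^-1).
  have -> : 1 + - n.+1%:R^-1 = n%:R / n.+1%:R :> R.
    by rewrite -(natr1 n); field; rewrite gt_eqF //; lra.
  have S0 : 0 < n.+1%:R :> R by rewrite ltr0n.
  rewrite ln_div ?posrE // => h2.
  have h3 : n.+1%:R^-1 <= ln n.+1%:R - ln n%:R :> R.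
    have : -1 < - n.+1%:R^-1 :> R by rewrite ltrN2 invf_lt1 // ltr1n ltnS (leq_trans n00).
    move=> /h2; move: (n.+1%:R^-1) (ln n.+1%:R) (ln n%:R) => u v w; lra.
  have h4 : n%:R^-1 <= 2 * n.+1%:R^-1 :> R.
    rewrite ler_pdivlMr // mulrC ler_pdivrMr // -natr1; lra.
  have h5 : K * n%:R^-1 <= K * (2 * (ln n.+1%:R - ln n%:R)) by apply: ler_wpM2l => //; apply: le_trans h4 _; rewrite ler_pM2l.
  by lra.
exists (`|x n0| + 2 * K) => n nn.
have : `|x n - x n0| <= 2 * K * (ln n%:R - ln n0%:R).
  rewrite -(telescope_sumr x nn) -(telescope_sumr (fun n => ln n%:R) nn) mulr_sumr.
  apply: le_trans (ler_norm_sum _ _ _) _.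
  by rewrite [leLHS]big_nat [leRHS]big_nat; apply: ler_sum => i /andP[n0i _]; exact: step.
have := ler_normD (x n - x n0) (x n0); rewrite subrK.
have h1 := lnn n nn; have h2 := lnn n0 (leqnn _).
have h3 : 0 <= `|x n0| * ln n%:R by rewrite mulr_ge0.
have h4 : 0 <= K * ln n0%:R by rewrite mulr_ge0.
by lra.
Qed.

Lemma bin_rat_poly (i : nat) : exists p : {poly rat}, forall n : nat,
  (map_poly ratr p).[n%:R] = 'C(n, i)%:R :> R.
Proof.
elim: i => [|i [p hp]].
  by exists 1 => n; rewrite rmorph1 hornerC bin0.
exists (p * ('X - i%:R%:P) * (i.+1%:R^-1)%:P) => n.
rewrite !rmorphM rmorphB /= map_polyX !map_polyC.
rewrite !hornerM hp hornerD hornerN hornerX !hornerC.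
rewrite -[X in _ * X = _]/(ratr i.+1%:R^-1) -[X in _ - X]/(ratr i%:R) fmorphV.
rewrite -[X in _ / X]/(ratr i.+1%:R) !ratr_nat.
have i0 : i.+1%:R != 0 :> R by rewrite pnatr_eq0.
apply: (mulIf i0); rewrite mulfVK //.
have [ni|ni] := leqP i n.
  by rewrite -natrB // -!natrM mulnC [in RHS]mulnC mul_bin_left.
by rewrite (bin_small ni) bin_small ?mul0r // ltnW.
Qed.

(** By Pascal's rule the increments of ['C(n, j + 1)] have period [q] modulo [D], so moving by [q]
    adds the constant ['C(q, j + 1)], and [D] such moves add 0. *)
Lemma bin_mod_periodic (D j : nat) : (0 < D)%N ->
  exists2 q, (0 < q)%N & forall n, 'C(n + q, j) = 'C(n, j) %[mod D].
Proof.
move=> D0; elim: j => [|j [q q0 hq]]; first by exists 1; rewrite // => n; rewrite !bin0.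
have step n : 'C(n + q, j.+1) = 'C(n, j.+1) + 'C(q, j.+1) %[mod D].
  elim: n => [|n IH]; first by rewrite add0n bin0n.
  by rewrite addSn !binS -modnDm IH hq modnDm addnAC.
exists (D * q)%N; first by rewrite muln_gt0 D0.
suff H l n : 'C(n + l * q, j.+1) = 'C(n, j.+1) + l * 'C(q, j.+1) %[mod D].
  by move=> n; rewrite H -modnDmr modnMr addn0.
elim: l => [|l IH]; first by rewrite !mul0n !addn0.
by rewrite mulSnr addnA step -modnDml IH modnDml mulSnr addnA.
Qed.

Lemma bin_quasi_periodic (theta : rat) (j : nat) :
  exists2 q, (0 < q)%N & quasi_periodic R q (fun n => 2 * pi * (ratr theta * 'C(n, j)%:R)).
Proof.
have [q q0 hq] := bin_mod_periodic `|denq theta|%N j ltac:(by rewrite absz_gt0 denq_neq0).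
exists q => // n.
have : (`|denq theta|%N%:Z %| 'C(n + q, j)%:Z - 'C(n, j)%:Z)%Z.
  by rewrite -eqz_mod_dvd !modz_nat; apply/eqP; congr Posz; exact: hq.
rewrite absz_denq => /dvdzP[z hz].
exists (numq theta * z).
have eC : 'C(n + q, j)%:R = 'C(n, j)%:R + (denq theta)%:~R * z%:~R :> R.
  by rewrite -intrM mulrC -hz intrB -!pmulrn addrC subrK.
rewrite eC.
have et : ratr theta * (denq theta)%:~R = (numq theta)%:~R :> R.
  rewrite -[in LHS](divq_num_den theta) rmorphM fmorphV /= !ratr_int.
  by rewrite divq_num_den mulfVK // intr_eq0 denq_neq0.
by rewrite intrM -et; ring.
Qed.

Lemma quasi_periodicD q1 q2 (r1 r2 : nat -> R) :
  quasi_periodic R q1 r1 -> quasi_periodic R q2 r2 ->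
  quasi_periodic R (q1 * q2) (fun n => r1 n + r2 n).
Proof.
move=> h1 h2 n.
have [z1 e1] := quasi_periodicM R q1 r1 q2 n h1.
have [z2 e2] := quasi_periodicM R q2 r2 q1 n h2.
by exists (z1 + z2); rewrite e1 (mulnC q1) e2 intrD; ring.
Qed.

Lemma bin_poly_quasi_periodic b (p q : nat) :
  (forall i, (p <= i < q)%N -> exists theta, b i = ratr theta) ->
  exists2 Q, (0 < Q)%N & quasi_periodic R Q (fun n => 2 * pi * bin_poly b p q n).
Proof.
elim: q => [|q IH] br.
  exists 1 => // n; exists 0; rewrite /bin_poly !big_geq //; ring.
have [qp|pq] := ltnP q p.
  by exists 1 => // n; exists 0; rewrite /bin_poly !big_geq //; ring.
have [|Q1 Q10 h1] := IH.
  by move=> i /andP[pi iq]; apply: br; rewrite pi ltnW.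
have [theta et] := br q ltac:(by rewrite pq leqnn).
have [Q2 Q20 h2] := bin_quasi_periodic theta q.
exists (Q1 * Q2)%N; first by rewrite muln_gt0 Q10.
have -> : (fun n => 2 * pi * bin_poly b p q.+1 n) =
    (fun n => 2 * pi * bin_poly b p q n + 2 * pi * (ratr theta * 'C(n, q)%:R)).
  by apply: funext => n; rewrite /bin_poly big_nat_recr //= et mulrDr.
exact: quasi_periodicD.
Qed.

End newton.

Section bounded_case.
Variable R : realType.

Lemma sin_pi_eq0 (y : R) : sin (pi * y) = 0 -> exists z : int, y = z%:~R.
Proof.
move=> sy; exists (Num.floor y).
have /andP[h1 h2] := floor_itv y; rewrite intrD in h2.
apply/eqP; apply: contrapT => /negP ne.
have pi0 := pi_gt0 R.
pose t := y - (Num.floor y)%:~R.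
have t0 : 0 < t by rewrite subr_gt0 lt_neqAle eq_sym ne.
have c2 (x : R) : cos (2 * x) = 1 - 2 * sin x ^+ 2.
  by rewrite mulr_natl cos_mulr2n cos2sin2; ring.
have : cos (2 * (pi * y)) = cos (2 * (pi * t)).
  rewrite -[RHS](cosD2piz _ _ (Num.floor y)); congr cos.
  by rewrite /t; ring.
rewrite !c2 sy expr0n /=.
have : 0 < sin (pi * t) ^+ 2.
  rewrite exprn_gt0 // sin_gt0_pi // mulr_gt0 //=.
  by rewrite gtr_pMr // /t ltrBlDl.
by lra.
Qed.

Lemma quasi_periodicZ_sign (q : nat) (r : nat -> R) (sg : R) : sg = 1 \/ sg = -1 ->
  quasi_periodic R q r -> quasi_periodic R q (fun n => sg * r n).
Proof.
case=> -> h n; have [z e] := h n; first by exists z; rewrite !mul1r.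
by exists (- z); rewrite e mulrNz; ring.
Qed.

Lemma monotone_on_affine (p p' m m' : nat) (c c' : R) v : (p <= p')%N -> (m' <= m)%N ->
  monotone_on _ p m v -> monotone_on _ p' m' (fun n => c * v n + c').
Proof.
move=> pp mm h; have [h1|h1] := monotone_onZ R p p' m m' c v pp mm h; [left|right] => n pn nm.
  by rewrite lerD2r h1.
by rewrite lerD2r h1.
Qed.

Lemma fdiff_bin_poly_skip (b : nat -> R) (k i d n : nat) : (i <= k)%N -> (0 < i <= d)%N ->
  fdiff R k (bin_poly R b 1 d.+1) n =
  (if k == i then b i else 0) + fdiff R k (bin_poly R b i.+1 d.+1) n.
Proof.
move=> ik /andP[i0 id]; rewrite !fdiff_bin_poly.
rewrite (@big_cat_nat _ _ _ i 1 d.+1) //=; last exact: leqW.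
rewrite big1_seq ?add0r; last first.
  move=> j /=; rewrite mem_index_iota => /andP[_ ji].
  by rewrite leqNgt (leq_trans ji ik) mulr0.
rewrite big_ltn //; congr (_ + _).
have [->|ki] := eqVneq k i; first by rewrite leqnn subnn bin0 mulr1.
by rewrite leqNgt ltn_neqAle eq_sym ki ik mulr0.
Qed.

Lemma bin_poly_rat (b : nat -> R) (p q : nat) :
  (forall i, (p <= i < q)%N -> exists theta, b i = ratr theta) ->
  exists P : {poly rat}, forall n : nat, (map_poly ratr P).[n%:R] = bin_poly R b p q n.
Proof.
elim: q => [|q IH] br.
  by exists 0 => n; rewrite rmorph0 horner0 /bin_poly big_geq.
have [qp|pq] := ltnP q p.
  by exists 0 => n; rewrite rmorph0 horner0 /bin_poly big_geq.
have [|P hP] := IH.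
  by move=> i /andP[pi iq]; apply: br; rewrite pi ltnW.
have [theta et] := br q ltac:(by rewrite pq leqnn).
have [B hB] := bin_rat_poly R q.
exists (P + theta%:P * B) => n.
rewrite rmorphD rmorphM /= map_polyC hornerD hornerM hornerC hP hB.
by rewrite /bin_poly big_nat_recr //= et.
Qed.

Lemma le_sum6 (x1 x2 x3 x4 x5 x6 m : R) : 0 <= x1 -> 0 <= x2 -> 0 <= x3 -> 0 <= x4 ->
  0 <= x5 -> 0 <= x6 -> x1 + x2 + x3 + x4 + x5 + x6 <= m ->
  x1 <= m /\ x2 <= m /\ x3 <= m /\ x4 <= m /\ x5 <= m /\ x6 <= m.
Proof. by move=> *; do !split; lra. Qed.

Section local_bound.
Variables (d n0 : nat) (a : nat -> R) (c K : R) (b : nat -> R).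
Let g := fdiff R d a.
Let h m := a m - bin_poly R b 1 d.+1 m.
Hypothesis n0_gt0 : (0 < n0)%N.
Hypothesis d_gt0 : (0 < d)%N.
Hypothesis c_gt0 : 0 < c.
Hypothesis g_bound : forall n, (n0 <= n)%N -> c / 2 <= g n <= 2 * c.
Hypothesis g_mono : forall m, monotone_on _ n0 m g.
Hypothesis h_bound : forall j n, (0 < j <= d.+1)%N -> (n0 <= n)%N ->
  `|fdiff R j h n| * n%:R ^+ j <= K.
Hypothesis a_far : forall (p : {poly rat}) (x y : R), exists2 n, (n0 <= n)%N &
  y * (1 + ln n%:R) < `|a n - x * (map_poly ratr p).[n%:R]|.

(* Otherwise [a] is a real multiple of a rational polynomial up to a
   logarithm. *)
Let exists_irrational (s0 : R) : s0 != 0 -> exists i, [/\ (0 < i <= d)%N,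
   forall theta : rat, s0 * b i <> ratr theta &
   forall j, (i.+1 <= j < d.+1)%N -> exists theta : rat, s0 * b j = ratr theta].
Proof.
move=> s00.
have not_all : ~ forall j, (0 < j < d.+1)%N -> exists theta : rat, s0 * b j = ratr theta.
  move=> all; have [P hP] := bin_poly_rat (fun j => s0 * b j) 1 d.+1 all.
  have [K' hK'] : exists K' : R, forall n, (n0 <= n)%N -> `|h n| <= K' * (1 + ln n%:R).
    apply: (log_growth R h n0 K n0_gt0) => n nn.
    by have := h_bound 1 n isT nn; rewrite expr1.
  have [n nn] := a_far P s0^-1 K'.
  suff -> : a n - s0^-1 * (map_poly ratr P).[n%:R] = h n by rewrite ltNge hK'.
  rewrite hP /h /bin_poly mulr_sumr; congr (_ - _); apply: eq_bigr => j _.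
  by rewrite mulrA mulKf.
suff H k : (k <= d)%N -> (forall j, (k < j < d.+1)%N -> exists theta : rat, s0 * b j = ratr theta) ->
   exists i, [/\ (0 < i <= d)%N, forall theta : rat, s0 * b i <> ratr theta &
   forall j, (i.+1 <= j < d.+1)%N -> exists theta : rat, s0 * b j = ratr theta].
  by apply: (H d) => // j; clear; lia.
elim: k => [|k IH] kd kr; first by case: not_all.
have [[theta et]|none] := pselect (exists theta : rat, s0 * b k.+1 = ratr theta).
  apply: IH (ltnW kd) _ => j /andP[kj jd].
  move: kj; rewrite leq_eqVlt => /orP[/eqP <-|kj]; first by exists theta.
  by apply: kr; rewrite kj.
by exists k.+1; split => // theta et; apply: none; exists theta.
Qed.

Let K_ge0 : 0 <= K.
Proof. by apply: le_trans (h_bound 1 n0 isT (leqnn _)); rewrite mulr_ge0 // exprn_ge0. Qed.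

Let fdiff_a k n : fdiff R k a n = fdiff R k h n + fdiff R k (bin_poly R b 1 d.+1) n.
Proof. by rewrite /h fdiffB subrK. Qed.

(** With [i] from [exists_irrational], the subtracted part has rational coefficients and is
    quasi-periodic. What remains is led, at [s = s0], by the irrational coefficient [s0 * b i]. *)
Let phase (s0 s : R) (i : nat) (n : nat) : R :=
  2 * pi * s * a n - 2 * pi * bin_poly R (fun j => s0 * b j) i.+1 d.+1 n.

Let fdiff_phase s0 s i k n : (0 < i <= d)%N -> (i <= k)%N ->
  fdiff R k (phase s0 s i) n =
  2 * pi * ((s - s0) * fdiff R k a n + s0 * fdiff R k h n) +
  (if k == i then 2 * pi * (s0 * b i) else 0).
Proof.
move=> id ik; rewrite /phase fdiffB fdiffZ fdiffZ.
have -> : fdiff R k (bin_poly R (fun j => s0 * b j) i.+1 d.+1) n =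
    s0 * fdiff R k (bin_poly R b i.+1 d.+1) n.
  by rewrite !fdiff_bin_poly mulr_sumr; apply: eq_bigr => j _; rewrite mulrA.
have := fdiff_a k n; rewrite (fdiff_bin_poly_skip b k i d n ik id).
by case: ifP => _ ->; ring.
Qed.

Let fdiff_phase_top s0 s i n : (0 < i < d)%N ->
  fdiff R d (phase s0 s i) n = 2 * pi * s * g n + - (2 * pi * (s0 * b d)).
Proof.
move=> /andP[i0 id]; rewrite /phase fdiffB fdiffZ fdiffZ fdiff_bin_poly -/g; congr (_ - _ * _).
rewrite big_nat_recr //= leqnn subnn bin0 mulr1 big1_seq ?add0r // => j /=.
by rewrite mem_index_iota => /andP[_ jd]; rewrite leqNgt jd mulr0.
Qed.

(** The main term is [|s - s0| * g], and the last hypothesis keeps the contribution of [h] below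
    [|s - s0| * c / 4]. As [c / 2 <= g <= 2 * c], the result lies between [1/4] and [9/4] of
    [|s - s0| * c], up to [2 * pi]; hence the ratio 9. *)
Let fdiff_phase_large s0 s sg i n : 0 < s0 -> (0 < i < d)%N -> (n0 <= n)%N ->
  sg = 1 \/ sg = -1 -> sg * (s - s0) = `|s - s0| ->
  4 * s0 * K <= `|s - s0| * n%:R ^+ d * c ->
  2 * pi * `|s - s0| * c / 4 <= fdiff R d (fun n => sg * phase s0 s i n) n <=
    9 * (2 * pi * `|s - s0| * c / 4).
Proof.
move=> s00 /andP[i0 id] nn sgE sgt sK.
have pi0 := pi_gt0 R.
have /andP[g1 g2] := g_bound n nn.
have -> : fdiff R d (fun n => sg * phase s0 s i n) n =
    2 * pi * (`|s - s0| * g n + sg * (s0 * fdiff R d h n)).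
  by rewrite fdiffZ fdiff_phase ?i0 ?(ltnW id) // gtn_eqF // addr0 -/g -sgt; ring.
have nd : 0 < n%:R ^+ d :> R by rewrite exprn_gt0 // ltr0n (leq_trans n0_gt0).
have h1 : `|sg * (s0 * fdiff R d h n)| <= `|s - s0| * c / 4.
  have -> : `|sg * (s0 * fdiff R d h n)| = s0 * `|fdiff R d h n|.
    by rewrite !normrM (gtr0_norm s00); case: sgE => ->; rewrite ?normrN normr1 mul1r.
  have h2 := h_bound d n ltac:(by rewrite d_gt0 leqnSn) nn.
  rewrite -(ler_pM2r nd) -mulrA.
  have : s0 * (`|fdiff R d h n| * n%:R ^+ d) <= s0 * K by rewrite ler_pM2l.
  by lra.
move: (`|s - s0|) (normr_ge0 (s - s0)) h1 {sK sgt} => t t0.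
rewrite ler_norml => /andP[h1 h1'].
have h2 : t * (c / 2) <= t * g n <= t * (2 * c) by rewrite !ler_wpM2l.
case/andP: h2 => h2 h3.
have -> : 2 * pi * t * c / 4 = 2 * pi * (t * c / 4) by ring.
have -> : 9 * (2 * pi * (t * c / 4)) = 2 * pi * (9 * (t * c / 4)) by ring.
by apply/andP; split; rewrite ler_pM2l ?mulr_gt0 //; lra.
Qed.

(** Let [tau = s - s0]. If [|tau| * m ^ (d - i)] is small, the [i]-th difference of [phase] stays
    near the irrational [omega] and [weyl_irr] applies. Otherwise [i < d], and [|tau| * m ^ d] is at
    least a multiple of [m]; then [kdt_step], which tolerates the quasi-periodic part, applies at
    order [d] with [lambda] proportional to [|tau|]. *)
Lemma local_exp_sums (s0 e : R) : 0 < s0 -> 0 < e -> exists (rho : R) (m0 : nat), 0 < rho /\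
  forall (s phi : R) (m : nat), `|s - s0| < rho -> (m0 <= m)%N ->
    \sum_(n0 <= n < m) cos (2 * pi * s * a n + phi) <= e * m%:R.
Proof.
move=> s00 e0.
have [i [iD irr rat]] := exists_irrational s0 (lt0r_neq0 s00).
have /andP[i0 id] := iD.
have [q q0 per] := bin_poly_quasi_periodic R (fun j => s0 * b j) i.+1 d.+1 rat.
pose omega := 2 * pi * (s0 * b i).
have pi0 := pi_gt0 R; have pi2 := pi_ge2 R; have pi4 : pi <= 4 :> R by have := pihalf_lt2 R; lra.
have omega_irr (k : nat) : (0 < k)%N -> sin (k%:R * omega / 2) != 0.
  move=> k0; apply/eqP.
  have -> : k%:R * omega / 2 = pi * (k%:R * (s0 * b i)) by rewrite /omega; field.
  move=> /sin_pi_eq0[z ez]; apply: (irr (z%:~R / k%:R)).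
  have k0' : k%:R != 0 :> R by rewrite pnatr_eq0 -lt0n.
  rewrite rmorphM fmorphV /= ratr_int ratr_nat -ez.
  by rewrite [RHS]mulrC mulKf.
have e20 : 0 < e / 2 by lra.
have [eta [MW [eta0 W]]] := weyl_irrP R i i0 q omega (e / 2) q0 e20 omega_irr.
have [K1 K10 hK1] : exists2 K1 : R, 0 < K1 & forall n, (n0 <= n)%N ->
    `|fdiff R i a n| <= K1 * n%:R ^+ (d - i).
  apply: (fdiff_growth R (d - i) n0 (fdiff R i a) (2 * c) n0_gt0) => n nn.
  have -> : fdiff R (d - i) (fdiff R i a) n = g n.
    by rewrite /g /fdiff -iterD subnK.
  by have /andP[g1 g2] := g_bound n nn; rewrite ger0_norm //; lra.
(* With 8 as a bound for [2 * pi], the term in [tau] uses up half of [eta] and the term in [h] the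
   other half. *)
pose k1 := eta / (16 * K1).
have k10 : 0 < k1 by rewrite /k1 divr_gt0 // mulr_gt0.
have k1E : eta / 16 = k1 * K1 by rewrite /k1; field; rewrite gt_eqF.
clearbody k1.
(* The guard [i < d], with [0 < i], makes the order [d - 1] passed to [kdt_step] positive. *)
have [T [del [T0 del0 KD]]] : exists T del : R, [/\ 0 < T, 0 < del &
    (i < d)%N -> forall (M lambda : R) f rho (p m : nat), quasi_periodic R q rho ->
      (p <= m)%N -> (m - p)%:R <= M ->
      0 < lambda <= del -> T <= M -> T <= lambda * M ^+ d ->
      (forall n, (p <= n < m - d)%N ->
         lambda <= fdiff R d f n <= 9 * lambda) ->
      monotone_on R p (m - d) (fdiff R d f) ->
      forall phi, \sum_(p <= n < m) cos (f n + rho n + phi) <= e / 2 * M].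
  have [id'|di] := ltnP i d; last by exists 1, 1; split.
  have d1 : (0 < d.-1)%N by clear -id' i0; lia.
  have [T [del [T0 del0 KD]]] := kdt_step R d.-1 q (e / 2) 9 d1 q0 e20 ltac:(lra) (kdtP R d.-1 d1).
  exists T, del; split => // _.
  by rewrite prednK // in KD.
pose T1 := 4 * s0 * K * (4 / e) ^+ d / c.
pose rho := Num.min k1 (del / (2 * 4 * c)).
have e40 : 0 < e / 4 by rewrite divr_gt0.
have pi8 : 2 * pi <= 8 :> R by have := pihalf_lt2 R; lra.
have rho0 : 0 < rho by rewrite lt_min k10 /= divr_gt0 // !mulr_gt0.
(* Each summand is a lower bound that [m] must satisfy below; [le_sum6] separates them again. *)
pose big := `|MW| + T + T1 / k1 + T / (c * k1) + 64 * s0 * K / (e * eta) + 4 / e * (n0%:R + 1).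
have [m0 /andP[_ m0b]] := truncn_ex R `|big| (normr_ge0 _).
exists rho, m0.+1; split=> // s phi m.
rewrite lt_min => /andP[tau1 tau2] mm0.
set tau := s - s0 in tau1 tau2.
have mbig : big <= m%:R.
  by apply: le_trans (ler_norm _) _; apply: ltW; apply: lt_le_trans m0b _; rewrite ler_nat.
have T10 : 0 <= T1 by rewrite /T1 !mulr_ge0 ?invr_ge0 ?exprn_ge0 ?mulr_ge0 ?invr_ge0 // ltW.
have b1 : 0 <= T1 / k1 by rewrite divr_ge0 // ltW.
have b2 : 0 <= T / (c * k1) by exact: ltW (divr_gt0 T0 (mulr_gt0 c_gt0 k10)).
have b3 : 0 <= 64 * s0 * K / (e * eta).
  apply: divr_ge0; last exact: ltW (mulr_gt0 e0 eta0).
  by apply: mulr_ge0 => //; apply: mulr_ge0 => //; exact: ltW.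
have b4 : 0 <= 4 / e * (n0%:R + 1).
  by apply: mulr_ge0; [apply: divr_ge0 => //; exact: ltW|rewrite addr_ge0].
have [mMW' [mT [mT1 [mTc [meta m1]]]]] := le_sum6 _ _ _ _ _ _ _ (normr_ge0 MW) (ltW T0) b1 b2 b3 b4 mbig.
have mMW : MW <= m%:R by apply: le_trans mMW'; exact: ler_norm.
clear mMW' mbig b1 b2 b3 b4 m0b mm0 big T10 rho rho0.
have m40 : n0%:R + 1 <= e / 4 * m%:R.
  have : e / 4 * (4 / e * (n0%:R + 1)) <= e / 4 * m%:R by apply: ler_wpM2l => //; exact: ltW.
  by have -> : e / 4 * (4 / e * (n0%:R + 1)) = n0%:R + 1 by field; rewrite gt_eqF.
clear m1.
have mR0 : 0 < m%:R :> R.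
  rewrite -(pmulr_rgt0 _ e40); apply: lt_le_trans m40.
  by rewrite ltr_wpDl.
have mR1 : 1 <= m%:R :> R by rewrite ler1n -(ltr0n R).
have [k /andP[hk1 hk2]] := truncn_ex R (e / 4 * m%:R) (ltW (mulr_gt0 e40 mR0)).
rewrite -(natr1 k) in hk2.
have n0k : (n0 <= k.+1)%N by rewrite -(ler_nat R) -(natr1 k); apply: ltW; apply: le_lt_trans hk2; apply: le_trans m40; rewrite lerDl.
have -> : e * m%:R = 2 * (e / 2 * m%:R) by field.
have n01 := ler0n R n0.
apply: (sum_cos_split R (fun n => 2 * pi * s * a n) phi _ n0 k.+1 m);
  [by rewrite -(natr1 k); lra|by rewrite mulr_ge0 //; lra| |
   by rewrite -(ler_nat R) -(natr1 k) => ?; lra].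
move=> km _.
pose r n := 2 * pi * bin_poly R (fun j => s0 * b j) i.+1 d.+1 n.
pose F := phase s0 s i.
have FE : \sum_(k.+1 <= n < m) cos (2 * pi * s * a n + phi) =
    \sum_(k.+1 <= n < m) cos (F n + r n + phi).
  by apply: eq_bigr => n _; congr cos; rewrite /F /phase /r; ring.
rewrite {}FE.
have mpm : (m - k.+1)%:R <= m%:R :> R by rewrite ler_nat leq_subr.
have nbig n : (k.+1 <= n)%N -> e / 4 * m%:R <= n%:R.
  move=> kn; have : k.+1%:R <= n%:R :> R by rewrite ler_nat.
  by apply: le_trans; rewrite -(natr1 k); exact: ltW.
have n0n n : (k.+1 <= n)%N -> (n0 <= n)%N by exact: leq_trans n0k.
have [C1|C2] := leP (`|tau| * m%:R ^+ (d - i)) k1.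
  apply: (W m%:R F r k.+1 m per km mpm mMW) => n /andP[kn nm].
  rewrite fdiff_phase // eqxx addrK normrM (ger0_norm (x := 2 * pi)); last by rewrite mulr_ge0 // pi_ge0.
  have h1 : `|tau * fdiff R i a n| <= eta / 16.
    rewrite k1E normrM; apply: le_trans (_ : `|tau| * (K1 * m%:R ^+ (d - i)) <= _).
      apply: ler_wpM2l => //; apply: le_trans (hK1 n (n0n n kn)) _.
      rewrite ler_pM2l //; apply: lerXn2r; rewrite ?nnegrE // ler_nat.
      by clear -nm; lia.
    by rewrite mulrCA mulrC ler_pM2r.
  have h2 : `|s0 * fdiff R i h n| <= eta / 16.
    have nn := nbig n kn.
    have np : 0 < n%:R :> R by exact: lt_le_trans (mulr_gt0 e40 mR0) nn.
    have h3 : `|fdiff R i h n| * n%:R <= K.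
      apply: le_trans (h_bound i n _ (n0n n kn)); last by rewrite i0 leqW.
      by apply: ler_wpM2l => //; rewrite -[leLHS]expr1; apply: ler_weXn2l => //; rewrite ler1n -(ltr0n R).
    rewrite normrM gtr0_norm // -(ler_pM2r np) -mulrA.
    apply: (@le_trans _ _ (s0 * K)); first by rewrite ler_pM2l.
    have h4 : eta * (e / 4 * m%:R) <= eta * n%:R by rewrite ler_pM2l.
    move: meta; rewrite ler_pdivrMr ?mulr_gt0 //; lra.
  have := ler_normD (tau * fdiff R i a n) (s0 * fdiff R i h n).
  set u := `|_ + _| => h3.
  have h4 : 2 * pi * u <= 8 * u by apply: ler_wpM2r => //; rewrite /u.
  by lra.
have id' : (i < d)%N.
  rewrite ltn_neqAle id andbT; apply/eqP => iE.
  by move: C2; rewrite iE subnn expr0 mulr1 => /lt_trans/(_ tau1); rewrite ltxx.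
have tau0 : 0 < `|tau|.
  rewrite normr_gt0; apply/eqP => t0; move: C2.
  by rewrite t0 normr0 mul0r => /lt_trans/(_ k10); rewrite ltxx.
have [sg sgE sgt] : exists2 sg : R, sg = 1 \/ sg = -1 & sg * tau = `|tau|.
  have [t0|t0] := leP 0 tau; first by exists 1; [left|rewrite mul1r ger0_norm].
  by exists (-1); [right|rewrite mulN1r ltr0_norm].
have taum : k1 * m%:R <= `|tau| * m%:R ^+ d.
  rewrite -(subnK id) exprD mulrA; apply: ler_pM; [exact: ltW|exact: ltW|exact: ltW C2|].
  by rewrite -[leLHS]expr1; apply: ler_weXn2l.
pose lambda := 2 * pi * `|tau| * c / 4.
pose f n := sg * F n.
have -> : \sum_(k.+1 <= n < m) cos (F n + r n + phi) =
    \sum_(k.+1 <= n < m) cos (f n + sg * r n + sg * phi).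
  apply: eq_bigr => n _; rewrite /f; case: sgE => ->; first by rewrite !mul1r.
  by rewrite -cosN; congr cos; ring.
apply: (KD id' m%:R lambda f (fun n => sg * r n) k.+1 m) => //.
- exact: quasi_periodicZ_sign.
- apply/andP; split; first by rewrite /lambda divr_gt0 // !mulr_gt0.
  move: tau2; rewrite ltr_pdivlMr ?mulr_gt0 // => tau2.
  have : pi * (`|tau| * c) <= 4 * (`|tau| * c) by apply: ler_wpM2r => //; rewrite mulr_ge0 // ltW.
  have : 0 <= `|tau| * c by rewrite mulr_ge0 // ltW.
  by rewrite /lambda; lra.
- have h1 : T <= c * (k1 * m%:R).
    by move: mTc; rewrite ler_pdivrMr ?mulr_gt0 // => mTc; rewrite mulrA mulrC.
  have h2 : c * (k1 * m%:R) <= c * (`|tau| * m%:R ^+ d) by rewrite ler_pM2l.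
  have h3 : 2 * (c * (`|tau| * m%:R ^+ d)) <= pi * (c * (`|tau| * m%:R ^+ d)).
    by apply: ler_wpM2r => //; rewrite !mulr_ge0 ?exprn_ge0 // ltW.
  by rewrite /lambda; lra.
- move=> n /andP[kn nm].
  have nn := nbig n kn.
  have := fdiff_phase_large s0 s sg i n s00 ltac:(by rewrite i0) (n0n n kn) sgE sgt.
  rewrite -/tau -/lambda -/F; apply.
  have h3 : (e / 4 * m%:R) ^+ d <= n%:R ^+ d by apply: lerXn2r; rewrite ?nnegrE // mulr_ge0 // ltW.
  have h4 : T1 <= `|tau| * m%:R ^+ d.
    by apply: le_trans taum; move: mT1; rewrite ler_pdivrMr // mulrC.
  have ed : 0 < (e / 4) ^+ d by exact: exprn_gt0.
  have h5 : T1 * (e / 4) ^+ d <= `|tau| * n%:R ^+ d.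
    apply: (@le_trans _ _ (`|tau| * m%:R ^+ d * (e / 4) ^+ d)); first by rewrite ler_pM2r.
    by rewrite -mulrA -exprMn [m%:R * _]mulrC ler_pM2l.
  have h6 : T1 * (e / 4) ^+ d = 4 * s0 * K / c.
    have e1 : (4 / e) ^+ d * (e / 4) ^+ d = 1.
      by rewrite -exprMn (_ : 4 / e * (e / 4) = 1) ?expr1n //; field; rewrite gt_eqF.
    by rewrite /T1 mulrAC -[_ * _ * (e / 4) ^+ d]mulrA e1 mulr1.
  by rewrite h6 ler_pdivrMr // in h5.
- have -> : fdiff R d f = (fun n => sg * (2 * pi * s) * g n + sg * (- (2 * pi * (s0 * b d)))).
    by apply: funext => n; rewrite /f fdiffZ fdiff_phase_top ?i0 // mulrDr !mulrA.
  by apply: (@monotone_on_affine n0 k.+1 m (m - d)) => //; exact: leq_subr.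
Qed.

(** The neighbourhoods from [local_exp_sums] cover the compact [[del, 2]], which gives one threshold
    [M1] for all [s]. For [m] below [M1] there are at most [M1 <= e * M] terms. *)
Lemma mid_sums_small_bounded : mid_sums_small R n0 a.
Proof.
move=> e del e0 del0.
have cpt := @segment_compact R del 2.
have := (compact_near_coveringP _).1 cpt nat \oo
  (fun m s => forall phi, \sum_(n0 <= n < m) cos (2 * pi * s * a n + phi) <= e * m%:R) _.
case.
  move=> s0 /=; rewrite in_itv /= => /andP[s01 s02].
  have [|rho [m0 [rho0 loc]]] := local_exp_sums s0 e _ e0; first by lra.
  exists ([set s | `|s - s0| < rho], [set m | (m0 <= m)%N]) => /=.
    split; last by exists m0.
    by apply/nbhs_ballP; exists rho => // s /=; rewrite /ball /= distrC.
  by move=> [s m] /= [h1 h2] phi; apply: loc.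
move=> M1 _ hM1.
have [k /andP[_ hk]] := truncn_ex R (M1%:R / e) ltac:(by rewrite divr_ge0 // ltW).
exists k.+1 => M m s phi kM mM sd.
have [M1m|mM1] := leqP M1 m.
  apply: le_trans (hM1 m M1m s _ phi) _; first by rewrite /= in_itv.
  by rewrite ler_pM2l // ler_nat.
apply: (@le_trans _ _ (m - n0)%:R); first by apply: sum_nat_le1 => n; exact: cos_le1.
apply: (@le_trans _ _ M1%:R); first by rewrite ler_nat; clear -mM1; lia.
have : M1%:R / e < M%:R by apply: lt_le_trans hk _; rewrite ler_nat.
by rewrite ltr_pdivrMr // mulrC => /ltW.
Qed.

End local_bound.
End bounded_case.

(** * Functions of a Hardy field *)

Section eventually.
Variable R : realType.
Implicit Types (f g u : R -> R) (P : R -> Prop).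

Definition ev P : Prop := exists X : R, forall x, X < x -> P x.

Lemma near_ev P : (\forall x \near +oo, P x) -> ev P.
Proof. by move=> [X [_ h]]; exists X. Qed.

Lemma ev_and P1 P2 : ev P1 -> ev P2 -> ev (fun x => P1 x /\ P2 x).
Proof.
move=> [X1 h1] [X2 h2]; exists (Num.max X1 X2) => x; rewrite gt_max => /andP[x1 x2].
by split; [exact: h1|exact: h2].
Qed.

Lemma ev_mono P1 P2 : (forall x, P1 x -> P2 x) -> ev P1 -> ev P2.
Proof. by move=> h [X hX]; exists X => x /hX/h. Qed.

Lemma ev_gt (X : R) : ev (fun x => X < x).
Proof. by exists X. Qed.

Definition signed f : Prop :=
  [\/ ev (fun x => f x = 0), ev (fun x => 0 < f x) | ev (fun x => f x < 0)].

Lemma MVT_ray (X : R) f f' (x y : R) : (forall z, X < z -> is_derive z 1 f (f' z)) ->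
  X < x -> x <= y -> exists2 z, x <= z <= y & f y - f x = f' z * (y - x).
Proof.
move=> df Xx xy.
have [z zxy e] : exists2 z, z \in `[x, y] & f y - f x = f' z * (y - x).
  apply: MVT_segment => //.
    by move=> z; rewrite in_itv /= => /andP[xz _]; apply: df; exact: lt_trans xz.
  apply: derivable_within_continuous => z; rewrite in_itv /= => /andP[xz _].
  by have := df z (lt_le_trans Xx xz) => h; exact: ex_derive.
by exists z => //; move: zxy; rewrite in_itv.
Qed.

Lemma nondecreasing_ray (X : R) f f' : (forall z, X < z -> is_derive z 1 f (f' z)) ->
  (forall z, X < z -> 0 <= f' z) -> forall x y, X < x -> x <= y -> f x <= f y.
Proof.
move=> df f'0 x y Xx xy; rewrite -subr_ge0.
have [z /andP[xz _] ->] := MVT_ray X f f' x y df Xx xy.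
by rewrite mulr_ge0 ?subr_ge0 // f'0 // (lt_le_trans Xx).
Qed.

Lemma signed_of_nonvanishing f : ev (fun x => f x != 0) ->
  ev (fun x => {for x, continuous f}) -> signed f.
Proof.
move=> f0 cf; have [X hX] := ev_and _ _ f0 cf.
have noroot x y : X < x -> x <= y -> Num.min (f x) (f y) <= 0 <= Num.max (f x) (f y) -> False.
  move=> Xx xy h.
  have cxy : {within `[x, y], continuous f}.
    apply: continuous_in_subspaceT => z; rewrite inE /= in_itv /= => /andP[xz _].
    by have [] := hX z (lt_le_trans Xx xz).
  have [z] := IVT xy cxy h; rewrite in_itv /= => /andP[xz _] fz.
  by have [] := hX z (lt_le_trans Xx xz); rewrite fz eqxx.
have X1 : X < X + 1 by lra.
have [n0 _] := hX _ X1.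
have [p|n|z] := ltgtP 0 (f (X + 1)); last by rewrite -z eqxx in n0.
  apply: Or32; exists (X + 1) => y Xy; rewrite ltNge; apply/negP => fy.
  apply: (noroot (X + 1) y) => //; first exact: ltW.
  by rewrite ge_min le_max fy (ltW p) orbT.
apply: Or33; exists (X + 1) => y Xy; rewrite ltNge; apply/negP => fy.
apply: (noroot (X + 1) y) => //; first exact: ltW.
by rewrite ge_min le_max fy (ltW n) orbT.
Qed.

Lemma signed_of_monotone f : (exists X, forall x y, X < x -> x < y -> f x < f y) \/
   (exists X, forall x y, X < x -> x < y -> f y < f x) \/
   (exists X, forall x y, X < x -> x < y -> f y = f x) -> signed f.
Proof.
case=> [[X h]|[[X h]|[X h]]].
- have [[x Xx fx]|no] := pselect (exists2 x, X < x & 0 <= f x).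
    by apply: Or32; exists x => y xy; apply: le_lt_trans fx (h _ _ _ xy).
  apply: Or33; exists X => x Xx; rewrite ltNge; apply/negP => fx.
  by apply: no; exists x.
- have [[x Xx fx]|no] := pselect (exists2 x, X < x & f x <= 0).
    by apply: Or33; exists x => y xy; apply: lt_le_trans (h _ _ _ xy) fx.
  apply: Or32; exists X => x Xx; rewrite ltNge; apply/negP => fx.
  by apply: no; exists x.
- have X1 : X < X + 1 by lra.
  have [p|n|z] := ltgtP 0 (f (X + 1)); [apply: Or32|apply: Or33|apply: Or31];
    exists (X + 1) => y Xy; rewrite (h _ _ X1 Xy) //.
Qed.

Lemma signed_of_derive f f' : ev (fun x => is_derive x 1 f (f' x)) -> signed f' -> signed f.
Proof.
move=> df sf'; apply: signed_of_monotone.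
case: sf' => s; have [X hX] := ev_and _ _ df s.
- right; right; exists X => x y Xx xy.
  have [z /andP[xz _] e] := MVT_ray X f f' x y (fun z h => (hX z h).1) Xx (ltW xy).
  by move: e; rewrite (hX z (lt_le_trans Xx xz)).2 mul0r => /eqP; rewrite subr_eq0 => /eqP.
- left; exists X => x y Xx xy; rewrite -subr_gt0.
  have [z /andP[xz _] ->] := MVT_ray X f f' x y (fun z h => (hX z h).1) Xx (ltW xy).
  by rewrite mulr_gt0 ?subr_gt0 // (hX z (lt_le_trans Xx xz)).2.
- right; left; exists X => x y Xx xy; rewrite -subr_lt0.
  have [z /andP[xz _] ->] := MVT_ray X f f' x y (fun z h => (hX z h).1) Xx (ltW xy).
  by rewrite pmulr_llt0 ?subr_gt0 // (hX z (lt_le_trans Xx xz)).2.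
Qed.

Lemma signed_mul f g : signed f -> signed g -> signed (fun x => f x * g x).
Proof.
case=> hf; case=> hg; have h := ev_and _ _ hf hg.
- by apply: Or31; apply: ev_mono h => x [-> _]; rewrite mul0r.
- by apply: Or31; apply: ev_mono h => x [-> _]; rewrite mul0r.
- by apply: Or31; apply: ev_mono h => x [-> _]; rewrite mul0r.
- by apply: Or31; apply: ev_mono h => x [_ ->]; rewrite mulr0.
- by apply: Or32; apply: ev_mono h => x [? ?]; rewrite mulr_gt0.
- by apply: Or33; apply: ev_mono h => x [? ?]; rewrite pmulr_rlt0.
- by apply: Or31; apply: ev_mono h => x [_ ->]; rewrite mulr0.
- by apply: Or33; apply: ev_mono h => x [? ?]; rewrite nmulr_rlt0.
- by apply: Or32; apply: ev_mono h => x [? ?]; rewrite nmulr_rgt0.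
Qed.

Lemma signed_ext f g : ev (fun x => f x = g x) -> signed f -> signed g.
Proof.
move=> e; case=> s; have h := ev_and _ _ e s; [apply: Or31|apply: Or32|apply: Or33];
  by apply: ev_mono h => x [<-].
Qed.

Section hardy.
Variable H : set (R -> R).
Hypothesis HH : is_hardy_field H.

(** A nonzero germ is invertible, hence eventually without zeros, and continuity then fixes its
    sign. *)
Lemma hardy_signed f : H f -> signed f.
Proof.
move=> Hf; have [z|nz] := pselect (germ_eq f (fun=> 0)).
  by apply: Or31; exact: near_ev.
have [g Hg fg] := hardy_inv HH Hf nz.
apply: signed_of_nonvanishing; last exact: near_ev (hardy_continuous HH Hf).
apply: ev_mono (near_ev _ fg) => x fgx; apply/eqP => fx.
by move: fgx; rewrite fx mul0r => /esym/eqP; rewrite oner_eq0.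
Qed.

Lemma hardy_is_derive f : H f -> ev (fun x => is_derive x 1 f (derive1 f x)).
Proof.
move=> Hf; apply: ev_mono (near_ev _ (hardy_derivable HH Hf)) => x /derivableP.
by rewrite derive1E.
Qed.

(* [fun x => x] need not be in [H]: divide by [g] and differentiate. *)
Lemma hardy_signed_affine f g : H f -> H g -> signed (fun x => f x + g x * x).
Proof.
move=> Hf Hg; have [z|nz] := pselect (germ_eq g (fun=> 0)).
  apply: signed_ext (hardy_signed f Hf).
  by apply: ev_mono (near_ev _ z) => x ->; rewrite mul0r addr0.
have [k Hk gk] := hardy_inv HH Hg nz.
have Hu := hardy_mul HH Hf Hk.
have s1 : signed (fun x => f x * k x + x).
  apply: (signed_of_derive _ (fun x => derive1 (fun x => f x * k x) x + 1)).
    apply: ev_mono (hardy_is_derive _ Hu) => x d.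
    exact: is_deriveD.
  exact: hardy_signed (hardy_add HH (hardy_derive HH Hu) (hardy_1 HH)).
apply: signed_ext (signed_mul _ _ s1 (hardy_signed _ Hg)).
apply: ev_mono (near_ev _ gk) => x e; rewrite mulrDl -mulrA (mulrC (k x)) e mulr1.
by rewrite (mulrC x).
Qed.

Lemma hardy_derive1n f (i : nat) : H f -> H (derive1n i f).
Proof.
by move=> Hf; elim: i => [|i IH]; [rewrite derive1n0|rewrite derive1nS; exact: hardy_derive].
Qed.

End hardy.
End eventually.

(** * From derivatives to finite differences *)

Section transfer.
Variable R : realType.
Implicit Types (f g : R -> R).

Lemma nonincreasing_ray (X : R) f f' : (forall z, X < z -> is_derive z 1 f (f' z)) ->
  (forall z, X < z -> f' z <= 0) -> forall x y, X < x -> x <= y -> f y <= f x.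
Proof.
move=> df f'0 x y Xx xy; rewrite -subr_le0.
have [z /andP[xz _] ->] := MVT_ray R X f f' x y df Xx xy.
by rewrite mulr_le0_ge0 ?subr_ge0 // f'0 // (lt_le_trans Xx).
Qed.

Lemma signed_trichotomy f f' : ev R (fun x => is_derive x 1 f (f' x)) ->
  signed R f' -> signed R f ->
  [\/ forall e : R, 0 < e -> ev R (fun x => `|f x| <= e),
      exists2 c : R, 0 < c & ev R (fun x => c <= f x) |
      exists2 c : R, 0 < c & ev R (fun x => f x <= - c)].
Proof.
have main g g' : ev R (fun x => is_derive x 1 g (g' x)) -> signed R g' ->
    ev R (fun x => 0 < g x) -> (forall e : R, 0 < e -> ev R (fun x => `|g x| <= e)) \/
      exists2 c : R, 0 < c & ev R (fun x => c <= g x).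
  move=> dg sg' gp.
  have [low|no] := pselect (exists2 c : R, 0 < c & ev R (fun x => c <= g x)); [by right|left].
  have [g'p|g'n] : ev R (fun x => 0 <= g' x) \/ ev R (fun x => g' x <= 0).
    case: sg' => h; [left|left|right]; apply: ev_mono h => x; [by move=> ->|exact: ltW|exact: ltW].
    have [X hX] := ev_and R _ _ dg (ev_and R _ _ gp g'p).
    exfalso; apply: no; have X1 : X < X + 1 by lra.
    exists (g (X + 1)); first by have [_ []] := hX _ X1.
    exists (X + 1) => x Xx.
    by apply: (nondecreasing_ray R X g g') => //; [move=> z /hX[]|move=> z /hX[_ []]|exact: ltW].
  have [X hX] := ev_and R _ _ dg (ev_and R _ _ gp g'n).
  move=> e e0; have [[x Xx gx]|all] := pselect (exists2 x, X < x & g x <= e).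
    exists x => y xy; have [_ [gy _]] := hX y (lt_trans Xx xy).
    rewrite gtr0_norm //; apply: le_trans gx.
    by apply: (nonincreasing_ray X g g') => //; [move=> z /hX[]|move=> z /hX[_ []]|exact: ltW].
  exfalso; apply: no; exists e => //; exists X => x Xx.
  by rewrite leNgt; apply/negP => gx; apply: all; exists x => //; exact: ltW.
move=> df sf'; case=> sf.
- by apply: Or31 => e e0; apply: ev_mono sf => x ->; rewrite normr0 ltW.
- by have [h|h] := main f f' df sf' sf; [apply: Or31|apply: Or32].
- have [| | |h|[c c0 h]] := main (fun x => - f x) (fun x => - f' x).
  + by apply: ev_mono df => x h; apply: is_deriveN.
  + case: sf' => h; [apply: Or31|apply: Or33|apply: Or32]; apply: ev_mono h => x.
    * by move=> ->; rewrite oppr0.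
    * by rewrite oppr_lt0.
    * by rewrite oppr_gt0.
  + by apply: ev_mono sf => x; rewrite oppr_gt0.
  + by apply: Or31 => e e0; apply: ev_mono (h e e0) => x; rewrite normrN.
  + by apply: Or33; exists c => //; apply: ev_mono h => x; rewrite lerNr.
Qed.

Lemma bounded_or_infinite f f' : ev R (fun x => is_derive x 1 f (f' x)) -> signed R f' ->
  (exists B : R, ev R (fun x => f x <= B)) \/
  (ev R (fun x => 0 <= f' x) /\ forall T : R, ev R (fun x => T <= f x)).
Proof.
move=> df sf'.
have [g'p|g'n] : ev R (fun x => 0 <= f' x) \/ ev R (fun x => f' x <= 0).
  case: sf' => h; [left|left|right]; apply: ev_mono h => x; [by move=> ->|exact: ltW|exact: ltW].
- have [bd|unb] := pselect (exists B : R, ev R (fun x => f x <= B)); [by left|right].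
  split=> // T; have [X hX] := ev_and R _ _ df g'p.
  have [[x Xx fx]|all] := pselect (exists2 x, X < x & T <= f x).
    exists x => y xy; apply: le_trans fx _.
    by apply: (nondecreasing_ray R X f f') => //; [move=> z /hX[]|move=> z /hX[]|exact: ltW].
  exfalso; apply: unb; exists T, X => x Xx.
  by rewrite leNgt; apply/negP => fx; apply: all; exists x => //; exact: ltW.
- have [X hX] := ev_and R _ _ df g'n; left; have X1 : X < X + 1 by lra.
  exists (f (X + 1)), (X + 1) => x Xx.
  by apply: (nonincreasing_ray X f f') => //; [move=> z /hX[]|move=> z /hX[]|exact: ltW].
Qed.

Definition derive_chain (X : R) (k : nat) (F : nat -> R -> R) : Prop :=
  forall i x, (i < k)%N -> X < x -> is_derive x 1 (F i) (F i.+1 x).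

(** Taking differences preserves chains: [G i x = F i (x + 1) - F i x] is a chain shorter by one,
    and by the mean value theorem [G k x] is a value of [F k.+1] on [[x, x + 1]]. *)
Lemma fdiff_ge (X lo : R) (k n : nat) (F : nat -> R -> R) : derive_chain X k F -> X < n%:R ->
  (forall x, n%:R <= x <= n%:R + k%:R -> lo <= F k x) ->
  lo <= fdiff R k (fun m => F 0 m%:R) n.
Proof.
elim: k F => [|k IH] F ch Xn hlo.
  by apply: hlo; rewrite lexx lerDl ler0n.
pose G i x := F i (x + 1) - F i x.
have chG : derive_chain X k G.
  move=> i x ik Xx; apply: is_deriveB; last exact: ch (ltnW ik) Xx.
  have Xx1 : X < x + 1 by lra.
  have d1 := ch i (x + 1) (ltnW ik) Xx1.
  have d2 : is_derive x 1 (fun y : R => y + 1) 1 by exact: is_derive_shift.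
  by have := @is_derive1_comp R (F i) (fun y => y + 1) x _ _ d1 d2; rewrite mulr1.
rewrite fdiffSr.
have -> : (fun m => F 0 m.+1%:R - F 0 m%:R) = (fun m => G 0 m%:R).
  by apply: funext => m; rewrite /G natr1.
apply: IH => // x /andP[nx xn].
have Xx : X < x by exact: lt_le_trans Xn nx.
have [|z /andP[xz zx] e] := MVT_ray R X (F k) (F k.+1) x (x + 1) (fun z Xz => ch k z (ltnSn k) Xz) Xx.
  by rewrite lerDl.
rewrite /G e addrAC subrr add0r mulr1; apply: hlo.
by rewrite (le_trans nx xz) /= -(natr1 k); apply: le_trans zx _; rewrite addrA lerD2r.
Qed.

Lemma fdiff_le (X hi : R) (k n : nat) (F : nat -> R -> R) : derive_chain X k F -> X < n%:R ->
  (forall x, n%:R <= x <= n%:R + k%:R -> F k x <= hi) ->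
  fdiff R k (fun m => F 0 m%:R) n <= hi.
Proof.
move=> ch Xn hhi.
have := fdiff_ge X (- hi) k n (fun i x => - F i x) _ Xn.
have -> : (fun m => - F 0 m%:R) = (fun m => -1 * F 0 m%:R) by apply: funext => m; rewrite mulN1r.
rewrite fdiffZ mulN1r lerN2; apply.
  by move=> i x ik Xx; apply: is_deriveN; exact: ch.
by move=> x /hhi; rewrite lerN2.
Qed.

(** Only the upper half of the sum of increments is kept: there they are at least
    [c1 * (n / 4) ^ k], so no power sum is computed. Half of the resulting constant [C1] is spent on
    the initial value. *)
Lemma fdiff_lower_growth (k n0 : nat) (f : nat -> R) (c : R) : 0 < c ->
  (forall n, (n0 <= n)%N -> c <= fdiff R k f n) ->
  exists (c' : R) (n1 : nat), 0 < c' /\ forall n, (n1 <= n)%N -> c' * n%:R ^+ k <= f n.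
Proof.
move=> c0; elim: k f => [|k IH] f fc.
  by exists c, n0; split => // n nn; rewrite expr0 mulr1; exact: fc.
have [|c1 [n1 [c10 h1]]] := IH (fun n => f n.+1 - f n).
  by move=> n nn; rewrite -fdiffSr; exact: fc.
pose C1 := c1 / (2 * 4 ^+ k).
have C10 : 0 < C1 by rewrite /C1 divr_gt0 // mulr_gt0 // exprn_gt0.
have [K /andP[_ hK]] := truncn_ex R (`|f n1| / (C1 / 2)) ltac:(by rewrite divr_ge0 // divr_ge0 // ltW).
exists (C1 / 2), (maxn (n1.*2 + 2) K.+1); split; first by rewrite divr_gt0.
move=> n; rewrite geq_max => /andP[nn1 nK].
pose p := n./2.
have pn : (n1 <= p)%N by rewrite /p; clear -nn1; lia.
have pn' : (p <= n)%N by rewrite /p; clear; lia.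
have df i : (n1 <= i)%N -> 0 <= f i.+1 - f i.
  by move=> ni; apply: le_trans (h1 i ni); rewrite mulr_ge0 ?exprn_ge0 // ltW.
have e1 : f n = f n1 + \sum_(n1 <= i < p) (f i.+1 - f i) + \sum_(p <= i < n) (f i.+1 - f i).
  by rewrite !telescope_sumr //; ring.
have s1 : 0 <= \sum_(n1 <= i < p) (f i.+1 - f i).
  by rewrite big_nat; apply: sumr_ge0 => i /andP[ni _]; exact: df.
have nR : 0 < n%:R :> R by rewrite ltr0n; clear -nn1; lia.
have p4 : n%:R / 4 <= p%:R :> R.
  by rewrite ler_pdivrMr // -natrM ler_nat /p; clear -nn1; lia.
have np2 : n%:R / 2 <= (n - p)%:R :> R.
  by rewrite ler_pdivrMr // -natrM ler_nat /p; clear; lia.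
have s2 : C1 * n%:R ^+ k.+1 <= \sum_(p <= i < n) (f i.+1 - f i).
  apply: (@le_trans _ _ (\sum_(p <= i < n) (c1 * (n%:R / 4) ^+ k))).
    rewrite big_const_nat iter_addr addr0 -[leRHS]mulr_natr.
    apply: (@le_trans _ _ (c1 * (n%:R / 4) ^+ k * (n%:R / 2))).
      rewrite le_eqVlt; apply/orP; left; apply/eqP.
      by rewrite /C1 expr_div_n exprSr; field; rewrite expf_neq0.
    by apply: ler_wpM2l => //; rewrite mulr_ge0 ?exprn_ge0 ?divr_ge0 // ltW.
  rewrite [leLHS]big_nat [leRHS]big_nat; apply: ler_sum => i /andP[pi _].
  apply: le_trans (h1 i (leq_trans pn pi)); rewrite ler_pM2l //.
  by apply: lerXn2r; rewrite ?nnegrE ?divr_ge0 //; apply: le_trans p4 _; rewrite ler_nat.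
have s3 : `|f n1| <= C1 / 2 * n%:R ^+ k.+1.
  have h : `|f n1| / (C1 / 2) < n%:R by apply: lt_le_trans hK _; rewrite ler_nat.
  have C12 : 0 < C1 / 2 by rewrite divr_gt0.
  apply: (@le_trans _ _ (C1 / 2 * n%:R)).
    by move: h; rewrite ltr_pdivrMr // mulrC => /ltW.
  rewrite ler_pM2l // -[leLHS]expr1; apply: ler_weXn2l => //.
  by rewrite ler1n -(ltr0n R).
have := ler_norm (- f n1); rewrite normrN e1.
by lra.
Qed.

(** [V] decreases, but not faster than [x ^ (- p)], so its values at [n], [n + k] and [M + k] agree
    up to constants when [e * M <= n <= M]. The shift [k] is the spread of the points that a [k]-th
    difference sees. *)
Lemma comparable_of_real (X : R) (V : R -> R) (u : nat -> R) (k p n0 : nat) :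
  0 <= X -> X < n0%:R ->
  (forall n, (n0 <= n)%N -> V (n%:R + k%:R) <= `|u n| <= V n%:R) ->
  (forall x y, X < x -> x <= y -> 0 <= V y <= V x /\ V x * x ^+ p <= V y * y ^+ p) ->
  comparable_scales R u.
Proof.
move=> X0 Xn0 uV VV e e0.
have [K /andP[_ hK]] := truncn_ex R (n0%:R / e) ltac:(by rewrite divr_ge0 // ltW).
pose C1 : R := (1 + k%:R) ^+ p; pose C2 : R := ((1 + k%:R) / e) ^+ p.
have k1 : 1 <= 1 + k%:R :> R by rewrite lerDl.
have C11 : 1 <= C1 by rewrite /C1 exprn_ege1.
have C20 : 0 <= C2 by rewrite /C2 exprn_ge0 // divr_ge0 ?ltW //; lra.
exists (C1 + C2), K.+1; split; first by lra.
move=> M n MK en nM.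
have n0n : (n0 <= n)%N.
  rewrite -(ler_nat R); apply: le_trans en.
  have : n0%:R / e < M%:R by apply: lt_le_trans hK _; rewrite ler_nat.
  by rewrite ltr_pdivrMr // => h3; rewrite mulrC ltW.
have Xn : X < n%:R by apply: lt_le_trans Xn0 _; rewrite ler_nat.
have nR : 0 < n%:R :> R by lra.
have n1 : 1 <= n%:R :> R by rewrite ler1n -(ltr0n R).
have nMR : n%:R <= M%:R :> R by rewrite ler_nat.
have k0 := ler0n R k.
have /andP[u1 u2] := uV n n0n; have /andP[u3 u4] := uV M (leq_trans n0n nM).
have ratio (y D : R) : n%:R <= y -> y <= D * n%:R -> V n%:R <= D ^+ p * V y.
  move=> ny yD; have [/andP[Vy _] h] := VV n%:R y Xn ny.
  rewrite -(ler_pM2r (exprn_gt0 p nR)); apply: le_trans h _.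
  rewrite mulrAC -exprMn mulrC; apply: ler_wpM2r => //.
  by apply: lerXn2r => //; rewrite nnegrE; lra.
split.
  have h1 : V n%:R <= C1 * V (n%:R + k%:R).
    apply: ratio; first by lra.
    by have : k%:R * 1 <= k%:R * n%:R :> R by [apply: ler_wpM2l]; lra.
  have [/andP[_ h2] _] := VV n%:R M%:R Xn nMR.
  have h3 : C1 * V (n%:R + k%:R) <= C1 * `|u n| by apply: ler_wpM2l => //; lra.
  have h4 : 0 <= C2 * `|u n| by rewrite mulr_ge0.
  by lra.
have h1 : V n%:R <= C2 * V (M%:R + k%:R).
  apply: ratio; first by lra.
  rewrite mulrAC ler_pdivlMr //.
  have h1 : (M%:R + k%:R) * e <= (1 + k%:R) * M%:R * e.
    apply: ler_wpM2r; first exact: ltW.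
    by have : k%:R * 1 <= k%:R * M%:R :> R by [apply: ler_wpM2l; lra]; lra.
  have h2 : (1 + k%:R) * (e * M%:R) <= (1 + k%:R) * n%:R by apply: ler_wpM2l => //; lra.
  by lra.
have h3 : C2 * V (M%:R + k%:R) <= C2 * `|u M| by apply: ler_wpM2l.
have h4 : 0 <= C1 * `|u M| by rewrite mulr_ge0 //; lra.
by lra.
Qed.

End transfer.

(** * Growth of a sequence from the size of its differences *)

Section discrete_growth.
Variable R : realType.
Implicit Types a f u y : nat -> R.

Lemma monotone_on_fdiff (k n0 : nat) a :
  (forall n, (n0 <= n)%N -> 0 <= fdiff R k.+1 a n) \/
  (forall n, (n0 <= n)%N -> fdiff R k.+1 a n <= 0) ->
  forall m, monotone_on R n0 m (fdiff R k a).
Proof.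
case=> h m; [left|right] => n nn _.
  by rewrite -subr_ge0 -fdiffS; exact: h.
by rewrite -subr_le0 -fdiffS; exact: h.
Qed.

Lemma monotone_seq (n0 : nat) f : (forall n, (n0 <= n)%N -> f n <= f n.+1) ->
  forall n m, (n0 <= n)%N -> (n <= m)%N -> f n <= f m.
Proof.
move=> h n m nn; elim: m => [|m IH]; first by rewrite leqn0 => /eqP ->.
rewrite leq_eqVlt => /orP[/eqP -> //|nm]; apply: le_trans (IH nm) (h _ _).
exact: leq_trans nn nm.
Qed.

(** The continuous model is that [x * y'' <= C * y'] integrates to [x * y' <= (C + 1) * y] plus a
    constant. Here one step adds at most [2 * C + 1] times the increment of [y]; the second [C] is
    due to [n + 1] in place of [n]. *)
Lemma ratio_step (n0 : nat) y (C : R) : (0 < n0)%N -> 1 <= C ->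
  (forall n, (n0 <= n)%N -> 0 < y n) ->
  (forall n, (n0 <= n)%N -> 0 < y n.+1 - y n) ->
  (forall n, (n0 <= n)%N ->
    n%:R * ((y n.+2 - y n.+1) - (y n.+1 - y n)) <= C * (y n.+1 - y n)) ->
  (exists2 c : R, 0 < c & forall n, (n0 <= n)%N -> c <= y n) ->
  exists2 C' : R, 1 <= C' & forall n, (n0 <= n)%N -> n%:R * (y n.+1 - y n) <= C' * y n.
Proof.
move=> n00 C1 y0 w0 H [c c0 yc].
pose K := n0%:R * (y n0.+1 - y n0).
have K0 : 0 <= K by rewrite mulr_ge0 // ltW // w0.
have main k : (n0 + k)%:R * (y (n0 + k).+1 - y (n0 + k)%N) <= (2 * C + 1) * y (n0 + k)%N + K.
  elim: k => [|k IH].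
    rewrite addn0 -/K lerDr mulr_ge0 //; last by rewrite ltW // y0.
    by lra.
  rewrite addnS; set n := (n0 + k)%N in IH *.
  have nn : (n0 <= n)%N by exact: leq_addr.
  have h := H n nn; have w := w0 n nn.
  have n1 : 1 <= n%:R :> R by rewrite ler1n (leq_trans n00).
  set w1 := y n.+1 - y n in h w IH *; set w2 := y n.+2 - y n.+1 in h *.
  have h2 : w2 - w1 <= C * w1.
    have [d0|d0] := leP (w2 - w1) 0.
      by apply: le_trans d0 _; rewrite mulr_ge0 ?ltW //; lra.
    by apply: le_trans h; rewrite ler_peMl // ltW.
  have e1 : y n.+1 = y n + w1 by rewrite /w1; ring.
  rewrite e1 -(natr1 n).
  have e2 : n%:R * w2 = n%:R * w1 + n%:R * (w2 - w1) by ring.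
  by lra.
exists (2 * C + 1 + K / c).
  by have : 0 <= K / c by [rewrite divr_ge0 // ltW]; lra.
move=> n nn; have := main (n - n0)%N; rewrite subnKC // => h.
have : K <= K / c * y n.
  by rewrite mulrAC ler_pdivlMr //; apply: ler_wpM2l => //; exact: yc.
by lra.
Qed.

Lemma fdiff_ratio (d n0 : nat) a (c : R) : (0 < n0)%N -> 0 < c ->
  (forall j n, (j <= d)%N -> (n0 <= n)%N -> c <= fdiff R j a n) ->
  (exists2 C : R, 1 <= C & forall n, (n0 <= n)%N -> n%:R * fdiff R d.+1 a n <= C * fdiff R d a n) ->
  exists2 C : R, 1 <= C & forall n, (n0 <= n)%N -> n%:R * (a n.+1 - a n) <= C * a n.
Proof.
move=> n00 c0 ac base.
suff H k : (k <= d)%N -> exists2 C : R, 1 <= C & forall n, (n0 <= n)%N ->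
    n%:R * fdiff R (d - k).+1 a n <= C * fdiff R (d - k) a n.
  by have := H d (leqnn _); rewrite subnn.
elim: k => [|k IH] kd; first by rewrite subn0.
have [C C1 hC] := IH (ltnW kd).
have e1 : (d - k = (d - k.+1).+1)%N by rewrite subnSK.
rewrite e1 in hC.
have jd : (d - k.+1 <= d)%N by exact: leq_subr.
have jd1 : ((d - k.+1).+1 <= d)%N by rewrite -e1 leq_subr.
apply: (ratio_step n0 (fdiff R (d - k.+1) a) C n00 C1).
- by move=> n nn; apply: lt_le_trans c0 (ac _ n jd nn).
- by move=> n nn; apply: lt_le_trans c0 (ac _ n jd1 nn).
- by move=> n nn; have := hC n nn; rewrite !fdiffS.
- by exists c => // n nn; exact: ac.
Qed.

(** If the increments of [g] decrease, each is at most every earlier one, so [n * w] is bounded by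
    the sum of the increments from [n0] on, plus a constant [K] for the first [n0] indices; the
    lower bound [c] absorbs [K]. *)
Lemma fdiff_base_ratio (n0 : nat) g (c : R) : 0 < c ->
  (forall n, (n0 <= n)%N -> c <= g n) ->
  (forall n, (n0 <= n)%N -> (g n.+2 - g n.+1) <= (g n.+1 - g n)) \/
  (forall n, (n0 <= n)%N -> (g n.+1 - g n) <= 0) ->
  exists2 C : R, 1 <= C & forall n, (n0 <= n)%N -> n%:R * (g n.+1 - g n) <= C * g n.
Proof.
move=> c0 gc; case=> h; last first.
  exists 1 => // n nn; rewrite mul1r; apply: (@le_trans _ _ 0).
    by rewrite mulr_ge0_le0 // h.
  by apply: le_trans (ltW c0) (gc n nn).
pose K := n0%:R * `|g n0.+1 - g n0|.
have K0 : 0 <= K by rewrite mulr_ge0.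
exists (1 + K / c); first by rewrite lerDl divr_ge0 // ltW.
move=> n nn.
have mono i j : (n0 <= i)%N -> (i <= j)%N -> g j.+1 - g j <= g i.+1 - g i.
  move=> ni ij.
  have := monotone_seq n0 (fun n => - (g n.+1 - g n)) _ i j ni ij; rewrite lerN2; apply.
  by move=> m mn; rewrite lerN2; exact: h.
set w := g n.+1 - g n.
have h1 : (n - n0)%:R * w <= g n - g n0.
  rewrite -(telescope_sumr g nn).
  have -> : (n - n0)%:R * w = \sum_(n0 <= i < n) w.
    by rewrite big_const_nat iter_addr addr0 mulr_natl.
  rewrite [leLHS]big_nat [leRHS]big_nat; apply: ler_sum => i /andP[ni ni'].
  by apply: mono => //; exact: ltnW.
have h2 : n0%:R * w <= K.
  by apply: ler_wpM2l => //; apply: le_trans (mono n0 n (leqnn _) nn) (ler_norm _).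
have h3 : K <= K / c * g n.
  rewrite mulrAC ler_pdivlMr //; apply: ler_wpM2l => //; exact: gc.
have h4 := gc n0 (leqnn _).
have e1 : n%:R * w = (n - n0)%:R * w + n0%:R * w by rewrite -mulrDl -natrD subnK.
by lra.
Qed.

(** The [d]-th difference is nondecreasing, so summing from one order to the next lower one costs
    just a factor [n]; the initial values are absorbed by its lower bound [c]. *)
Lemma fdiff_upper_by_top (d n0 : nat) a (c : R) : (0 < n0)%N -> 0 < c -> (0 < d)%N ->
  (forall j n, (j <= d)%N -> (n0 <= n)%N -> c <= fdiff R j a n) ->
  (forall n, (n0 <= n)%N -> 0 <= fdiff R d.+1 a n) ->
  exists2 C : R, 0 < C & forall n, (n0 <= n)%N ->
    a n.+1 - a n <= C * n%:R ^+ d.-1 * fdiff R d a n.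
Proof.
move=> n00 c0 d0 ac u0.
have gmono n m : (n0 <= n)%N -> (n <= m)%N -> fdiff R d a n <= fdiff R d a m.
  by apply: monotone_seq => k nk; rewrite -subr_ge0 -fdiffS; exact: u0.
suff H j : (j < d)%N -> exists2 C : R, 0 < C & forall n, (n0 <= n)%N ->
    fdiff R (d - j) a n <= C * n%:R ^+ j * fdiff R d a n.
  have [|C C0 hC] := H d.-1; first by rewrite prednK.
  exists C => // n nn; have := hC n nn.
  by have -> : (d - d.-1 = 1)%N by clear -d0; lia.
elim: j => [|j IH] jd; first by exists 1 => // n nn; rewrite subn0 expr0 !mul1r.
have [C C0 hC] := IH (ltnW jd).
have e1 : (d - j = (d - j.+1).+1)%N by rewrite subnSK // ltnW.
rewrite {}e1 in hC; set y := fdiff R (d - j.+1) a.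
have y0 : 0 < y n0 by apply: lt_le_trans c0 (ac _ n0 (leq_subr _ _) (leqnn _)).
exists (y n0 / c + C); first by rewrite addr_gt0 // divr_gt0.
move=> n nn.
have n1 : 1 <= n%:R :> R by rewrite ler1n (leq_trans n00).
have gn : c <= fdiff R d a n by exact: ac.
have -> : y n = y n0 + \sum_(n0 <= i < n) (y i.+1 - y i) by rewrite telescope_sumr // addrC subrK.
rewrite !mulrDl; apply: lerD.
  rewrite -mulrA mulrAC ler_pdivlMr // ler_pM2l //; apply: le_trans gn _.
  by rewrite ler_peMl ?exprn_ege1 // (le_trans _ (ac d n (leqnn _) nn)) // ltW.
apply: (@le_trans _ _ (\sum_(n0 <= i < n) (C * n%:R ^+ j * fdiff R d a n))).
  rewrite [leLHS]big_nat [leRHS]big_nat; apply: ler_sum => i /andP[ni ni'].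
  have -> : y i.+1 - y i = fdiff R (d - j.+1).+1 a i by [].
  apply: le_trans (hC i ni) _.
  apply: ler_pM; first by rewrite mulr_ge0 ?exprn_ge0 // ltW.
  - exact: le_trans (ltW c0) (ac d i (leqnn _) ni).
  - by rewrite ler_pM2l //; apply: lerXn2r; rewrite ?nnegrE // ler_nat ltnW.
  - by apply: gmono => //; exact: ltnW.
rewrite big_const_nat iter_addr addr0 -[leLHS]mulr_natr exprSr.
have h : (n - n0)%:R <= n%:R :> R by rewrite ler_nat leq_subr.
have h2 : 0 <= C * n%:R ^+ j * fdiff R d a n.
  by rewrite mulr_ge0 ?mulr_ge0 ?exprn_ge0 ?(ltW C0) //; lra.
have := ler_wpM2l h2 h; lra.
Qed.

End discrete_growth.

(** * Growth of functions whose derivatives have a sign *)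

Section real_limits.
Variable R : realType.
Implicit Types f g : R -> R.

Lemma decreasing_of_tends0 f f' : ev R (fun x => is_derive x 1 f (f' x)) -> signed R f' ->
  (forall e : R, 0 < e -> ev R (fun x => `|f x| <= e)) ->
  (ev R (fun x => 0 <= f x) -> ev R (fun x => f' x <= 0)) /\
  (ev R (fun x => f x <= 0) -> ev R (fun x => 0 <= f' x)).
Proof.
have main g g' : ev R (fun x => is_derive x 1 g (g' x)) ->
    (forall e : R, 0 < e -> ev R (fun x => `|g x| <= e)) ->
    ev R (fun x => 0 <= g x) -> ev R (fun x => 0 < g' x) -> False.
  move=> dg g0 gp g'p.
  have [X hX] := ev_and R _ _ dg (ev_and R _ _ gp g'p).
  have X1 : X < X + 1 by lra. have X2 : X + 1 <= X + 2 by lra.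
  have [z /andP[z1 z2] e1] := MVT_ray R X g g' (X + 1) (X + 2) (fun z h => (hX z h).1) X1 X2.
  have [_ [_ g'z]] := hX z (lt_le_trans X1 z1).
  have [_ [gX _]] := hX _ X1.
  have gX2 : 0 < g (X + 2).
    have : 0 < g' z * (X + 2 - (X + 1)) by rewrite mulr_gt0 //; lra.
    by rewrite -e1; lra.
  have [Y hY] := g0 (g (X + 2) / 2) ltac:(lra).
  pose x := Num.max (X + 2) (Y + 1).
  have x1 : X + 2 <= x by rewrite le_max lexx.
  have x2 : Y < x by rewrite lt_max; apply/orP; right; lra.
  have X3 : X < X + 2 by lra.
  have := nondecreasing_ray R X g g' (fun z h => (hX z h).1) (fun z h => ltW (hX z h).2.2) _ _ X3 x1.
  have := hY x x2; have := ler_norm (g x); lra.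
move=> df sf' f0; split=> hf.
  case: sf' => h; [apply: ev_mono h => x -> //|by case: (main f f')|by apply: ev_mono h => x /ltW].
case: sf' => h; [apply: ev_mono h => x -> //|by apply: ev_mono h => x /ltW|].
case: (main (fun x => - f x) (fun x => - f' x)).
- by apply: ev_mono df => x h1; apply: is_deriveN.
- by move=> e e0; apply: ev_mono (f0 e e0) => x; rewrite normrN.
- by apply: ev_mono hf => x; rewrite oppr_ge0.
- by apply: ev_mono h => x; rewrite oppr_gt0.
Qed.

(** The witness is the limit of [f], taken as a supremum or an infimum according to the direction in
    which [f] is monotone. *)
Lemma nearly_constant f f' (c0 B : R) : ev R (fun x => is_derive x 1 f (f' x)) -> signed R f' ->
  0 < c0 -> ev R (fun x => c0 <= f x) -> ev R (fun x => f x <= B) ->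
  exists2 c : R, 0 < c & ev R (fun x => c / 2 <= f x <= 2 * c).
Proof.
move=> df sf' c00 fc fB.
have [fp|fn] : ev R (fun x => 0 <= f' x) \/ ev R (fun x => f' x <= 0).
  case: sf' => h; [left|left|right]; apply: ev_mono h => x; [by move=> ->|exact: ltW|exact: ltW].
- have [X hX] := ev_and R _ _ (ev_and R _ _ df fp) (ev_and R _ _ fc fB).
  pose E := [set y : R | exists2 x, X < x & y = f x].
  have E0 : E !=set0 by exists (f (X + 1)), (X + 1) => //; lra.
  have Eb : has_ubound E by exists B => _ [x /hX[_ [_ xB]] ->].
  have fE x : X < x -> f x <= sup E by move=> Xx; apply: ub_le_sup => //; exists x.
  have s0 : 0 < sup E.
    have X1 : X < X + 1 by lra.
    by apply: lt_le_trans (fE _ X1); have [_ [h _]] := hX _ X1; lra.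
  have [y [x Xx ->] yx] := @sup_adherent R E (sup E / 2) ltac:(lra) (conj E0 Eb).
  exists (sup E) => //; exists x => z xz.
  have Xz := lt_trans Xx xz.
  have h1 := nondecreasing_ray R X f f' (fun z h => (hX z h).1.1) (fun z h => (hX z h).1.2) x z Xx (ltW xz).
  have h2 := fE z Xz; apply/andP; split; lra.
- have [X hX] := ev_and R _ _ (ev_and R _ _ df fn) (ev_and R _ _ fc fB).
  pose E := [set y : R | exists2 x, X < x & y = f x].
  have E0 : E !=set0 by exists (f (X + 1)), (X + 1) => //; lra.
  have Eb : has_lbound E by exists c0 => _ [x /hX[_ [xB _]] ->].
  have fE x : X < x -> inf E <= f x by move=> Xx; apply: ge_inf => //; exists x.
  have s0 : 0 < inf E.
    by apply: lt_le_trans c00 _; apply: lb_le_inf => // _ [x /hX[_ [xB _]] ->].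
  have [y [x Xx ->] yx] := @inf_adherent R E (inf E) s0 (conj E0 Eb).
  exists (inf E) => //; exists x => z xz.
  have Xz := lt_trans Xx xz.
  have h1 := nonincreasing_ray R X f f' (fun z h => (hX z h).1.1) (fun z h => (hX z h).1.2) x z Xx (ltW xz).
  have h2 := fE z Xz; apply/andP; split; lra.
Qed.

End real_limits.

(** A bound [V / G <= b / x ^ 2] makes the derivative of [ln G] integrable, so [G] would be bounded.
    To avoid logarithms and integrals, [G * (1 + 2 * b / x)] is shown to be nonincreasing beyond
    [2 * b]. *)
Lemma not_bounded_log_derivative (R : realType) (G V : R -> R) (B : R) :
  ev R (fun x => is_derive x 1 G (V x)) -> ev R (fun x => 0 < G x) ->
  ev R (fun x => x ^+ 2 * V x / G x <= B) -> (forall T : R, ev R (fun x => T <= G x)) -> False.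
Proof.
move=> dG G0 GB Ginf.
pose b := Num.max B 1.
have b0 : 0 < b by rewrite lt_max ltr01 orbT.
have [X hX] := ev_and R _ _ (ev_and R _ _ dG G0) (ev_and R _ _ GB (ev_gt R (2 * b))).
pose phi x := G x * (1 + 2 * b * x^-1).
have dphi x : X < x -> is_derive x 1 phi (V x * (1 + 2 * b * x^-1) + G x * (2 * b * (- x ^- 2))).
  move=> Xx; have [[dGx Gx] [GBx bx]] := hX x Xx.
  have x0 : x != 0 by rewrite gt_eqF //; lra.
  have dinv := is_deriveV x0 (is_derive_id x (1 : R)).
  have d2 : is_derive x 1 (fun y : R => 1 + 2 * b * y^-1) (2 * b * (- x ^- 2)).
    have := is_deriveD (is_derive_cst (1 : R) x (1 : R)) (is_deriveZ (2 * b) dinv).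
    by rewrite add0r /GRing.scale /= mulr1.
  have := is_deriveM dGx d2.
  by rewrite /GRing.scale /= addrC [in X in _ -> is_derive _ _ _ (X + _)]mulrC.
have X1 : X < X + 1 by lra.
have dec x : X + 1 <= x -> G x <= phi (X + 1).
  move=> x1; have Xx : X < x by lra.
  have [[_ Gx] [_ bx]] := hX x Xx.
  apply: (@le_trans _ _ (phi x)).
    rewrite /phi ler_peMr //; first exact: ltW.
    rewrite lerDl mulr_ge0 ?invr_ge0 //; lra.
  apply: (nonincreasing_ray R X phi _ dphi) => // z Xz.
  have [[_ Gz] [GBz bz]] := hX z Xz.
  have z0 : 0 < z by lra.
  have Vz : V z <= b * G z / z ^+ 2.
    rewrite ler_pdivlMr ?exprn_gt0 // mulrC.
    move: GBz; rewrite ler_pdivrMr // => h; apply: le_trans h _.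
    by rewrite ler_pM2r // le_max lexx.
  have h1 : 0 < 1 + 2 * b * z^-1 by rewrite addr_gt0 // !mulr_gt0 ?invr_gt0.
  have h2 := ler_wpM2r (ltW h1) Vz.
  have h3 : 2 * b * z^-1 <= 1 by rewrite ler_pdivrMr // mul1r ltW.
  have h4 : 0 <= b * G z / z ^+ 2 by rewrite divr_ge0 ?mulr_ge0 ?exprn_ge0 // ltW.
  have h5 := ler_wpM2l h4 h3.
  have -> : G z * (2 * b * - z ^- 2) = - (2 * (b * G z / z ^+ 2)) by ring.
  by rewrite mulrDr mulr1 in h2; lra.
have [Y hY] := Ginf (phi (X + 1) + 1).
pose x := Num.max (X + 1) (Y + 1).
have x1 : X + 1 <= x by rewrite le_max lexx.
have x2 : Y < x by rewrite lt_max; apply/orP; right; lra.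
by have := dec x x1; have := hY x x2; lra.
Qed.

Lemma is_derive_sqr_ratio (R : realType) (G V V' : R -> R) (x : R) :
  is_derive x 1 G (V x) -> is_derive x 1 V (V' x) -> G x != 0 ->
  is_derive x 1 (fun y => y * y * V y * (G y)^-1)
    (x * ((2 * G x * V x) + (G x * V' x - V x * V x) * x) * (G x)^-2).
Proof.
move=> dG dV Gx0; have dx := is_derive_id x (1 : R).
have := is_deriveM (is_deriveM (is_deriveM dx dx) dV) (is_deriveV Gx0 dG).
rewrite /GRing.scale /= => dd.
apply: (eq_ind _ (fun z => is_derive x 1 (fun y => y * y * V y * (G y)^-1) z) dd).
have e1 : (id * id) x = x * x by [].
have e2 : (id * id * V) x = x * x * V x by [].
by rewrite e1 e2; field.
Qed.

Lemma signed_id_mul (R : realType) (f : R -> R) : signed R f -> signed R (fun x => x * f x).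
Proof. by move=> sf; apply: signed_mul => //; apply: Or32; exact: ev_gt. Qed.

Lemma hardy_ratio_signed (R : realType) (H : set (R -> R)) (HH : is_hardy_field H)
  (G V V' : R -> R) : H G -> H V -> H V' ->
  signed R (fun x => x * ((2 * G x * V x) + (G x * V' x - V x * V x) * x)).
Proof.
move=> HG HV HV'; apply: signed_id_mul; apply: (hardy_signed_affine R H HH).
  have HGV := hardy_mul HH HG HV.
  have -> : (fun x => 2 * G x * V x) = (fun x => G x * V x + G x * V x).
    by apply: funext => z; ring.
  exact (hardy_add HH HGV HGV).
have h2 := hardy_opp HH (hardy_mul HH HV HV).
exact (hardy_add HH (hardy_mul HH HG HV') h2).
Qed.

(* The second [signed] function is the numerator of the derivative of
   [x ^+ 2 * V x / G x], which is thus monotone. *)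
Lemma slow_ratio_growth (R : realType) (G V V' : R -> R) :
  ev R (fun x => is_derive x 1 G (V x)) -> ev R (fun x => is_derive x 1 V (V' x)) ->
  signed R V' ->
  signed R (fun x => x * ((2 * G x * V x) + (G x * V' x - V x * V x) * x)) ->
  (forall e : R, 0 < e -> ev R (fun x => `|V x| <= e)) ->
  ev R (fun x => 0 <= V x) -> (forall T : R, ev R (fun x => T <= G x)) ->
  exists X : R, [/\ 1 <= X,
    forall x y, X < x -> x <= y -> 0 <= V y <= V x /\ V x * x ^+ 2 <= V y * y ^+ 2,
    forall x y, X < x -> x <= y -> 0 < G x <= G y &
    forall T : R, ev R (fun x => T * G x <= x ^+ 2 * V x)].
Proof.
move=> dG dV sV' sN V0 Vge0 Ginf.
have [/(_ Vge0) Vdec _] := decreasing_of_tends0 R V V' dV sV' V0.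
have G1 := Ginf 1.
have base := ev_and R _ _ (ev_and R _ _ dG dV)
  (ev_and R _ _ (ev_and R _ _ Vge0 Vdec) (ev_and R _ _ G1 (ev_gt R 1))).
pose B1 x := x * x * V x * (G x)^-1.
pose B1' x := x * ((2 * G x * V x) + (G x * V' x - V x * V x) * x) * (G x)^-2.
have dB : ev R (fun x => is_derive x 1 B1 (B1' x)).
  apply: ev_mono base => x [[dGx dVx] [_ [G1x _]]].
  by apply: is_derive_sqr_ratio => //; rewrite gt_eqF //; lra.
have sB' : signed R B1'.
  apply: signed_mul => //.
  by apply: Or32; apply: ev_mono G1 => x Gx; rewrite invr_gt0 exprn_gt0 //; lra.
have [B1p B1inf] : ev R (fun x => 0 <= B1' x) /\ forall T : R, ev R (fun x => T <= B1 x).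
  have [[B hB]|//] := bounded_or_infinite R B1 B1' dB sB'.
  exfalso; apply: (not_bounded_log_derivative R G V B dG) => //.
  by apply: ev_mono G1 => x Gx; lra.
have [X hX] := ev_and R _ _ (ev_and R _ _ dB B1p) base.
have Gp z : X < z -> 0 < G z by move=> /hX[_ [_ [_ [h _]]]]; lra.
have Gm x y : X < x -> x <= y -> G x <= G y.
  by apply: (nondecreasing_ray R X G V) => z /hX[_ [[h1 h2] [[h3 h4] h5]]].
exists (Num.max X 1); split; first by rewrite le_max lexx orbT.
- move=> x y; rewrite gt_max => /andP[Xx x1] xy.
  have Xy := lt_le_trans Xx xy.
  have [_ [_ [[Vx _] _]]] := hX x Xx.
  have [_ [_ [[Vy _] _]]] := hX y Xy.
  have VyVx : V y <= V x.
    by apply: (nonincreasing_ray R X V V') => // z /hX[_ [[h1 h2] [[h3 h4] h5]]].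
  have BB : B1 x <= B1 y.
    by apply: (nondecreasing_ray R X B1 B1') => // z /hX[[h1 h2] _].
  rewrite Vy VyVx; split => //.
  have Gx0 := Gp x Xx; have Gy0 := Gp y Xy; have GxGy := Gm x y Xx xy.
  rewrite /B1 ler_pdivrMr // in BB; rewrite !expr2 ![V _ * _]mulrC.
  apply: le_trans BB _; rewrite mulrAC ler_pdivrMr //.
  by apply: ler_wpM2l => //; rewrite mulr_ge0 // mulr_ge0 //; lra.
- move=> x y; rewrite gt_max => /andP[Xx x1] xy.
  by rewrite Gp ?Gm.
- move=> T; apply: ev_mono (ev_and R _ _ (B1inf T) (ev_gt R X)) => x [Bx Xx].
  by move: Bx; rewrite /B1 ler_pdivlMr ?Gp // expr2.
Qed.

Lemma is_derive_pow (R : realType) (n : nat) (x : R) :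
  is_derive x 1 (fun y => y ^+ n.+1) (n.+1%:R * x ^+ n).
Proof.
elim: n => [|n IH].
  have -> : (fun y : R => y ^+ 1) = id by apply: funext => y; rewrite expr1.
  by rewrite expr0 mulr1; exact: is_derive_id.
have -> : (fun y : R => y ^+ n.+2) = (fun y => y * y ^+ n.+1) by apply: funext => y; rewrite exprS.
have := is_deriveM (is_derive_id x (1 : R)) IH; rewrite /GRing.scale /= mulr1 => dd.
apply: (eq_ind _ (fun z => is_derive x 1 (fun y => y * y ^+ n.+1) z) dd).
by rewrite -(natr1 n.+1) exprS; ring.
Qed.

(** The second signed function is, up to the factor [x ^ p], the derivative of [W * x ^ (p + 1)],
    which is therefore monotone: it is bounded above or increases to infinity. This alternative
    isolates the polynomials up to a logarithm. *)
Lemma power_growth (R : realType) (W W' : R -> R) (p : nat) :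
  ev R (fun x => is_derive x 1 W (W' x)) -> signed R W' ->
  signed R (fun x => p.+1%:R * W x + W' x * x) ->
  (forall e : R, 0 < e -> ev R (fun x => `|W x| <= e)) ->
  ev R (fun x => 0 <= W x) ->
  exists X : R, [/\ 1 <= X, forall x y, X < x -> x <= y -> 0 <= W y <= W x &
    (exists K : R, forall x, X < x -> W x * x ^+ p.+1 <= K) \/
    ((forall x y, X < x -> x <= y -> W x * x ^+ p.+1 <= W y * y ^+ p.+1) /\
     forall T : R, ev R (fun x => T <= W x * x ^+ p.+1))].
Proof.
move=> dW sW' sN W0 Wge0.
have [/(_ Wge0) Wdec _] := decreasing_of_tends0 R W W' dW sW' W0.
pose B x := W x * x ^+ p.+1.
pose B' x := x ^+ p * (p.+1%:R * W x + W' x * x).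
have dB : ev R (fun x => is_derive x 1 B (B' x)).
  apply: ev_mono dW => x dWx.
  have := is_deriveM dWx (is_derive_pow R p x); rewrite /GRing.scale /= => dd.
  apply: (eq_ind _ (fun z => is_derive x 1 B z) dd).
  by rewrite /B' exprS; ring.
have sB' : signed R B'.
  apply: signed_mul => //.
  by apply: Or32; apply: ev_mono (ev_gt R 0) => x x0; exact: exprn_gt0.
have [X hX] := ev_and R _ _ dW (ev_and R _ _ Wge0 Wdec).
have dec x y : X < x -> x <= y -> 0 <= W y <= W x.
  move=> Xx xy; have [_ [Wy _]] := hX y (lt_le_trans Xx xy); rewrite Wy /=.
  by apply: (nonincreasing_ray R X W W') => // z /hX[h1 [h2 h3]].
have [[K [Y hY]]|[Bp Binf]] := bounded_or_infinite R B B' dB sB'.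
  exists (Num.max X (Num.max Y 1)); split; first by rewrite !le_max lexx !orbT.
    by move=> x y; rewrite gt_max => /andP[Xx _]; exact: dec.
  by left; exists K => x; rewrite !gt_max => /andP[_ /andP[Yx _]]; exact: hY.
have [Y hY] := ev_and R _ _ dB Bp.
exists (Num.max X (Num.max Y 1)); split; first by rewrite !le_max lexx !orbT.
  by move=> x y; rewrite gt_max => /andP[Xx _]; exact: dec.
right; split=> // x y; rewrite !gt_max => /andP[_ /andP[Yx _]] xy.
by apply: (nondecreasing_ray R Y B B') => // z /hY[h1 h2].
Qed.

(** * The sequence [alpha n] *)

Section hardy_sequence.
Variable R : realType.
Variables (H : set (R -> R)) (alpha : R -> R).
Hypothesis HH : is_hardy_field H.
Hypothesis Halpha : H alpha.
Hypothesis alpha_infty : forall T : R, ev R (fun x => T <= alpha x).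

Let D i : R -> R := derive1n i alpha.
Let a (n : nat) : R := alpha n%:R.

Let D_H i : H (D i). Proof. exact: hardy_derive1n. Qed.
Let D_signed i : signed R (D i). Proof. exact: hardy_signed (D_H i). Qed.
Let D_derive i : ev R (fun x => is_derive x 1 (D i) (D i.+1 x)).
Proof. by have := hardy_is_derive R H HH _ (D_H i); rewrite /D derive1nS. Qed.

Let D_chain k : exists X, derive_chain R X k D.
Proof.
elim: k => [|k [X hX]]; first by exists 0.
have [Y hY] := D_derive k; exists (Num.max X Y) => i x ik.
rewrite gt_max => /andP[Xx Yx]; move: ik; rewrite ltnS leq_eqVlt => /orP[/eqP ->|ik].
  exact: hY.
exact: hX.
Qed.

Definition evn (P : nat -> Prop) : Prop := exists n0 : nat, forall n, (n0 <= n)%N -> P n.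

Lemma ev_evn (P : R -> Prop) : ev R P -> evn (fun n => P n%:R).
Proof.
move=> [X hX]; have [K /andP[_ hK]] := truncn_ex R `|X| (normr_ge0 _).
exists K.+1 => n Kn; apply: hX; apply: le_lt_trans (ler_norm _) _.
by apply: lt_le_trans hK _; rewrite ler_nat.
Qed.

Lemma evn_and P Q : evn P -> evn Q -> evn (fun n => P n /\ Q n).
Proof.
move=> [n h] [m h']; exists (maxn n m) => k; rewrite geq_max => /andP[nk mk].
by split; [exact: h|exact: h'].
Qed.

Let D0E : D 0 = alpha. Proof. by []. Qed.

Let fdiff_between k (lo hi : R -> R) :
  evn (fun n => (forall x, n%:R <= x <= n%:R + k%:R -> lo n%:R <= D k x <= hi n%:R) ->
    lo n%:R <= fdiff R k a n <= hi n%:R).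
Proof.
have [X ch] := D_chain k.
have [n0 h0] := ev_evn _ (ev_gt R X).
exists n0 => n nn h; apply/andP; split.
  by apply: (fdiff_ge R X (lo n%:R) k n D ch (h0 n nn)) => x /h/andP[].
by apply: (fdiff_le R X (hi n%:R) k n D ch (h0 n nn)) => x /h/andP[].
Qed.

Let fdiff_ev_ge k (lo : R) : ev R (fun x => lo <= D k x) -> evn (fun n => lo <= fdiff R k a n).
Proof.
move=> [Y hY]; have [X ch] := D_chain k.
have [n0 h0] := evn_and _ _ (ev_evn _ (ev_gt R X)) (ev_evn _ (ev_gt R Y)).
exists n0 => n nn; have [hX hY'] := h0 n nn.
by apply: (fdiff_ge R X lo k n D ch hX) => x /andP[nx _]; apply: hY; exact: lt_le_trans nx.
Qed.

Let fdiff_ev_le k (hi : R) : ev R (fun x => D k x <= hi) -> evn (fun n => fdiff R k a n <= hi).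
Proof.
move=> [Y hY]; have [X ch] := D_chain k.
have [n0 h0] := evn_and _ _ (ev_evn _ (ev_gt R X)) (ev_evn _ (ev_gt R Y)).
exists n0 => n nn; have [hX hY'] := h0 n nn.
by apply: (fdiff_le R X hi k n D ch hX) => x /andP[nx _]; apply: hY; exact: lt_le_trans nx.
Qed.

Let fdiff_signed k : evn (fun n => 0 <= fdiff R k a n) \/ evn (fun n => fdiff R k a n <= 0).
Proof.
case: (D_signed k) => h.
- by left; apply: fdiff_ev_ge; apply: ev_mono h => x ->.
- by left; apply: fdiff_ev_ge; apply: ev_mono h => x /ltW.
- by right; apply: fdiff_ev_le; apply: ev_mono h => x /ltW.
Qed.

Let tends0 k : Prop := forall e : R, 0 < e -> ev R (fun x => `|D k x| <= e).

(** The third case of [signed_trichotomy], a derivative below a negative constant, would make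
    [alpha n] nonpositive for large [n]. *)
Let D_tri k : tends0 k \/ exists2 c : R, 0 < c & ev R (fun x => c <= D k x).
Proof.
have [h|h|[c c0 h]] := signed_trichotomy R (D k) (D k.+1) (D_derive k) (D_signed k.+1) (D_signed k).
- by left.
- by right.
exfalso; have [n0 h0] := fdiff_ev_le k (- c) h.
have [|c' [n1 [c'0 h1]]] := fdiff_lower_growth R k n0 (fun n => -1 * a n) c c0.
  by move=> n nn; rewrite fdiffZ mulN1r lerNr; exact: h0.
have [n2 h2] := ev_evn _ (alpha_infty 1).
have := h1 (maxn n1 n2) (leq_maxl _ _); have := h2 (maxn n1 n2) (leq_maxr _ _).
have : 0 <= c' * (maxn n1 n2)%:R ^+ k by rewrite mulr_ge0 ?exprn_ge0 // ltW.
by rewrite mulN1r -/(a _); lra.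
Qed.

(** A positive lower bound on [D L] would make [alpha n] grow at least like [n ^ L], so [tends0 L]
    holds and there is a least order. It is not 0 because [alpha] itself tends to infinity. *)
Let first_tends0 (L : nat) : (forall c : R, 0 < c -> ~ evn (fun n => c * n%:R ^+ L <= a n)) ->
  exists k, [/\ (0 < k)%N, tends0 k & forall i, (i < k)%N ->
     exists2 c : R, 0 < c & ev R (fun x => c <= D i x)].
Proof.
move=> slow.
have tL : tends0 L.
  have [//|[c c0 h]] := D_tri L; exfalso.
  have [n0 h0] := fdiff_ev_ge L c h.
  have [c' [n1 [c'0 h1]]] := fdiff_lower_growth R L n0 a c c0 h0.
  by apply: (slow c' c'0); exists n1.
have ex : exists k, `[< tends0 k >] by exists L; apply/asboolP.
case: (ex_minnP ex) => k /asboolP tk min; exists k; split => //.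
  rewrite lt0n; apply/eqP => k0; have := tk 1 ltr01; rewrite k0 => h.
  have [X hX] := ev_and R _ _ h (alpha_infty 2).
  have [] := hX (X + 1) ltac:(lra).
  by rewrite D0E => h1 h2; have := ler_norm (alpha (X + 1)); lra.
move=> i ik; have [h|//] := D_tri i.
by have := min i (introT (asboolP _) h); rewrite leqNgt ik.
Qed.

(** From [n1] on, steps of [a] are at most [1/2], so the first index with [a n >= x + y] overshoots
    by less than 1. Choosing [x] above [|a n1|] makes that index larger than [n1], so that its
    predecessor is still in the controlled range. *)
Lemma hits_of_derive_tends0 (A : set nat) : tends0 1 -> (forall N, exists2 x, (N <= x)%N & A x) ->
  exists x y n, [/\ A x, A y, x <> y, (1 <= n)%N & 0 <= a n - x%:R - y%:R < 1].
Proof.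
move=> t1 Ainf.
have hlt : 0 < 2^-1 :> R by lra.
have [n0 h0] := fdiff_ev_le 1 2^-1 (ev_mono R _ _ (fun x h => le_trans (ler_norm _) h) (t1 _ hlt)).
pose n1 := maxn 1 n0.
have [K /andP[_ hK]] := truncn_ex R `|a n1| (normr_ge0 _).
have [x xK Ax] := Ainf K.+1; have [y xy Ay] := Ainf x.+1.
have ex : exists n, (n1 <= n)%N && (x%:R + y%:R <= a n).
  have [m hm] := ev_evn _ (alpha_infty (x%:R + y%:R)).
  exists (maxn n1 m); rewrite leq_maxl /=; apply: hm; exact: leq_maxr.
case: (ex_minnP ex) => n /andP[n1n xyn] min.
exists x, y, n; split => //.
- by move=> e; move: xy; rewrite e ltnn.
- by apply: leq_trans n1n; exact: leq_maxl.
have nn1 : (n1 < n)%N.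
  rewrite ltn_neqAle n1n andbT; apply/eqP => e; rewrite -e in xyn.
  have h1 : K.+1%:R <= x%:R :> R by rewrite ler_nat.
  by have := ler_norm (a n1); have := ler0n R y; lra.
have np : n = n.-1.+1 by rewrite prednK //; apply: leq_trans nn1.
have : a n.-1 < x%:R + y%:R.
  rewrite ltNge; apply/negP => h.
  have := min n.-1; rewrite h andbT => /(_ ltac:(rewrite -ltnS -np; exact: nn1)).
  by rewrite {1}np ltnn.
have := h0 n.-1 ltac:(rewrite -ltnS -np; exact: leq_ltn_trans (leq_maxr _ _) nn1).
rewrite fdiffS -np /fdiff /= => h1 h2.
by apply/andP; split; lra.
Qed.

Section regular.
Variable d : nat.
Hypothesis d_gt0 : (0 < d)%N.
Hypothesis D_lower : forall i, (i < d.+1)%N -> exists2 c : R, 0 < c & ev R (fun x => c <= D i x).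
Hypothesis D_top : tends0 d.+1.

Let g := fdiff R d a.
Let u := fdiff R d.+1 a.

Let D_lower_unif : exists2 c : R, 0 < c & evn (fun n => forall i, (i <= d)%N -> c <= fdiff R i a n).
Proof.
suff main k : (k <= d.+1)%N -> exists2 c : R, 0 < c &
    evn (fun n => forall i, (i < k)%N -> c <= fdiff R i a n).
  have [c c0 [n0 h]] := main d.+1 (leqnn _); exists c => //; exists n0 => n nn i id.
  exact: h.
elim: k => [|k IH] kd; first by exists 1 => //; exists 0.
have [c1 c10 h1] := IH (ltnW kd).
have [c2 c20 /fdiff_ev_ge h2] := D_lower k kd.
exists (Num.min c1 c2); first by rewrite lt_min c10.
have [n0 h] := evn_and _ _ h1 h2; exists n0 => n nn i ik.
have [h3 h4] := h n nn; rewrite ge_min; move: ik; rewrite ltnS leq_eqVlt => /orP[/eqP ->|ik].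
  by rewrite h4 orbT.
by rewrite h3.
Qed.

Let u_small (e : R) : 0 < e -> evn (fun n => `|u n| <= e).
Proof.
move=> e0; have h := D_top e e0.
have h1 := fdiff_ev_le d.+1 e (ev_mono R _ _ (fun x h => le_trans (ler_norm _) h) h).
have h2 : evn (fun n => - e <= fdiff R d.+1 a n).
  by apply: fdiff_ev_ge; apply: ev_mono h => x; rewrite ler_norml => /andP[].
have [n0 h3] := evn_and _ _ h1 h2; exists n0 => n nn.
by have [h4 h5] := h3 n nn; rewrite ler_norml h5.
Qed.

Let g_mono : evn (fun n => forall m, monotone_on R n m g).
Proof.
have [[n0 h]|[n0 h]] := fdiff_signed d.+1; exists n0 => n nn; apply: monotone_on_fdiff;
  [left|right] => k nk; apply: h; exact: leq_trans nn nk.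
Qed.

Let u_mono : evn (fun n => forall m, monotone_on R n m u).
Proof.
have [[n0 h]|[n0 h]] := fdiff_signed d.+2; exists n0 => n nn; apply: monotone_on_fdiff;
  [left|right] => k nk; apply: h; exact: leq_trans nn nk.
Qed.

Let G := D d.
Let V := D d.+1.
Let V' := D d.+2.

Lemma exp_sums_small_unbounded : ev R (fun x => 0 <= V x) -> (forall T : R, ev R (fun x => T <= G x)) ->
  evn (fun n => exp_sums_small R n a).
Proof.
move=> V0 Ginf.
have sN : signed R (fun x => x * ((2 * G x * V x) + (G x * V' x - V x * V x) * x)).
  by apply: (hardy_ratio_signed R H HH G V V'); exact: D_H.
have [X0 [X01 VV GG ratio]] :=
  slow_ratio_growth R G V V' (D_derive d) (D_derive d.+1) (D_signed d.+2) sN D_top V0 Ginf.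
have ubet := fdiff_between d.+1 (fun x => V (x + d.+1%:R)) V.
have gbet := fdiff_between d (fun x => 0) (fun x => G (x + d%:R)).
have [c c0 low] := D_lower_unif.
have [n0 h0] := evn_and _ _ (evn_and _ _ (evn_and _ _ ubet gbet) (evn_and _ _ low u_mono))
  (ev_evn _ (ev_gt R X0)).
have Xn n : (n0 <= n)%N -> X0 < n%:R by move=> /h0[].
have uV n : (n0 <= n)%N -> V (n%:R + d.+1%:R) <= u n <= V n%:R.
  move=> nn; have [[[ub _] _] _] := h0 n nn; apply: ub => x /andP[nx xn].
  have h1 := Xn n nn.
  have [/andP[_ v1] _] := VV n%:R x h1 nx.
  have [/andP[_ v2] _] := VV x (n%:R + d.+1%:R) (lt_le_trans h1 nx) xn.
  by rewrite v2.
have u0 n : (n0 <= n)%N -> 0 <= u n.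
  move=> nn; have /andP[v1 _] := uV n nn; apply: le_trans v1.
  by have [/andP[]] := VV n%:R (n%:R + d.+1%:R) (Xn n nn) ltac:(by rewrite lerDl).
have gG n : (n0 <= n)%N -> g n <= G (n%:R + d%:R).
  move=> nn; have [[[_ gb] _] _] := h0 n nn.
  have h1 := Xn n nn.
  have /andP[_ //] : 0 <= g n <= G (n%:R + d%:R).
  apply: gb => x /andP[nx xn]; have Xx := lt_le_trans h1 nx.
  have /andP[G1 G2] := GG x (n%:R + d%:R) Xx xn.
  by rewrite G2 andbT; exact: ltW G1.
have n0p : (0 < n0)%N by rewrite -(ltr0n R); apply: lt_trans (Xn n0 (leqnn _)); lra.
exists n0 => n1 n01.
have n1p : (0 < n1)%N by exact: leq_trans n01.
have at_n1 n : (n1 <= n)%N -> (n0 <= n)%N by exact: leq_trans.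
have lown i n : (i <= d)%N -> (n1 <= n)%N -> c <= fdiff R i a n.
  by move=> id /at_n1/h0[[_ [h _]] _]; exact: h.
have [C C0 wC] := fdiff_upper_by_top R d n1 a c n1p c0 d_gt0 lown (fun n nn => u0 n (at_n1 n nn)).
apply: (exp_sums_small_infinite R d n1 a C d_gt0 C0).
- by have [[_ [_ h]] _] := h0 n1 n01.
- by move=> n nn; apply: u0; exact: at_n1.
- by move=> n nn; apply: lt_le_trans c0 (lown d n (leqnn _) nn).
- apply: (comparable_of_real R X0 V u d.+1 2 n1) => //; first by lra.
    exact: Xn.
  by move=> n nn; rewrite ger0_norm ?u0 ?uV //; exact: at_n1.
- move=> e e0; have [m h] := u_small e e0; exists m => M mM.
  by apply: le_trans (ler_norm _) (h M mM).
(* The ratio is known at the real point [y = M + d + 1], where [V y <= u M] and [g M <= G y]; the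
   factor 4 pays for [y <= 2 * M]. *)
- move=> T; have [Y hY] := ratio (4 * `|T|).
  have [m hm] := ev_evn _ (ev_gt R Y).
  exists (maxn (maxn n1 d.+1) m) => M; rewrite !geq_max => /andP[/andP[M1 Md] Mm].
  have nn := at_n1 M M1.
  set y : R := M%:R + d.+1%:R.
  have dR : 0 <= d.+1%:R :> R by exact: ler0n.
  have My : M%:R <= y by rewrite /y lerDl.
  have XM := Xn M nn.
  have Xy : X0 < y by exact: lt_le_trans XM My.
  have By := hY y (lt_le_trans (hm M Mm) My).
  have gy : g M <= G y.
    apply: le_trans (gG M nn) _.
    have h1 : M%:R + d%:R <= y by rewrite /y -(natr1 d) addrA lerDl.
    have h2 : X0 < M%:R + d%:R by apply: lt_le_trans XM _; rewrite lerDl.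
    by have /andP[] := GG _ _ h2 h1.
  have /andP[Vu _] := uV M nn; rewrite -/y in Vu.
  have [/andP[Vy _] _] := VV y y Xy (lexx _).
  have /andP[Gy0 _] := GG y y Xy (lexx _).
  have gM0 : 0 <= g M by apply: le_trans (ltW c0) (lown d M (leqnn _) M1).
  have y2 : y <= 2 * M%:R.
    by rewrite /y mulr_natl mulr2n lerD2l ler_nat.
  have T0 := ler_norm T; have T1 := normr_ge0 T.
  rewrite -/(g M) -/(u M); move: (G y) (V y) (u M) (g M) By gy Vu Vy Gy0 gM0 => Gy Vy' uM gM By gy Vu Vy Gy0 gM0.
  have yy : y ^+ 2 <= 4 * M%:R ^+ 2.
    have -> : 4 * M%:R ^+ 2 = (2 * M%:R) ^+ 2 :> R by ring.
    have M0 := ler0n R M; have y0 : 0 <= y by lra.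
    by apply: lerXn2r; rewrite ?nnegrE //; lra.
  have h1 : y ^+ 2 * Vy' <= 4 * M%:R ^+ 2 * Vy' by apply: ler_wpM2r.
  have h2 : M%:R ^+ 2 * Vy' <= M%:R ^+ 2 * uM by apply: ler_wpM2l => //; exact: exprn_ge0.
  have h3 : T * gM <= `|T| * gM by apply: ler_wpM2r.
  have h4 : `|T| * gM <= `|T| * Gy by apply: ler_wpM2l.
  by move: By h1 h2 h3 h4; lra.
- by move=> n nn; exact: wC.
Qed.

Section bounded_top.
Hypothesis a_far : forall (p : {poly rat}) (x y : R) (N : nat), exists2 n, (N <= n)%N &
  y * (1 + ln n%:R) < `|a n - x * (map_poly ratr p).[n%:R]|.

Let sign_top : exists2 sg : R, sg = 1 \/ sg = -1 & ev R (fun x => 0 <= sg * V x).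
Proof.
case: (D_signed d.+1) => h.
- by exists 1; [left|apply: ev_mono h => x e; rewrite mul1r /V e].
- by exists 1; [left|apply: ev_mono h => x e; rewrite mul1r /V ltW].
- by exists (-1); [right|apply: ev_mono h => x e; rewrite mulN1r oppr_ge0 /V ltW].
Qed.

Lemma mid_sums_small_ev (c : R) : 0 < c -> evn (fun n => c / 2 <= g n <= 2 * c) ->
  evn (fun n => mid_sums_small R n a).
Proof.
move=> c0 gc; have [sg sgE sgV] := sign_top.
pose W x := sg * V x; pose W' x := sg * V' x.
have dW : ev R (fun x => is_derive x 1 W (W' x)).
  apply: ev_mono (D_derive d.+1) => x dV; exact: (is_deriveZ sg dV).
have ssg f : signed R f -> signed R (fun x => sg * f x).
  move=> sf; apply: (signed_mul R (fun=> sg) f) => //.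
  case: sgE => ->; [apply: Or32|apply: Or33]; exists 0 => x _; first exact: ltr01.
  by rewrite oppr_lt0.
have sW' : signed R W' by apply: ssg; exact: D_signed.
have sN : signed R (fun x => d.+1%:R * W x + W' x * x).
  have h : signed R (fun x => sg * (d.+1%:R * V x + V' x * x)).
    apply: ssg; apply: (hardy_signed_affine R H HH _ _ _ (D_H d.+2)).
    (* [H] need not contain all real constants, so integer multiples are built by repeated
       addition. *)
    have H1 (k : nat) : H (fun x => k%:R * V x).
      elim: k => [|k IH].
        have -> : (fun x : R => 0%:R * V x) = (fun=> 0) by apply: funext => x; rewrite mul0r.
        exact: (hardy_0 HH).
      have -> : (fun x : R => k.+1%:R * V x) = (fun x => k%:R * V x + V x).
        by apply: funext => x; rewrite -(natr1 k) mulrDl mul1r.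
      exact (hardy_add HH IH (D_H d.+1)).
    exact: H1.
  by apply: signed_ext h; exists 0 => x _; rewrite /W /W'; ring.
have W0 (e : R) : 0 < e -> ev R (fun x => `|W x| <= e).
  move=> /D_top; apply: ev_mono => x h; rewrite /W normrM.
  by case: sgE => ->; rewrite ?normrN normr1 mul1r.
have [X [X1 Wdec Wcase]] := power_growth R W W' d dW sW' sN W0 sgV.
have ubet : evn (fun n => (forall x, n%:R <= x <= n%:R + d.+1%:R ->
      W (n%:R + d.+1%:R) <= W x <= W n%:R) ->
    W (n%:R + d.+1%:R) <= sg * u n <= W n%:R).
  case: sgE => sg1.
    have [n0 h0] := fdiff_between d.+1 (fun x => W (x + d.+1%:R)) W.
    exists n0 => n nn; rewrite sg1 mul1r => h; apply: h0 => // x /h.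
    by have -> : W x = D d.+1 x by rewrite /W sg1 mul1r.
  have [n0 h0] := fdiff_between d.+1 (fun x => - W x) (fun x => - W (x + d.+1%:R)).
  exists n0 => n nn; rewrite sg1 mulN1r => h.
  have /andP[h1 h2] : - W n%:R <= u n <= - W (n%:R + d.+1%:R).
    apply: h0 => // x /h; have -> : W x = - D d.+1 x by rewrite /W sg1 mulN1r.
    by move=> /andP[h1 h2]; apply/andP; split; [rewrite lerNl|rewrite lerNr].
  by apply/andP; split; [rewrite lerNr|rewrite lerNl].
have [n0 h0] := evn_and _ _ (evn_and _ _ ubet gc)
  (evn_and _ _ (evn_and _ _ g_mono u_mono) (ev_evn _ (ev_gt R X))).
have Xn n : (n0 <= n)%N -> X < n%:R by move=> /h0[_ []].
have su n : (n0 <= n)%N -> W (n%:R + d.+1%:R) <= sg * u n <= W n%:R.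
  move=> nn; have [[ub _] _] := h0 n nn; apply: ub => x /andP[nx xn].
  have h1 := Xn n nn.
  have /andP[_ v1] := Wdec n%:R x h1 nx.
  by have /andP[_ ->] := Wdec x (n%:R + d.+1%:R) (lt_le_trans h1 nx) xn.
have su0 n : (n0 <= n)%N -> 0 <= sg * u n.
  move=> nn; have /andP[v1 _] := su n nn; apply: le_trans v1.
  by have /andP[] := Wdec n%:R (n%:R + d.+1%:R) (Xn n nn) ltac:(by rewrite lerDl).
have abs_u n : (n0 <= n)%N -> `|u n| = sg * u n.
  move=> nn; rewrite -[RHS]ger0_norm ?su0 // normrM.
  by case: sgE => ->; rewrite ?normrN normr1 mul1r.
exists n0 => n1 n01.
have at_n1 n : (n1 <= n)%N -> (n0 <= n)%N by exact: leq_trans.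
have n1p : (0 < n1)%N.
  by rewrite -(ltr0n R); apply: lt_trans (Xn n1 n01); lra.
have nR n : (n1 <= n)%N -> 0 <= n%:R ^+ d.+1 :> R by move=> _; exact: exprn_ge0.
(* If [W x * x ^ (d + 1)] is bounded, [newton_expansion] exhibits the polynomial and [a_far] is
   called upon; otherwise the derivative test of order [d + 1] is enough. *)
case: Wcase => [[K hK]|[Winc Winf]].
  have [|b [K' hb]] := newton_expansion R d n1 a K n1p.
    move=> n nn; rewrite -/(u n) abs_u ?at_n1 //.
    have /andP[_ h1] := su n (at_n1 n nn).
    by apply: le_trans (hK n%:R (Xn n (at_n1 n nn))); apply: ler_wpM2r h1; exact: nR nn.
  apply: (mid_sums_small_bounded R d n1 a c K' b n1p d_gt0 c0).
  - by move=> n /at_n1/h0[[_ h] _].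
  - by have [_ [[h _] _]] := h0 n1 n01.
  - exact: hb.
  - by move=> p x y; exact: a_far.
apply: (mid_sums_small_large R d n1 a).
- by have [_ [[_ h] _]] := h0 n1 n01.
- case: sgE => sg1; [left|right] => n /at_n1/su0; rewrite sg1 ?mul1r // mulN1r.
  by rewrite oppr_ge0.
- apply: (comparable_of_real R X W u d.+1 d.+1 n1); [by lra|exact: Xn| |].
    by move=> n nn; rewrite abs_u ?at_n1 // su // at_n1.
  by move=> x y Xx xy; split; [exact: Wdec|exact: Winc].
- by move=> e e0; exact: u_small.
- move=> T; have [Y hY] := Winf (2 ^+ d.+1 * `|T|).
  have [m hm] := ev_evn _ (ev_gt R Y).
  exists (maxn (maxn n1 d.+1) m) => M; rewrite !geq_max => /andP[/andP[M1 Md] Mm].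
  have nn := at_n1 M M1.
  set y : R := M%:R + d.+1%:R.
  have My : M%:R <= y by rewrite /y lerDl.
  have Wy := hY y (lt_le_trans (hm M Mm) My).
  have /andP[h1 _] := su M nn; rewrite -/y in h1.
  have /andP[h2 _] := Wdec y y (lt_le_trans (Xn M nn) My) (lexx _).
  have y2 : y <= 2 * M%:R by rewrite /y mulr_natl mulr2n lerD2l ler_nat.
  have y0 : 0 <= y by apply: le_trans My; exact: ler0n.
  have h3 : y ^+ d.+1 <= 2 ^+ d.+1 * M%:R ^+ d.+1.
    by rewrite -exprMn; apply: lerXn2r; rewrite ?nnegrE ?mulr_ge0.
  have h4 : W y * y ^+ d.+1 <= W y * (2 ^+ d.+1 * M%:R ^+ d.+1) by apply: ler_wpM2l.
  have p2 : 0 < 2 ^+ d.+1 :> R by exact: exprn_gt0.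
  have h5 := le_trans Wy h4.
  rewrite -/(u M) abs_u //.
  have h6 : `|T| <= M%:R ^+ d.+1 * W y.
    rewrite -(ler_pM2l p2); apply: le_trans h5 _.
    by rewrite le_eqVlt; apply/orP; left; apply/eqP; ring.
  apply: le_trans (ler_norm _) _; apply: le_trans h6 _.
  by apply: ler_wpM2l h1; exact: nR M1.
Qed.

Lemma exp_sums_small_bounded (B : R) : ev R (fun x => G x <= B) ->
  evn (fun n => exp_sums_small R n a).
Proof.
move=> GB; have [c0 c00 Gc0] := D_lower d (ltnSn d).
have [c cp Gc] := nearly_constant R G V c0 B (D_derive d) (D_signed d.+1) c00 Gc0 GB.
have gc : evn (fun n => c / 2 <= g n <= 2 * c).
  have h1 := fdiff_ev_ge d (c / 2) (ev_mono R _ _ (fun x h => (andP h).1) Gc).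
  have h2 := fdiff_ev_le d (2 * c) (ev_mono R _ _ (fun x h => (andP h).2) Gc).
  have [n0 h] := evn_and _ _ h1 h2; exists n0 => n nn.
  by have [h3 h4] := h n nn; apply/andP.
have [n0 h0] := evn_and _ _ gc (evn_and _ _ g_mono (mid_sums_small_ev c cp gc)).
exists n0.+1 => n1 n01.
have n1p : (0 < n1)%N by exact: leq_trans n01.
have at_n1 n : (n1 <= n)%N -> (n0 <= n)%N by move=> h; apply: leq_trans h; exact: ltnW.
have [C C0 hC] : exists2 C : R, 0 < C & forall n, (n1 <= n)%N ->
    `|a n.+1 - a n| <= C * n%:R ^+ d.-1.
  apply: (fdiff_growth R d.-1 n1 (fun n => a n.+1 - a n) (2 * c) n1p) => n nn.
  rewrite -fdiffSr prednK // -/(g n).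
  have [/andP[g1 g2] _] := h0 n (at_n1 n nn).
  by rewrite ger0_norm //; lra.
apply: (exp_sums_small_finite R d n1 a c C d_gt0 C0 cp).
- by have [_ [h _]] := h0 n1 (ltnW n01).
- by move=> n /at_n1/h0[].
- by move=> n nn; apply: le_trans (ler_norm _) (hC n nn).
- by have [_ [_ h]] := h0 n1 (ltnW n01).
Qed.

Lemma exp_sums_small_ev : evn (fun n => exp_sums_small R n a).
Proof.
have [[B GB]|[V0 Ginf]] := bounded_or_infinite R G V (D_derive d) (D_signed d.+1).
  exact: exp_sums_small_bounded GB.
exact: exp_sums_small_unbounded.
Qed.

Lemma hits_of_derive_lower (A : set nat) (delta : R) : 0 < delta <= 1 ->
  (forall N0, exists N s, [/\ (N0 <= N)%N, uniq s,
     forall x, x \in s -> A x /\ (0 < x <= N)%N & delta * N%:R <= (size s)%:R]) ->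
  exists x y n, [/\ A x, A y, x <> y, (1 <= n)%N & 0 <= a n - x%:R - y%:R < 1].
Proof.
move=> d01 dense.
have [c c0 low] := D_lower_unif.
(* The input of [fdiff_base_ratio]: as [V] tends to 0 with a definite sign, it is either positive
   and decreasing or nonpositive. *)
have base : evn (fun n => u n.+1 <= u n) \/ evn (fun n => u n <= 0).
  have [Vdec _] := decreasing_of_tends0 R V V' (D_derive d.+1) (D_signed d.+2) D_top.
  case: (D_signed d.+1) => h.
  - by right; apply: fdiff_ev_le; apply: ev_mono h => x ->.
  - have [|n0 hn] := fdiff_ev_le d.+2 0.
      by apply: Vdec; apply: ev_mono h => x /ltW.
    by left; exists n0 => n /hn; rewrite fdiffS subr_le0.
  - by right; apply: fdiff_ev_le; apply: ev_mono h => x /ltW.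
have both (P Q : nat -> Prop) : evn P \/ evn Q ->
    exists n0, (forall n, (n0 <= n)%N -> P n) \/ (forall n, (n0 <= n)%N -> Q n).
  by move=> [[m hm]|[m hm]]; exists m; [left|right].
have [m1 base1] := both _ _ base.
have [m2 w2] := both _ _ (fdiff_signed 2).
have [m3 h3] := evn_and _ _ low exp_sums_small_ev.
pose n0 := maxn (maxn 1 m1) (maxn m2 m3).
have : (n0 <= n0)%N by [].
rewrite {1}/n0 !geq_max => /andP[/andP[n0p n01] /andP[n02 n03]].
clearbody n0.
have lown i n : (i <= d)%N -> (n0 <= n)%N -> c <= fdiff R i a n.
  by move=> id nn; have [h _] := h3 n (leq_trans n03 nn); exact: h.
have w1 n : (n0 <= n)%N -> c <= a n.+1 - a n.
  by move=> nn; have := lown 1%N n d_gt0 nn; rewrite fdiffS.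
have [C C1 hC] : exists2 C : R, 1 <= C & forall n, (n0 <= n)%N -> n%:R * (a n.+1 - a n) <= C * a n.
  apply: (fdiff_ratio R d n0 a c n0p c0 lown).
  have [||C C1 hC] := fdiff_base_ratio R n0 g c c0; first by move=> n nn; exact: lown.
    case: base1 => h; [left|right] => n nn.
      by rewrite -!fdiffS; apply: h; exact: leq_trans nn.
    by rewrite -!fdiffS; apply: h; exact: leq_trans nn.
  by exists C => // n nn; rewrite fdiffS; exact: hC.
have wsign : (forall n, (n0 <= n)%N -> 0 <= fdiff R 2 a n) \/
    (forall n, (n0 <= n)%N -> fdiff R 2 a n <= 0).
  by case: w2 => h; [left|right] => n nn; apply: h; exact: leq_trans nn.
have wmono : forall m, monotone_on R n0 m (fun n => a n.+1 - a n).
  exact (monotone_on_fdiff R 1 n0 a wsign).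
(* The increments are monotone. If they increase, [c' = 1] works; if they decrease, they lie between
   [c] and the one at [n0], and [c'] is the quotient. *)
have [c' c'0 wcomp] : exists2 c' : R, 0 < c' & forall n m, (n0 <= n <= m)%N ->
    c' * (a n.+1 - a n) <= a m.+1 - a m.
  case: wsign => h.
    exists 1 => // n m /andP[nn nm]; rewrite mul1r.
    elim: m nm => [|m IH]; first by rewrite leqn0 => /eqP ->.
    rewrite leq_eqVlt => /orP[/eqP -> //|]; rewrite ltnS => nm.
    apply: le_trans (IH nm) _; have := h m (leq_trans nn nm).
    by rewrite fdiffS /= subr_ge0.
  have wdec n : (n0 <= n)%N -> a n.+1 - a n <= a n0.+1 - a n0.
    elim: n => [|n IH]; first by rewrite leqn0 => /eqP ->.
    rewrite leq_eqVlt => /orP[/eqP -> //|]; rewrite ltnS => nn.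
    by apply: le_trans (IH nn); have := h n nn; rewrite fdiffS /= subr_le0.
  have w0 : 0 < a n0.+1 - a n0 by apply: lt_le_trans c0 (w1 n0 _).
  exists (c / (a n0.+1 - a n0)); first exact: divr_gt0.
  move=> n m /andP[nn nm]; apply: (@le_trans _ _ c); last by apply: w1; exact: leq_trans nm.
  rewrite mulrAC ler_pdivrMr // ler_pM2l //; exact: wdec.
have ainf (X : R) : exists2 n, (n0 <= n)%N & X < a n.
  have [m hm] := ev_evn _ (alpha_infty (X + 1)).
  exists (maxn n0 m); first exact: leq_maxl.
  by have := hm (maxn n0 m) (leq_maxr _ _); rewrite -/(a _); lra.
have a0 : 0 <= a n0 by have := lown 0%N n0 (leq0n _) (leqnn _); apply: le_trans (ltW c0).
have w0 n : (n0 <= n)%N -> 0 < a n.+1 - a n by move=> nn; exact: lt_le_trans c0 (w1 n nn).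
have small : exp_sums_small R n0 a by have [] := h3 n0 n03.
have C0 : 0 < C by lra.
have [x [y [n [Ax Ay xy nn /andP[h1 h2]]]]] :=
  dense_set_hits R n0 a c' C c'0 C0 a0 w0 wmono wcomp hC ainf small A delta d01 dense.
exists x, y, n; split => //; first exact: leq_trans nn.
by rewrite ltW.
Qed.
End bounded_top.
End regular.

Lemma hardy_sequence_hits (L : nat) (A : set nat) (delta : R) :
  (forall c : R, 0 < c -> ~ evn (fun n => c * n%:R ^+ L <= a n)) ->
  (forall (p : {poly rat}) (x y : R) (N : nat), exists2 n, (N <= n)%N &
    y * (1 + ln n%:R) < `|a n - x * (map_poly ratr p).[n%:R]|) ->
  0 < delta <= 1 ->
  (forall N0, exists N s, [/\ (N0 <= N)%N, uniq s,
     forall x, x \in s -> A x /\ (0 < x <= N)%N & delta * N%:R <= (size s)%:R]) ->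
  exists x y n, [/\ A x, A y, x <> y, (1 <= n)%N & 0 <= a n - x%:R - y%:R < 1].
Proof.
(* Order 1 is the case [d = 0], where [A] only has to be infinite: a set bounded by [N] could not
   have [delta * M] elements up to every large [M] of the density hypothesis. *)
move=> slow far d01 dense; have [[|[|d]] [// _ top low]] := first_tends0 L slow.
  apply: hits_of_derive_tends0 top _ => N.
  have [d0 _] := andP d01.
  have [K /andP[_ hK]] := truncn_ex R (N%:R / delta) (divr_ge0 (ler0n _ _) (ltW d0)).
  have [M [s [KM us sA sM]]] := dense K.+1.
  case: (boolP (has (fun x => N <= x)%N s)) => [/hasP[x /sA[Ax _] Nx]|/hasPn hs].
    by exists x.
  exfalso; have : (size s <= N)%N.
    rewrite -(size_iota 0 N); apply: uniq_leq_size => // x /hs.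
    by rewrite mem_iota /= add0n ltnNge.
  rewrite -(ler_nat R) => sN.
  have : K.+1%:R <= M%:R :> R by rewrite ler_nat.
  move: hK; rewrite ltr_pdivrMr // mulrC => hK KM'.
  have : delta * K.+1%:R <= delta * M%:R by apply: ler_wpM2l => //; exact: ltW.
  by lra.
have := hits_of_derive_lower d.+1 isT low top far A delta d01 dense.
by [].
Qed.
End hardy_sequence.

(** * Translation of the hypotheses on [A] and [alpha] *)

Lemma upper_density_pos (R : realType) (A : set nat) :
  (0 < upper_density R A)%E ->
  exists2 delta : R, 0 < delta <= 1 & forall N0, exists N s, [/\ (N0 <= N)%N, uniq s,
     forall x, x \in s -> A x /\ (0 < x <= N)%N & delta * N%:R <= (size s)%:R].
Proof.
rewrite /upper_density; set u := (X in limn_esup X) => A_dens.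
have [delta d01 dl] : exists2 delta : R, 0 < delta <= 1 & (delta%:E < limn_esup u)%E.
  move: A_dens; case: (limn_esup u) => [r||//]; last first.
    by exists 1; rewrite ?ltr01 ?lexx ?ltry.
  rewrite lte_fin => r0; exists (Num.min 1 (r / 2)).
    by rewrite lt_min ltr01 divr_gt0 //= ge_min lexx.
  by rewrite lte_fin gt_min; apply/orP; right; lra.
exists delta => // N0.
(* The limsup is an infimum of suprema over neighbourhoods of infinity, so the supremum over this
   tail exceeds [delta]. [maxn N0 1] also keeps [N] away from 0, so that the quotient can be
   cleared. *)
have [] : exists2 y, [set u x | x in [set N | (maxn N0 1 <= N)%N]] y & (delta%:E < y)%E.
  apply: ereal_sup_gt; apply: lt_le_trans dl _.
  apply: ereal_inf_lbound; exists [set N | (maxn N0 1 <= N)%N] => //.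
  exact: nbhs_infty_ge.
move=> _ [N /= N0N <-]; rewrite lte_fin.
have [N0N' N1] : (N0 <= N)%N /\ (0 < N)%N by move: N0N; rewrite geq_max => /andP.
have fin : finite_set (A `&` [set k : nat | (1 <= k <= N)%N]).
  by apply: (sub_finite_set _ (finite_II N.+1)) => x [_ /andP[_]] /=; rewrite ltnS.
rewrite ltr_pdivlMr ?ltr0n // => h.
exists N, (enum_fset (fset_set (A `&` [set k : nat | (1 <= k <= N)%N]))); split => //.
- exact: fset_uniq.
- move=> x xs; have : x \in fset_set (A `&` [set k : nat | (1 <= k <= N)%N]) by [].
  by rewrite in_fset_set // inE.
- exact: ltW.
Qed.

Lemma far_from_poly (R : realType) (alpha : R -> R) (p : {poly rat}) (x y : R) :
  `|alpha t - x * (map_poly ratr p).[t]| / ln t @[t --> +oo] --> +oo ->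
  forall N, exists2 n, (N <= n)%N &
    y * (1 + ln n%:R) < `|alpha n%:R - x * (map_poly ratr p).[n%:R]|.
Proof.
move=> /cvgryPge h N.
(* Beyond [expR 1] one has [1 + ln t <= 2 * ln t], whence the factor 2; the summand 1 makes the
   final inequality strict. *)
have [n0 h0] := ev_evn R _ (ev_and R _ _ (near_ev R _ (h (2 * `|y| + 1))) (ev_gt R (expR 1))).
exists (maxn N n0); first exact: leq_maxl.
have [] := h0 _ (leq_maxr N n0).
set t : R := (maxn N n0)%:R; set z := `|_ - _| => h1 h2.
have t0 : 0 < t by exact: lt_trans (expR_gt0 1) h2.
have l1 : 1 <= ln t by rewrite -[1]expRK ler_ln ?posrE ?expR_gt0 // ltW.
move: h1; rewrite ler_pdivlMr; last by lra.
move=> h1; apply: lt_le_trans h1.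
have := ler_norm y; have := normr_ge0 y => y0 y1.
have : y * (1 + ln t) <= `|y| * (1 + ln t) by apply: ler_wpM2r => //; lra.
have : `|y| * (1 + ln t) <= `|y| * (2 * ln t) by apply: ler_wpM2l => //; lra.
by lra.
Qed.

Lemma power_slow (R : realType) (alpha : R -> R) (l : R) :
  0 < l -> alpha x / x `^ l @[x --> +oo] --> 0 ->
  exists L : nat, forall c : R, 0 < c -> ~ evn (fun n => c * n%:R ^+ L <= alpha n%:R).
Proof.
move=> l0 /cvgr0Pnorm_le h.
have [L /andP[_ hL]] := truncn_ex R l (ltW l0).
exists L.+1 => c c0 [n0 hn].
have c2 : 0 < c / 2 by lra.
have [n1 h1] := ev_evn R _ (near_ev R _ (h _ c2)).
pose n := maxn 1 (maxn n0 n1).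
have : (n <= n)%N by [].
rewrite {1}/n !geq_max => /andP[n_1 /andP[n_0 n_n1]].
have := h1 n n_n1; have := hn n n_0.
have t1 : 1 <= n%:R :> R by rewrite ler1n.
have tl : n%:R `^ l <= n%:R ^+ L.+1 :> R.
  by rewrite -powR_mulrn //; apply: ler_powR => //; exact: ltW.
have tp : 0 < n%:R `^ l :> R by rewrite powR_gt0; lra.
rewrite normrM normfV (ger0_norm (ltW tp)) ler_pdivrMr //.
move=> h2 h3; have := ler_norm (alpha n%:R).
have : c / 2 * n%:R `^ l <= c / 2 * n%:R ^+ L.+1 by apply: ler_wpM2l => //; lra.
have : 0 < c * n%:R ^+ L.+1 by rewrite mulr_gt0 ?exprn_gt0; lra.
by lra.
Qed.

Theorem theorem1p7 (R : realType) (alpha : R -> R)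
    (alpha_subpoly : sub_polynomial alpha)
    (alpha_pinfty : alpha x @[x --> +oo] --> +oo)
    (alpha_far : forall (p : {poly rat}) (c : R),
      `|alpha x - c * (map_poly ratr p).[x]| / ln x @[x --> +oo] --> +oo)
    (A : set nat)
    (A_pos : A `<=` [set k : nat | (1 <= k)%N])
    (A_dens : (0 < upper_density R A)%E) :
  exists x y n : nat, [/\ A x, A y, x <> y, (1 <= n)%N
    & (x + y)%N%:Z = Num.floor (alpha n%:R)].
Proof.
have [[H HH Halpha] [l l0 al]] := alpha_subpoly.
have ainf T : ev R (fun x => T <= alpha x).
  by move/cvgryPge: alpha_pinfty => /(_ T); exact: near_ev.
have [delta d01 dense] := upper_density_pos R A A_dens.
have [L slow] := power_slow R alpha l l0 al.
have far p x y := far_from_poly R alpha p x y (alpha_far p x).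
have [x [y [n [Ax Ay xy n1 /andP[h1 h2]]]]] :=
  hardy_sequence_hits R H alpha HH Halpha ainf L A delta slow far d01 dense.
exists x, y, n; split => //; apply/esym/floor_def.
by rewrite intrD -!pmulrn natrD; apply/andP; split; lra.
Qed.
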